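(* Let $s\in(0,1)$, let $\Omega\subset\mathbb{R}^n$ be a bounded open set with Lipschitz boundary and let $E\subset\mathbb{R}^n$. Then $$P_s(E,\Omega)=\inf\Big\{\liminf_{h\to\infty}P_s(E_h,\Omega)\ \Big|\ E_h\subset\mathbb{R}^n\text{ open with smooth boundary, such that }E_h\xrightarrow{loc}E\Big\},$$ where the infimum is over all such sequences $\{E_h\}_{h\in\mathbb{N}}$ (and both sides may be $+\infty$).
   Context: All sets are Lebesgue measurable. For disjoint $A,B\subset\mathbb{R}^n$ put $\mathcal{L}_s(A,B)=\int_A\int_B\frac{dx\,dy}{|x-y|^{n+s}}\in[0,\infty]$. The $s$-perimeter of $E\subset\mathbb{R}^n$ in an open set $\Omega\subset\mathbb{R}^n$ is, writing $E^c=\mathbb{R}^n\setminus E$, $$P_s(E,\Omega)=\mathcal{L}_s(E\cap\Omega,E^c\cap\Omega)+\mathcal{L}_s(E\cap\Omega,E^c\setminus\Omega)+\mathcal{L}_s(E\setminus\Omega,E^c\cap\Omega).$$ $E_h\xrightarrow{loc}E$ means $\chi_{E_h}\to\chi_E$ in $L^1_{loc}(\mathbb{R}^n)$. Smooth means $C^\infty$. *)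

(* Defs.v *)
From HB Require Import structures.
From mathcomp Require Import all_boot all_order all_algebra.
From mathcomp Require Import all_classical all_reals all_analysis.

Set Implicit Arguments.
Unset Strict Implicit.
Unset Printing Implicit Defensive.

Import Order.TTheory GRing.Theory Num.Theory.
Import numFieldNormedType.Exports.

Local Open Scope classical_set_scope.
Local Open Scope ring_scope.

(** * Lebesgue measure on R^n

    R^n is ['rV[R]_n], with the library's topology.  On R^n we put the Borel
    sigma-algebra, presented as the one generated by the coordinates, then the
    n-fold product of [lebesgue_measure], and finally complete that product
    (Caratheodory) to get all Lebesgue measurable sets. *)

Definition rV_display : measure_display. Proof. exact: default_measure_display. Qed.

Section rV_measurable.
Variables (R : realType) (n : nat).

Definition rV_coord (i : 'I_n) (x : 'rV[R]_n) : measurableTypeR R := x 0 i.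

Let rV_set0 : g_sigma_preimage rV_coord set0.
Proof. exact: sigma_algebra0. Qed.

Let rV_setC A : g_sigma_preimage rV_coord A -> g_sigma_preimage rV_coord (~` A).
Proof. exact: sigma_algebraC. Qed.

Let rV_bigcup (F : (set 'rV[R]_n)^nat) :
  (forall i, g_sigma_preimage rV_coord (F i)) ->
  g_sigma_preimage rV_coord (\bigcup_i (F i)).
Proof. exact: sigma_algebra_bigcup. Qed.

HB.instance Definition _ := @isMeasurable.Build rV_display
  'rV[R]_n (g_sigma_preimage rV_coord) rV_set0 rV_setC rV_bigcup.

Lemma measurable_rV_coord (i : 'I_n) : measurable_fun setT (rV_coord i).
Proof.
move=> _ Y mY; rewrite setTI; apply: sub_sigma_algebra => /=.
rewrite -bigcup_seq/=; exists i => /=; first by rewrite mem_index_enum.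
by exists Y => //; rewrite setTI.
Qed.

Lemma measurable_fun_rVP d (T : measurableType d) (f : T -> 'rV[R]_n) :
  (forall i, measurable_fun setT (rV_coord i \o f)) -> measurable_fun setT f.
Proof.
move=> mf.
suff H : g_sigma_preimage (fun i => rV_coord i \o f) `<=` measurable.
  move=> _ A mA; apply: H; rewrite g_sigma_preimage_comp.
  by exists A.
apply: smallest_sub; first exact: sigma_algebra_measurable.
rewrite -bigcup_seq; apply: bigcup_sub => i _ A [B mB <-].
exact: mf.
Qed.

End rV_measurable.

Section borel_lebesgue.
Variable R : realType.

Definition rV_cons n (p : measurableTypeR R * 'rV[R]_n) : 'rV[R]_n.+1 :=
  row_mx (const_mx p.1 : 'rV[R]_1) p.2.

Lemma measurable_rV_cons n : measurable_fun setT (@rV_cons n).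
Proof.
apply: measurable_fun_rVP => i.
have [j ->|j ->] := @fintype.split_ordP 1 n i.
- rewrite (_ : _ \o _ = fst); first exact: measurable_fst.
  apply/funext => p /=.
  by rewrite [LHS](@row_mxEl R 1 1 n) mxE.
- rewrite (_ : _ \o _ = (@rV_coord R n j \o snd)).
    by apply: measurableT_comp => //; exact: measurable_rV_coord.
  by apply/funext => p; exact: (@row_mxEr R 1 1 n).
Qed.

Fixpoint borel_lebesgue n : set 'rV[R]_n -> \bar R :=
  if n is m.+1 then
    pushforward (@lebesgue_measure R \x @borel_lebesgue m)%E (@rV_cons m)
  else \d_(0 : 'rV[R]_0).
Arguments borel_lebesgue : clear implicits.

Lemma pushforward_rV_cons_sigma_finite n
    (mu : {sigma_finite_measure set 'rV[R]_n -> \bar R}) :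
  sigma_finite setT (pushforward (@lebesgue_measure R \x mu)%E (@rV_cons n)).
Proof.
have /sigma_finiteP[F [FT ndF Foo]] := sigma_finiteT (@lebesgue_measure R).
have /sigma_finiteP[G [GT ndG Goo]] := sigma_finiteT mu.
have mc : measurable_fun setT
    (fun x : 'rV[R]_n.+1 => (rV_coord (@lshift 1 n ord0) x,
       (\row_j x 0 (@rshift 1 n j) : 'rV[R]_n))).
  apply/measurable_fun_pairP; split; first exact: measurable_rV_coord.
  apply: measurable_fun_rVP => i.
  rewrite (_ : _ \o _ = rV_coord (@rshift 1 n i)); first exact: measurable_rV_coord.
  by apply/funext => x; rewrite /rV_coord /= mxE.
set c := (fun x : 'rV[R]_n.+1 => _) in mc.
have cK p : c (rV_cons p) = p.
  case: p => a v; congr pair; first by rewrite [LHS](@row_mxEl R 1 1 n) mxE.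
  by apply/rowP => j; rewrite mxE [LHS](@row_mxEr R 1 1 n).
exists (fun k => c @^-1` (F k `*` G k)).
  rewrite -preimage_bigcup -[LHS](preimage_setT c); congr (_ @^-1` _).
  rewrite -setXTT FT GT; apply/seteqP; split=> [[x y] [/= [i _ Fx] [j _ Gy]]|].
    exists (maxn i j) => //; split => /=.
      by apply: (subsetPset _ _ (ndF _ _ (leq_maxl i j))).
    by apply: (subsetPset _ _ (ndG _ _ (leq_maxr i j))).
  by move=> [x y] [k _ [/= Fx Gy]]; split; exists k.
move=> k; have [mF Fk] := Foo k; have [mG Gk] := Goo k; split.
  by rewrite -[X in measurable X]setTI; apply: mc => //; exact: measurableX.
rewrite /pushforward -comp_preimage (_ : c \o _ = id).
  by rewrite preimage_id product_measure1E// lte_mul_pinfty// ge0_fin_numE.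
by apply/funext => p /=; exact: cK.
Qed.

Section pushforward_rV_cons_measure.
Variables (n : nat) (mu : {sigma_finite_measure set 'rV[R]_n -> \bar R}).

Let nu : set 'rV[R]_n.+1 -> \bar R :=
  pushforward (@lebesgue_measure R \x mu)%E (@rV_cons n).

Let P : {measure set (measurableTypeR R * 'rV[R]_n)%type -> \bar R} :=
  (@lebesgue_measure R \x mu)%E.

Let nu0 : nu set0 = 0%E.
Proof. exact: (measure0 P). Qed.

Let nu_ge0 A : (0 <= nu A)%E.
Proof. exact: (measure_ge0 P). Qed.

Let nu_sigma_additive : semi_sigma_additive nu.
Proof.
move=> F mF tF mUF; rewrite /nu /pushforward preimage_bigcup.
apply: (@measure_semi_sigma_additive _ _ _ P (fun k => @rV_cons n @^-1` F k)).
- by move=> k; rewrite -[X in measurable X]setTI; exact: measurable_rV_cons.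
- apply/trivIsetP => /= i j _ _ ij; rewrite -preimage_setI.
  by move/trivIsetP : tF => /(_ _ _ _ _ ij) ->//; rewrite preimage_set0.
- rewrite -preimage_bigcup -[X in measurable X]setTI.
  exact: measurable_rV_cons.
Qed.

HB.instance Definition _ := isMeasure.Build _ _ _ nu
  nu0 nu_ge0 nu_sigma_additive.

HB.instance Definition _ := Measure_isSigmaFinite.Build _ _ _ nu
  (pushforward_rV_cons_sigma_finite mu).

Definition pushforward_rV_cons :
  {sigma_finite_measure set 'rV[R]_n.+1 -> \bar R} := nu.

End pushforward_rV_cons_measure.

Lemma borel_lebesgue_is_measure n :
  exists mu : {sigma_finite_measure set 'rV[R]_n -> \bar R},
    mu = borel_lebesgue n :> (set 'rV[R]_n -> \bar R).
Proof.
elim: n => [|n [mu mE]].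
  by exists [the {sigma_finite_measure set 'rV[R]_0 -> \bar R} of \d_(0 : 'rV[R]_0)].
by exists (pushforward_rV_cons mu); rewrite /= -mE.
Qed.

Let borel_lebesgue0 n : borel_lebesgue n set0 = 0%E.
Proof. by have [mu <-] := borel_lebesgue_is_measure n; exact: measure0. Qed.

Let borel_lebesgue_ge0 n A : (0 <= borel_lebesgue n A)%E.
Proof. by have [mu <-] := borel_lebesgue_is_measure n; exact: measure_ge0. Qed.

Let borel_lebesgue_sigma_additive n : semi_sigma_additive (borel_lebesgue n).
Proof.
by have [mu <-] := borel_lebesgue_is_measure n; exact: measure_semi_sigma_additive.
Qed.

HB.instance Definition _ n := isMeasure.Build _ _ _ (borel_lebesgue n)
  (borel_lebesgue0 n) (@borel_lebesgue_ge0 n) (@borel_lebesgue_sigma_additive n).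

Let borel_lebesgue_sigma_finite n : sigma_finite setT (borel_lebesgue n).
Proof. by have [mu <-] := borel_lebesgue_is_measure n; exact: sigma_finiteT. Qed.

HB.instance Definition _ n := Measure_isSigmaFinite.Build _ _ _
  (borel_lebesgue n) (borel_lebesgue_sigma_finite n).

Lemma borel_lebesgue_box n (A : 'I_n -> set (measurableTypeR R)) :
  (forall i, measurable (A i)) ->
  borel_lebesgue n [set x | forall i, A i (x 0 i)] =
  (\prod_(i < n) lebesgue_measure (A i))%E.
Proof.
elim: n A => [|n IH] A mA.
  rewrite big_ord0 /= diracE mem_set// => -[]; by [].
rewrite big_ord_recl /= /pushforward -(IH (fun i => A (lift ord0 i)))//.
have mB : measurable [set x : 'rV[R]_n | forall i, A (lift ord0 i) (x 0 i)].
  rewrite (_ : mkset _ = \big[setI/setT]_(i < n)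
      (@rV_coord R n i @^-1` A (lift ord0 i))).
    apply: bigsetI_measurable => i _.
    by rewrite -[X in measurable X]setTI; exact: measurable_rV_coord.
  rewrite -bigcap_seq; apply/seteqP; split=> x H i; first by move=> _; exact: H.
  by apply: H; rewrite /= mem_index_enum.
rewrite -product_measure1E//; congr (_ _).
have E0 (p : measurableTypeR R * 'rV[R]_n) : rV_cons p 0 ord0 = p.1.
  rewrite (_ : ord0 = @lshift 1 n ord0); last exact: val_inj.
  by rewrite [LHS](@row_mxEl R 1 1 n) mxE.
have E1 (p : measurableTypeR R * 'rV[R]_n) j : rV_cons p 0 (lift ord0 j) = p.2 0 j.
  rewrite (_ : lift ord0 j = @rshift 1 n j); last exact: val_inj.
  exact: (@row_mxEr R 1 1 n).
apply/seteqP; split=> [p H|p [H0 H1] i] /=.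
  by split=> [|i] /=; [rewrite -E0; exact: H|rewrite -E1; exact: H].
by have [j ->|->] := unliftP ord0 i; [rewrite E1; exact: H1|rewrite E0].
Qed.

End borel_lebesgue.
Arguments borel_lebesgue : clear implicits.

Section lebesgue_space.
Variables (R : realType) (n : nat).

(* R^n equipped with the sigma-algebra of all its Lebesgue measurable sets. *)
Definition lebesgue_space := caratheodory_type ((borel_lebesgue R n)^*)%mu.

Definition lebesgue : {measure set lebesgue_space -> \bar R} :=
  @completed_measure_extension _ _ _ (borel_lebesgue R n).

Definition lebesgue_measurable (A : set 'rV[R]_n) : Prop :=
  ((borel_lebesgue R n)^*)%mu.-cara.-measurable A.

(* The library's norm on ['rV[R]_n] is the sup norm. *)
Definition euclidean_norm (x : 'rV[R]_n) : R :=
  Num.sqrt (\sum_(i < n) x 0 i ^+ 2).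

End lebesgue_space.
Arguments lebesgue : clear implicits.

Section fractional_perimeter.
Variables (R : realType) (n : nat) (s : R).
Local Open Scope ereal_scope.

(* On the diagonal, never met when A and B are disjoint, the kernel is 0. *)
Definition interaction (A B : set 'rV[R]_n) : \bar R :=
  \int[lebesgue R n]_(x in A) \int[lebesgue R n]_(y in B)
    ((euclidean_norm (x - y) `^ (n%:R + s))^-1)%R%:E.

Definition s_perimeter (E Omega : set 'rV[R]_n) : \bar R :=
  interaction (E `&` Omega) (~` E `&` Omega) +
  interaction (E `&` Omega) (~` E `\` Omega) +
  interaction (E `\` Omega) (~` E `&` Omega).

(* Convergence of the characteristic functions in L^1_loc. *)
Definition loc_cvg (F : (set 'rV[R]_n)^nat) (E : set 'rV[R]_n) : Prop :=
  forall K : set 'rV[R]_n, compact K ->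
    \int[lebesgue R n]_(x in K) (`|\1_(F h) x - \1_E x|)%R%:E @[h --> \oo] --> 0.

End fractional_perimeter.

Section boundary_regularity.
Variable R : realType.

Definition boundary n (U : set 'rV[R]_n) : set 'rV[R]_n := closure U `\` U°.

(* C^k: all iterated partial derivatives of order at most k exist and are
   continuous. *)
Fixpoint Ck k m (f : 'rV[R]_m -> R) : Prop :=
  continuous f /\
  if k is k'.+1 then
    forall i : 'I_m, (forall x, derivable f x (delta_mx 0 i)) /\
                     Ck k' (fun x => 'D_(delta_mx 0 i) f x)
  else True.

Definition smooth m (f : 'rV[R]_m -> R) : Prop := forall k, Ck k f.

(* Near each of its boundary points and in suitable orthonormal coordinates
   [x *m Q], the set U is the strict epigraph of a function of class C in the
   n-1 coordinates other than the i-th one. *)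
Definition graph_boundary n (C : set ('rV[R]_n.-1 -> R)) (U : set 'rV[R]_n) :=
  forall p, boundary U p ->
    exists (Q : 'M[R]_n) (i : 'I_n) (phi : 'rV[R]_n.-1 -> R),
      [/\ Q *m Q^T = 1%:M, C phi &
          \forall x \near p, U x <-> phi (col' i (x *m Q)) < (x *m Q) 0 i].

(* [lipschitz] refers to the sup norm, hence agrees with the Euclidean notion
   up to the value of the constant. *)
Definition lipschitz_boundary n (U : set 'rV[R]_n) : Prop :=
  graph_boundary [set phi : 'rV[R]_n.-1 -> R^o | lipschitz phi] U.

Definition smooth_boundary n (U : set 'rV[R]_n) : Prop :=
  graph_boundary (@smooth n.-1) U.

End boundary_regularity.

(* Main.v *)
(* Let K(x, y) = |x - y|^-(n+s), let W be its restriction to the pairs that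
   touch Omega, and write the s-perimeter as the double integral of W over
   E x E^c.  Truncating W gives the lower semicontinuity.

   Conversely, let P_s(E, Omega) be finite.  As the boundary of Omega has finite
   Minkowski content, Omega has finite K-energy.  The sets that can be
   approximated by sets of finite K-energy, with respect to an integrable weight
   controlling the interaction with Omega, form a sigma-algebra containing the
   half-spaces; this allows one to replace E outside Omega by a bounded set so
   that the total K-energy becomes finite.  For such an E let u be the function
   equal on each cube of a fine grid to the density of E there.  The W-energy of
   u is at most that of an average of W over pairs of cubes, which is dominated
   by a multiple of K and tends to W; by an averaging argument in place of the
   coarea formula, some superlevel set of u, a finite union of cubes, has almost
   the energy of E.  Finally each cube is replaced by a smooth convex set
   sum_i z_i^(2N) < t inside it: for large N and a suitable level t, the energy
   of what is removed is small, and the sets so obtained are disjoint and at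
   positive distance from each other. *)
Require Import Defs.
From HB Require Import structures.
From mathcomp Require Import all_boot all_order all_algebra.
From mathcomp Require Import all_classical all_reals all_analysis.
From mathcomp Require Import measurable_realfun ring lra.

Set Implicit Arguments.
Unset Strict Implicit.
Unset Printing Implicit Defensive.

Import Order.TTheory GRing.Theory Num.Theory.
Import numFieldNormedType.Exports.

Local Open Scope classical_set_scope.
Local Open Scope ring_scope.

(** * Energies *)

(** Finiteness of P_s(E, Omega) says nothing about the interaction of E with its complement away
    from Omega. The grid argument needs more: an average of W over two cubes crossing the boundary
    of Omega is not bounded by a multiple of W, only by one of K, so dominated convergence on E x
    E^c asks for finite K-energy. Hence E is first modified outside Omega, at a cost measured by the
    potential y -> int_Omega K(x, y) dx, which is integrable off Omega because Omega itself has
    finite K-energy. A level t of u separates x from y on a set of measure at most u(x) - u(y) <=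
    u(x)(1 - u(y)), and this product, integrated against W over pairs in distinct cubes, is exactly
    the averaged energy of E. The comparison with E thus needs no estimate of |u(x) - u(y)|. Cubes
    of the grid may touch, so smoothing has to open gaps between them cheaply. The level of each
    smooth body is chosen by the same averaging. Its defining function has slope of order N, the
    layer where the level varies has measure of order 1/N, and the two powers of N cancel: at
    distance 2^-j the estimate is O(2^-j) uniformly in N, while the total measure of the layer tends
    to 0. *)

(* The library's product measure loses its sigma-finite instance to the one of
   sub-probabilities, hence this copy. *)
Definition sf_product d1 d2 (T1 : measurableType d1) (T2 : measurableType d2) (R : realType)
    (m1 : {sigma_finite_measure set T1 -> \bar R})
    (m2 : {sigma_finite_measure set T2 -> \bar R}) : set (T1 * T2) -> \bar R :=
  (m1 \x m2)%E.

Section sf_product.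
Context d1 d2 (T1 : measurableType d1) (T2 : measurableType d2) (R : realType).
Variable m1 : {sigma_finite_measure set T1 -> \bar R}.
Variable m2 : {sigma_finite_measure set T2 -> \bar R}.

HB.instance Definition _ := Measure.copy (sf_product m1 m2) (m1 \x m2)%E.

Let sf_product_sigma_finite : sigma_finite setT (sf_product m1 m2).
Proof.
have /sigma_finiteP[F [TF ndF Foo]] := sigma_finiteT m1.
have /sigma_finiteP[G [TG ndG Goo]] := sigma_finiteT m2.
exists (fun n => F n `*` G n) => [|k]; last first.
  have [? ?] := Foo k; have [? ?] := Goo k; split; first exact: measurableX.
  by rewrite /sf_product product_measure1E// lte_mul_pinfty// ge0_fin_numE.
rewrite -setXTT TF TG; apply/seteqP; split=> [[x y] [/= [i _ Fx] [j _ Gy]]|].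
  exists (maxn i j) => //; split.
    exact: (subsetPset _ _ (ndF _ _ (leq_maxl i j))).
  exact: (subsetPset _ _ (ndG _ _ (leq_maxr i j))).
by move=> [x y] [k _ [/= ? ?]]; split; exists k.
Qed.

HB.instance Definition _ := Measure_isSigmaFinite.Build _ _ _ (sf_product m1 m2)
  sf_product_sigma_finite.

End sf_product.

(** Tonelli for [W] on [S]: integrated first in [x] it is at most the integral of [g W], integrated
    first in [y] it is at least [c] for every [x] in [I]. *)
Lemma averaging d1 d2 (X : measurableType d1) (Y : measurableType d2) (R : realType)
  (m1 : {sigma_finite_measure set X -> \bar R}) (m2 : {sigma_finite_measure set Y -> \bar R})
  (I : set X) (S : set (X * Y)) (W g : Y -> R) (c : R) :
  measurable I -> measurable S -> measurable_fun setT W -> measurable_fun setT g ->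
  (forall y, 0 <= W y) -> 0 <= c ->
  (forall y, (m1 (I `&` ysection S y) <= (g y)%:E)%E) ->
  (forall x, I x -> (c%:E <= \int[m2]_(y in xsection S x) (W y)%:E)%E) ->
  (c%:E * m1 I <= \int[m2]_y (g y * W y)%:E)%E.
Proof.
move=> mI mS mW mg W0 c0 Hg Hc.
pose f (p : X * Y) := (\1_(I `*` setT `&` S) p * W p.2)%:E.
have mS' : measurable (I `*` setT `&` S) by apply: measurableI => //; exact: measurableX.
have mf : measurable_fun setT f.
  apply/measurable_EFinP; apply: measurable_funM; first exact: measurable_indic.
  exact: (measurableT_comp mW measurable_snd).
have f0 p : (0 <= f p)%E by rewrite lee_fin mulr_ge0.
apply: (@le_trans _ _ (\int[m1]_x \int[m2]_y f (x, y))%E); last first.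
  rewrite (fubini_tonelli f mf f0); apply: ge0_le_integral => //.
  - by move=> y _; apply: integral_ge0.
  - exact: measurable_fun_fubini_tonelli_G.
  - by apply/measurable_EFinP; exact: measurable_funM.
  move=> y _; rewrite /f.
  have mSy : measurable (I `&` ysection S y) by apply: measurableI => //; exact: measurable_ysection.
  rewrite (_ : (\int[m1]_x _)%E = (\int[m1]_x ((W y)%:E * (\1_(I `&` ysection S y) x)%:E))%E); last first.
    apply: eq_integral => x _; rewrite -EFinM mulrC; congr (_ * _)%:E.
    rewrite !indicE /ysection/=; congr (_%:R); congr nat_of_bool.
    by apply/idP/idP; rewrite !inE/= inE/= => -[] // [] Ix ?.
  rewrite ge0_integralZl//.
  - by rewrite integral_indic// setIT EFinM muleC; apply: lee_wpmul2r; [rewrite lee_fin|exact: Hg].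
  - by apply/measurable_EFinP; exact: measurable_indic.
  - by rewrite lee_fin.
rewrite -integral_cst// integral_mkcond; apply: ge0_le_integral => //.
- by move=> t _; apply: erestrict_ge0 => u _; rewrite lee_fin.
- by apply/(measurable_restrictT _ _).1.
- exact: measurable_fun_fubini_tonelli_F.
move=> x _; rewrite patchE; case: ifPn => [|_]; last exact: integral_ge0.
rewrite inE => Ix; apply: (le_trans (Hc x Ix)).
rewrite integral_mkcond le_eqVlt; apply/orP; left; apply/eqP; apply: eq_integral => y _.
rewrite patchE /f /=; have -> : \1_(I `*` setT `&` S) (x, y) = (y \in xsection S x)%:R :> R.
  rewrite indicE; congr (_%:R); congr nat_of_bool.
  by apply/idP/idP; rewrite /xsection !inE/= inE // => -[].
by case: ifPn => _; rewrite ?mul1r ?mul0r.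
Qed.

Section energy.
Context d (T : measurableType d) (R : realType).
Variable mu : {sigma_finite_measure set T -> \bar R}.
Local Open Scope ereal_scope.

Lemma le_integral_setU d' (S : measurableType d') (m : {measure set S -> \bar R})
    (A B : set S) (f : S -> \bar R) : measurable A -> measurable B ->
  measurable_fun setT f -> (forall x, 0 <= f x) ->
  \int[m]_(x in A `|` B) f x <= \int[m]_(x in A) f x + \int[m]_(x in B) f x.
Proof.
move=> mA mB mf f0.
have -> : A `|` B = A `|` (B `\` A) by rewrite setDE setUIr setUCr setIT.
have mBA : measurable (B `\` A) by exact: measurableD.
rewrite ge0_integral_setU//; last 2 first.
- by apply: measurable_funS mf.
- by apply/disj_setPS => x [] Ax [].
apply: leeD => //; apply: ge0_subset_integral => //.
by apply: measurable_funS mf.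
Qed.

Definition energy (W : T * T -> R) (A : set T) : \bar R :=
  \int[mu \x mu]_(z in A `*` ~` A) (W z)%:E.

Variable W : T * T -> R.
Hypothesis mW : measurable_fun setT W.
Hypothesis W0 : forall z, (0 <= W z)%R.

Let mWE D : measurable_fun D (fun z => (W z)%:E).
Proof. by apply/measurable_EFinP; exact: measurable_funS mW. Qed.

Lemma energy_ge0 A : 0 <= energy W A.
Proof. by apply: integral_ge0 => z _; rewrite lee_fin. Qed.

(** Since the energy is an integral over ordered pairs, subadditivity under set operations reduces
    to an inclusion between sets of pairs. *)
Lemma le_energy_union2 (A B C : set T) : measurable A -> measurable B -> measurable C ->
  A `*` ~` A `<=` (B `*` ~` B) `|` (C `*` ~` C) -> energy W A <= energy W B + energy W C.
Proof.
move=> mA mB mC H.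
have mX (D : set T) : measurable D -> measurable (D `*` ~` D).
  by move=> mD; apply: measurableX => //; exact: measurableC.
apply: (@le_trans _ _ (\int[mu \x mu]_(z in (B `*` ~` B) `|` (C `*` ~` C)) (W z)%:E)).
  apply: ge0_subset_integral => //; first exact: mX.
    by apply: measurableU; exact: mX.
  by move=> z _; rewrite lee_fin.
by apply: le_integral_setU => //; exact: mX.
Qed.

Lemma le_energyI (A B : set T) : measurable A -> measurable B ->
  energy W (A `&` B) <= energy W A + energy W B.
Proof.
move=> mA mB; apply: le_energy_union2 => //; first exact: measurableI.
move=> [x y] /= [[Ax Bx]] /not_andP[nA|nB]; by [left|right].
Qed.

Lemma le_energyU (A B : set T) : measurable A -> measurable B ->
  energy W (A `|` B) <= energy W A + energy W B.
Proof.
move=> mA mB; apply: le_energy_union2 => //; first exact: measurableU.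
move=> [x y] /= [[Ax|Bx]] /not_orP[nA nB]; by [left|right].
Qed.

Lemma integral_swap (f : T * T -> \bar R) : measurable_fun setT f -> (forall z, 0 <= f z) ->
  \int[mu \x mu]_z f (z.2, z.1) = \int[mu \x mu]_z f z.
Proof.
move=> mf f0.
rewrite [RHS]fubini_tonelli2// fubini_tonelli1//.
by apply: (measurableT_comp mf); exact: measurable_swap.
Qed.

Lemma energyC (A : set T) : (forall x y, W (x, y) = W (y, x)) -> measurable A ->
  energy W (~` A) = energy W A.
Proof.
move=> sW mA; have mA' := measurableC mA.
rewrite /energy setCK [LHS]integral_mkcond [RHS]integral_mkcond -[RHS]integral_swap//; last 2 first.
- by apply/(measurable_restrictT _ _).1 => //; exact: measurableX.
- by move=> z; apply: erestrict_ge0 => w _; rewrite lee_fin.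
apply: eq_integral => -[x y] _; rewrite !patchE /= sW.
by congr (if _ then _ else _); rewrite !in_setX /= andbC.
Qed.

(** The substitute for the coarea formula: [g z] bounds the measure of the parameters that separate
    the pair [z]. If all parameters gave an energy above [c], [averaging] would bound the integral
    of [g W] below by [c (b - a)]. It is applied to superlevel sets of cell densities and to the
    layers removed when a cube is rounded. *)
Lemma energy_selection (D : R -> set T) (g : T * T -> R) (a b c : R) :
  measurable [set p : measurableTypeR R * T | D p.1 p.2] ->
  measurable_fun setT g ->
  (a < b)%R -> (forall z,
    (@lebesgue_measure R) [set t | [/\ (a < t < b)%R, D t z.1 & ~ D t z.2]] <= (g z)%:E) ->
  \int[mu \x mu]_z (g z * W z)%:E < (c * (b - a))%:E ->
  exists t, (a < t < b)%R /\ energy W (D t) <= c%:E.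
Proof.
move=> mD mg ab Dg Ic.
have c0 : (0 <= c)%R.
  rewrite -(@pmulr_lge0 _ (b - a)) ?subr_gt0// -lee_fin.
  apply: le_trans (ltW Ic); apply: integral_ge0 => z _.
  by rewrite lee_fin mulr_ge0// -lee_fin (le_trans _ (Dg z)).
apply: contrapT => /forallNP H.
move: Ic; apply/negP; rewrite -leNgt.
pose I : set (measurableTypeR R) := `]a, b[%classic.
pose D1 : set (measurableTypeR R * T) := [set p | D p.1 p.2].
(* The section of [S] at [t] is [D t] times its complement, so integrating [W] over it gives the
   energy of [D t]. *)
pose S : set (measurableTypeR R * (T * T)) :=
  ((fun p => (p.1, p.2.1)) @^-1` D1) `&` ((fun p => (p.1, p.2.2)) @^-1` (~` D1)).
have mp1 : measurable_fun [set: measurableTypeR R * (T * T)] (fun p => (p.1, p.2.1)).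
  apply/measurable_fun_pairP; split; first exact: measurable_fst.
  exact: (measurableT_comp measurable_fst measurable_snd).
have mp2 : measurable_fun [set: measurableTypeR R * (T * T)] (fun p => (p.1, p.2.2)).
  apply/measurable_fun_pairP; split; first exact: measurable_fst.
  exact: (measurableT_comp measurable_snd measurable_snd).
have mS : measurable S.
  apply: measurableI; first by rewrite -[X in measurable X]setTI; exact: mp1.
  by rewrite -[X in measurable X]setTI; apply: mp2 => //; exact: measurableC.
have -> : (c * (b - a))%:E = c%:E * (@lebesgue_measure R) I.
  by rewrite EFinM lebesgue_measure_itv/= lte_fin ab.
apply: (@averaging _ _ _ _ _ (@lebesgue_measure R) (sf_product mu mu) I S W g c) => //.
- exact: measurable_itv.
- move=> z; apply: le_trans (Dg z); rewrite (_ : _ `&` _ = [set t | [/\ (a < t < b)%R, D t z.1 & ~ D t z.2]])//.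
  apply/seteqP; split=> [t|t] /=; rewrite /ysection/= inE /I/= in_itv/=.
    by move=> [? [? ?]].
  by move=> [? ? ?].
- move=> t; rewrite /I/= in_itv/= => tab; have := H t; rewrite not_andP => -[//|/negP].
  rewrite -ltNge => /ltW /le_trans; apply; rewrite /energy.
  rewrite (_ : _ `*` _ = xsection S t)//; apply/seteqP; split=> [[x y]|[x y]] /=.
    by move=> [? ?]; rewrite /xsection/= inE.
  by rewrite /xsection/= inE => -[].
Qed.
End energy.

Lemma limn_einf_ge (R : realType) (u : (\bar R)^nat) (a : \bar R) :
  (\forall h \near \oo, (a <= u h)%E) -> (a <= limn_einf u)%E.
Proof.
move=> [N _ H]; rewrite limn_einf_lim; apply: lime_ge; first exact: is_cvg_einfs.
exists N => // k /= Nk; apply: le_ereal_inf_tmp => _ [m /= km <-].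
by apply: H => /=; exact: leq_trans km.
Qed.

Lemma cvge0_near_le (R : realType) (u : (\bar R)^nat) (e : R) :
  u @ \oo --> 0%E -> 0 < e -> \forall h \near \oo, (u h <= e%:E)%E.
Proof.
move=> /fine_cvgP[fu /cvgr0Pnorm_lt H] e0; near=> h.
have fh : u h \is a fin_num by near: h.
rewrite -(fineK fh) lee_fin (le_trans (ler_norm _))// ltW//.
by near: h; exact: H.
Unshelve. all: by end_near.
Qed.

(** * Lower semicontinuity of the energy *)

Section energy_lsc.
Context d (T : measurableType d) (R : realType).
Variable mu : {sigma_finite_measure set T -> \bar R}.
Local Open Scope ereal_scope.

(** The truncations [WM M] are bounded by [M] and live on a set of finite measure, so the
    corresponding energies are controlled by L^1 distances on [B M]; they increase to [W], and
    monotone convergence recovers the energy of [E]. *)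
Lemma energy_lsc (W : T * T -> R) (F : (set T)^nat) (E : set T) (B : (set T)^nat) :
  measurable_fun setT W -> (forall z, 0 <= W z)%R ->
  (forall h, measurable (F h)) -> measurable E ->
  (forall M, measurable (B M)) -> (forall M, mu (B M) < +oo) ->
  nondecreasing_seq B -> \bigcup_M B M = setT ->
  (forall M, \int[mu]_(x in B M) (`|\1_(F h) x - \1_E x|)%R%:E @[h --> \oo] --> 0) ->
  energy mu W E <= limn_einf (fun h => energy mu W (F h)).
Proof.
move=> mW W0 mF mE mB Boo ndB BT FE.
pose WM (M : nat) z := (Num.min (W z) M%:R * \1_(B M `*` B M) z)%R.
have mWM M : measurable_fun setT (WM M).
  apply: measurable_funM; last by apply: measurable_indic; exact: measurableX.
  by apply: measurable_minr => //; exact: measurable_cst.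
have WM0 M z : (0 <= WM M z)%R by rewrite mulr_ge0// le_min W0/=.
have mEE D : measurable_fun D (fun z => (W z)%:E).
  by apply/measurable_EFinP; exact: measurable_funS mW.
have mMEE M D : measurable_fun D (fun z => (WM M z)%:E).
  by apply/measurable_EFinP; exact: measurable_funS (mWM M).
have mXC (A : set T) : measurable A -> measurable (A `*` ~` A).
  by move=> mA; apply: measurableX => //; exact: measurableC.
have WMW M z : (WM M z <= W z)%R.
  rewrite /WM indicE; case: (_ \in _); rewrite ?mulr1 ?mulr0//.
  by rewrite ge_min lexx.
have WMM M z : (WM M z <= M%:R)%R.
  rewrite /WM indicE; case: (_ \in _); rewrite ?mulr1 ?mulr0//.
  by rewrite ge_min lexx orbT.
have cvgM : energy mu (WM M) E @[M --> \oo] --> energy mu W E.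
  have cvgz z : (WM M z)%:E @[M --> \oo] --> (W z)%:E.
    apply/fine_cvgP; split; first by apply: nearW.
    apply: cvg_near_cst.
    have [k1 _ Bk1] : (\bigcup_M B M) z.1 by rewrite BT.
    have [k2 _ Bk2] : (\bigcup_M B M) z.2 by rewrite BT.
    have [k3 Wk3] : exists k, (W z <= k%:R)%R.
      by exists (Num.bound (W z)); rewrite ltW// archi_boundP.
    exists (maxn k3 (maxn k1 k2)) => // k /=; rewrite !geq_max => /and3P[k3k k1k k2k].
    rewrite /WM min_l ?(le_trans Wk3) ?ler_nat// indicE mem_set ?mulr1//.
    split; first by have /subsetPset := ndB _ _ k1k; exact.
    by have /subsetPset := ndB _ _ k2k; exact.
  have -> : energy mu W E = \int[mu \x mu]_(z in E `*` ~` E) limn (fun M => (WM M z)%:E).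
    by apply: eq_integral => z _; apply/esym/cvg_lim.
  apply: cvg_monotone_convergence => //.
  - exact: mXC.
  - by move=> M z _; rewrite lee_fin.
  - move=> z _ m n mn; rewrite lee_fin /WM; apply: ler_pM => //.
    + by rewrite le_min W0/=.
    + by rewrite le_min !ge_min lexx /= ler_nat mn orbT.
    + rewrite !indicE ler_nat; case: (boolP (z \in B m `*` B m)) => //.
      rewrite inE => -[Bz1 Bz2]; rewrite mem_set//.
      by have /subsetPset H := ndB _ _ mn; split; exact: H.
rewrite -(cvg_lim _ cvgM)//; apply: lime_le; first by apply/cvg_ex; eexists; exact: cvgM.
apply: nearW => M.
pose dl h := \int[mu]_(x in B M) (`|\1_(F h) x - \1_E x|)%R%:E.
(* A pair of points of [B M] that leaves [E] also leaves [F h], unless its first point is in [E]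
   minus [F h] or its second one in [F h] minus [E]. Each exception costs at most [M mu(B M) dl h],
   whence the factor 2. *)
have H1 h : energy mu (WM M) E <= energy mu W (F h) + (M%:R * 2%:R)%:E * mu (B M) * dl h.
  have mEF : measurable ((E `\` F h) `&` B M) by apply: measurableI => //; exact: measurableD.
  have mFE : measurable ((F h `\` E) `&` B M) by apply: measurableI => //; exact: measurableD.
  have mFX := mXC _ (mF h).
  pose Y1 := ((E `\` F h) `&` B M) `*` B M; pose Y2 := B M `*` ((F h `\` E) `&` B M).
  have mY1 : measurable Y1 by exact: measurableX.
  have mY2 : measurable Y2 by exact: measurableX.
  pose Z := (F h `*` ~` F h) `|` (Y1 `|` Y2).
  have mZ : measurable Z by apply: measurableU => //; exact: measurableU.
  have -> : energy mu (WM M) E = \int[mu \x mu]_(z in (E `*` ~` E) `&` (B M `*` B M)) (WM M z)%:E.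
    rewrite /energy [RHS]integral_mkcondr; apply: eq_integral => z _.
    rewrite patchE; case: ifPn => // zB; rewrite /WM indicE (negbTE zB) mulr0//.
  apply: (@le_trans _ _ (\int[mu \x mu]_(z in Z) (WM M z)%:E)).
    apply: ge0_subset_integral => //.
    - by apply: measurableI; [exact: mXC|exact: measurableX].
    - by move=> z _; rewrite lee_fin.
    move=> [x y] /= [[Ex Ey] [Bx By]].
    have [Fx|Fx] := pselect (F h x); last by right; left.
    by have [Fy|Fy] := pselect (F h y); [right; right|left].
  have dlE A : measurable A -> A `<=` [set x | (E x /\ ~ F h x) \/ (F h x /\ ~ E x)] -> A `<=` B M -> mu A <= dl h.
    move=> mA AS AB; rewrite -[A]setIT -integral_indic// integral_mkcond.
    rewrite /dl [leRHS]integral_mkcond; apply: ge0_le_integral => //.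
    - by move=> x _; apply: erestrict_ge0 => ? _; rewrite lee_fin.
    - by apply/(measurable_restrictT _ _).1 => //; apply/measurable_EFinP; exact: measurable_indic.
    - apply/(measurable_restrictT _ _).1 => //; apply/measurable_EFinP.
      apply: measurableT_comp => //; apply: measurable_funB; exact: measurable_indic.
    move=> x _; rewrite !patchE in_setT; case: ifPn => [xB|/negP xB]; last first.
      by rewrite lee_fin indicE memNset//= => /AB xB'; apply: xB; rewrite inE.
    rewrite lee_fin indicE; have [xA|xA] := boolP (x \in A); last exact: normr_ge0.
    move: xA; rewrite inE => /AS /=.
    move=> [[Ex Fx]|[Fx Ex]]; rewrite !indicE.
      by rewrite (mem_set Ex) memNset//= sub0r normrN normr1.
    by rewrite (mem_set Fx) memNset//= subr0 normr1.
  have WM0' z : 0 <= (WM M z)%:E by rewrite lee_fin.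
  have mY12 : measurable (Y1 `|` Y2) by exact: measurableU.
  have U1 := le_integral_setU (mu \x mu)%E mFX mY12 (mMEE M setT) WM0'.
  have U2 := le_integral_setU (mu \x mu)%E mY1 mY2 (mMEE M setT) WM0'.
  apply: (le_trans U1).
  have cM : (0 <= M%:R%:E :> \bar R) by rewrite lee_fin.
  apply: leeD.
    by apply: ge0_le_integral => // z _; rewrite lee_fin.
  apply: (le_trans U2).
  have Hm A : measurable A -> \int[mu \x mu]_(z in A) (WM M z)%:E <= M%:R%:E * (mu \x mu) A.
    move=> mA; rewrite -integral_cst//; apply: ge0_le_integral => // z _; rewrite lee_fin//.
  have Hc : M%:R%:E * (mu (B M) * dl h) + M%:R%:E * (mu (B M) * dl h) = (M%:R * 2%:R)%:E * mu (B M) * dl h.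
    by rewrite mulr_natr mulr2n EFinD -!muleA -ge0_muleDl// ?lee_fin.
  rewrite -Hc; apply: leeD; [apply: le_trans (Hm _ mY1) _|apply: le_trans (Hm _ mY2) _]; apply: lee_wpmul2l => //.
    rewrite product_measure1E// muleC; apply: lee_wpmul2l => //; apply: dlE => //.
    by move=> x [[Ex Fx] _]; left.
  rewrite product_measure1E//; apply: lee_wpmul2l => //; apply: dlE => //.
  by move=> x [[Ex Fx] _]; right.
apply/lee_addgt0Pr => e e0; rewrite addeC -limn_einf_shift//; apply: limn_einf_ge.
have : (M%:R * 2%:R)%:E * mu (B M) * dl h @[h --> \oo] --> 0.
  rewrite -(mule0 ((M%:R * 2%:R)%:E * mu (B M))); apply: cvgeZl; last exact: FE.
  by rewrite fin_numM// ge0_fin_numE.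
move=> /cvge0_near_le /(_ e0); apply: filterS => h dh.
by apply: (le_trans (H1 h)); rewrite addeC leeD2r.
Qed.
End energy_lsc.

(** * The Lebesgue measure of boxes *)

Section rV_norm.
Variables (R : realType) (n : nat).
Implicit Types x y : 'rV[R]_n.

Lemma rV_norm_ltP x (e : R) : 0 < e -> `|x| < e <-> forall i, `|x 0 i| < e.
Proof.
move=> e0; rewrite [`|x|]mx_normrE; split=> [/bigmax_ltP[_ H] i|H].
  exact: (H (0, i)).
by apply/bigmax_ltP; split=> // -[i j] _ /=; rewrite ord1; exact: H.
Qed.

Lemma rV_norm_leP x (e : R) : 0 <= e -> `|x| <= e <-> forall i, `|x 0 i| <= e.
Proof.
move=> e0; rewrite [`|x|]mx_normrE; split=> [/bigmax_leP[_ H] i|H].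
  exact: (H (0, i)).
by apply/bigmax_leP; split=> // -[i j] _ /=; rewrite ord1; exact: H.
Qed.

Lemma le_coord_norm x i : `|x 0 i| <= `|x|.
Proof. exact: (rV_norm_leP x (normr_ge0 x)).1. Qed.

Lemma euclidean_norm_ge0 x : 0 <= euclidean_norm x.
Proof. exact: sqrtr_ge0. Qed.

Lemma norm_le_euclidean x : `|x| <= euclidean_norm x.
Proof.
apply/rV_norm_leP => [|i]; first exact: euclidean_norm_ge0.
rewrite -sqrtr_sqr ler_sqrt ?sumr_ge0// => [|j _]; last exact: sqr_ge0.
by rewrite (bigD1 i)//= lerDl sumr_ge0// => j _; exact: sqr_ge0.
Qed.

Lemma euclidean_le_norm x : euclidean_norm x <= n%:R * `|x|.
Proof.
rewrite -(@ler_pXn2r _ 2)// ?nnegrE ?euclidean_norm_ge0 ?mulr_ge0//.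
rewrite sqr_sqrtr ?sumr_ge0// => [|j _]; last exact: sqr_ge0.
apply: (@le_trans _ _ (\sum_(i < n) `|x| ^+ 2)).
  apply: ler_sum => i _; rewrite -(real_normK (num_real (x 0 i))).
  by rewrite ler_pXn2r ?nnegrE// le_coord_norm.
rewrite sumr_const card_ord -[leLHS]mulr_natl exprMn ler_wpM2r ?exprn_ge0//.
have H k : (k <= k ^ 2)%N by case: k => // m; rewrite expnS expn1 leq_pmulr.
by rewrite -natrX ler_nat H.
Qed.

Lemma euclidean_norm0 : euclidean_norm (0 : 'rV[R]_n) = 0.
Proof. by rewrite /euclidean_norm big1 ?sqrtr0// => i _; rewrite mxE expr0n. Qed.

End rV_norm.

Section lebesgue_sf.
Variables (R : realType) (n : nat).

Definition leb : set (lebesgue_space R n) -> \bar R :=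
  @completed_measure_extension _ _ _ (borel_lebesgue R n).

HB.instance Definition _ := Measure.copy leb (lebesgue R n).

Let leb_sigma_finite : sigma_finite setT leb.
Proof. exact/completed_measure_extension_sigma_finite/sigma_finiteT. Qed.

HB.instance Definition _ := Measure_isSigmaFinite.Build _ _ _ leb leb_sigma_finite.

Notation T := (lebesgue_space R n).

Lemma borel_lebesgue_measurable (A : set 'rV[R]_n) :
  measurable A -> measurable (A : set T).
Proof. exact: caratheodory_measurable_mu_ext. Qed.

Lemma lebE (A : set 'rV[R]_n) : measurable A -> leb A = borel_lebesgue R n A.
Proof. by move=> mA; rewrite /leb /completed_measure_extension measurable_mu_extE. Qed.

Lemma measurable_coord (i : 'I_n) :
  measurable_fun setT (fun x : T => (x : 'rV[R]_n) 0 i).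
Proof.
move=> _ Y mY; rewrite setTI; apply: borel_lebesgue_measurable.
by rewrite -[X in measurable X]setTI; exact: (@measurable_rV_coord R n i).
Qed.

Lemma leb_box (A : 'I_n -> set (measurableTypeR R)) :
  (forall i, measurable (A i)) ->
  leb [set x : 'rV[R]_n | forall i, A i (x 0 i)] = (\prod_(i < n) lebesgue_measure (A i))%E.
Proof.
move=> mA; rewrite -borel_lebesgue_box//; apply: lebE.
rewrite (_ : mkset _ = \big[setI/setT]_(i < n) (@rV_coord R n i @^-1` A i)).
  apply: bigsetI_measurable => i _.
  by rewrite -[X in measurable X]setTI; exact: measurable_rV_coord.
rewrite -bigcap_seq; apply/seteqP; split=> x H i; first by move=> _; exact: H.
by apply: H; rewrite /= mem_index_enum.
Qed.

End lebesgue_sf.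

(* Working with an abstract copy [T] of R^n, rather than with [lebesgue_space],
   keeps unification from unfolding the Caratheodory construction. *)
Record lebesgue_model (R : realType) (n : nat) d (T : measurableType d)
    (mu : {sigma_finite_measure set T -> \bar R}) (pt : T -> 'rV[R]_n) : Prop := LebesgueModel {
  model_inj : injective pt ;
  model_coord : forall i, measurable_fun setT (fun x => pt x 0 i) ;
  model_box : forall A : 'I_n -> set (measurableTypeR R), (forall i, measurable (A i)) ->
    mu [set x | forall i, A i (pt x 0 i)] = (\prod_(i < n) lebesgue_measure (A i))%E }.

Section model.
Context (R : realType) (n : nat) d (T : measurableType d)
  (mu : {sigma_finite_measure set T -> \bar R}) (pt : T -> 'rV[R]_n).
Hypothesis mod : lebesgue_model mu pt.

Let measurable_coord i : measurable_fun setT (fun x => pt x 0 i).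
Proof. exact: model_coord mod i. Qed.

Lemma measurable_box (A : 'I_n -> set (measurableTypeR R)) :
  (forall i, measurable (A i)) ->
  measurable [set x | forall i, A i (pt x 0 i)].
Proof.
move=> mA; rewrite (_ : mkset _ = \big[setI/setT]_(i < n)
   ((fun x => pt x 0 i) @^-1` A i)).
  apply: bigsetI_measurable => i _.
  by have := measurable_coord i measurableT (mA i); rewrite setTI.
rewrite -bigcap_seq; apply/seteqP; split=> x H i; first by move=> _; exact: H.
by apply: H; rewrite /= mem_index_enum.
Qed.

(** Balls of the sup norm are boxes, whose measure is given by [model_box]; this is why distances
    are estimated in that norm and the Euclidean one is confined to the kernel. *)
Definition nball (x : 'rV[R]_n) (r : R) : set T := [set y | `|x - pt y| < r].

Lemma nballE (x : 'rV[R]_n) (r : R) : 0 < r ->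
  nball x r = [set y | forall i, `](x 0 i - r), (x 0 i + r)[%classic (pt y 0 i)].
Proof.
move=> r0; apply/seteqP; split=> y /=; rewrite /nball/= rV_norm_ltP//.
  by move=> H i; have := H i; rewrite !mxE in_itv/= ltr_norml => /andP[? ?]; apply/andP; split; lra.
by move=> H i; have := H i; rewrite !mxE in_itv/= ltr_norml => /andP[? ?]; apply/andP; split; lra.
Qed.

Lemma measurable_nball x r : measurable (nball x r).
Proof.
have [r0|r0] := ltP 0 r.
  rewrite nballE//.
  by apply: (@measurable_box (fun i => `](x 0 i - r), (x 0 i + r)[%classic)) => i; exact: measurable_itv.
rewrite (_ : nball x r = set0)//; apply/seteqP; split=> // y /=.
by rewrite /nball/= ltNge (le_trans r0).
Qed.

Lemma mu_nball (x : 'rV[R]_n) (r : R) : 0 < r -> mu (nball x r) = ((r *+ 2) ^+ n)%:E.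
Proof.
move=> r0; rewrite nballE// (@model_box _ _ _ _ _ _ mod (fun i => `](x 0 i - r), (x 0 i + r)[%classic)); last first.
  by move=> i; exact: measurable_itv.
transitivity (\prod_(i < n) (r *+ 2)%:E)%E.
  apply: eq_bigr => i _; rewrite lebesgue_measure_itv/= lte_fin.
  rewrite ifT; last by lra.
  by rewrite -EFinD; congr (_%:E); rewrite mulr2n; lra.
by rewrite prodEFin prodr_const card_ord.
Qed.

Lemma open_measurable_pt (U : set 'rV[R]_n) : open U -> measurable (pt @^-1` U).
Proof.
move=> oU.
(* Candidate balls have rational centres and radii [1/(k+1)], so they can be indexed by [nat]
   through [unpickle]; codes that give no ball inside [U] contribute [set0]. *)
pose c (p : 'rV[rat]_n * nat) : 'rV[R]_n := \row_i ratr (p.1 0 i).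
pose F (m : nat) : set T := if unpickle m is Some p then
  (if `[< nball (c p) (p.2.+1%:R^-1) `<=` pt @^-1` U >] then nball (c p) (p.2.+1%:R^-1) else set0) else set0.
rewrite (_ : pt @^-1` U = \bigcup_m F m); last first.
  apply/seteqP; split=> [x Ux|x [m _]]; last first.
    by rewrite /F; case: unpickle => // p; case: asboolP => // H /H.
  have /nbhs_ballP[e /= e0 He] := oU _ Ux.
  have e40 : 0 < e / 2 by rewrite divr_gt0.
  have [k Hk] : exists k : nat, k.+1%:R^-1 < e / 2.
    by have [k _ H] := near_infty_natSinv_lt (PosNum e40); exists k; exact: H k (leqnn k).
  have qP i : exists q : rat, `|ratr q - pt x 0 i| < k.+1%:R^-1.
    have /rat_in_itvoo[q] : pt x 0 i - k.+1%:R^-1 < pt x 0 i + k.+1%:R^-1.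
      by rewrite ltrD2l gtrN// invr_gt0.
    by rewrite in_itv/= => q12; exists q; rewrite ltr_distl.
  pose p : 'rV[rat]_n * nat := (\row_i projT1 (cid (qP i)), k).
  have xp : `|c p - pt x| < k.+1%:R^-1.
    apply/rV_norm_ltP => [|i]; first by rewrite invr_gt0.
    by rewrite !mxE; exact: (projT2 (cid (qP i))).
  exists (pickle p) => //; rewrite /F pickleK; case: asboolP => // -[] y /=.
  rewrite /nball/= => yp; apply: He; rewrite -ball_normE /=.
  rewrite -(subrKA (c p)) (le_lt_trans (ler_normD _ _))// distrC.
  by rewrite (splitr e) ltrD// (lt_trans _ Hk).
apply: bigcupT_measurable => m; rewrite /F; case: unpickle => // p.
by case: asboolP => // _; exact: measurable_nball.
Qed.

Lemma closed_measurable_pt (U : set 'rV[R]_n) : closed U -> measurable (pt @^-1` U).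
Proof.
move=> cU; rewrite -[U]setCK; apply: measurableC.
exact: (@open_measurable_pt (~` U) (closed_openC cU)).
Qed.

End model.

(** * The fractional kernel *)

Lemma le_nneseries_term (R : realType) (u : (\bar R)^nat) k :
  (forall i, 0 <= u i)%E -> (u k <= \sum_(i <oo) u i)%E.
Proof.
move=> u0; apply: (@le_trans _ _ (\sum_(0 <= i < k.+1) u i)%E); last exact: nneseries_lim_ge.
by rewrite big_nat_recr//= leeDr// sume_ge0.
Qed.

Lemma le_exp2 (R : realType) (x : R) : exists k, x <= 2 ^+ k.
Proof.
exists (Num.bound x); apply: ltW.
have [x0|x0] := ltP x 0; first by rewrite (lt_le_trans x0)// exprn_ge0.
by apply: (lt_trans (archi_boundP x0)); rewrite -natrX ltr_nat ltn_expl.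
Qed.

Lemma powR_exprn (R : realType) (a s : R) i : 0 <= a -> (a ^+ i) `^ s = (a `^ s) ^+ i.
Proof.
move=> a0; rewrite -(powR_mulrn i a0) -(powR_mulrn i (powR_ge0 a s)).
by rewrite -powRrM -[RHS]powRrM mulrC.
Qed.

Lemma powRV (R : realType) (a s : R) : 0 <= a -> (a^-1) `^ s = (a `^ s)^-1.
Proof.
move=> a0; have [->|an0] := eqVneq a 0.
  rewrite invr0; have [->|s0] := eqVneq s 0; first by rewrite !powRr0 invr1.
  by rewrite powR0// invr0.
by rewrite -powR_inv1// -powRrM mulN1r powRN.
Qed.

Lemma dyadic_lt (R : realType) (rho x : R) : 0 < x -> x < rho ->
  exists j, rho / 2 ^+ j.+1 <= x < rho / 2 ^+ j.
Proof.
move=> x0 xr; have r0 := lt_trans x0 xr.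
have ex : exists j, rho / 2 ^+ j.+1 <= x.
  have [k kx] := le_exp2 (rho / x); exists k.
  rewrite ler_pdivrMr ?exprn_gt0// mulrC -ler_pdivrMr// (le_trans kx)//.
  by rewrite ler_weXn2l// ler1n.
have [[|j] Hj Hm] := ex_minnP ex; first by exists 0%N; rewrite Hj expr0 divr1.
by exists j.+1; rewrite Hj ltNge; apply/negP => /Hm; rewrite ltnn.
Qed.

Lemma dyadic_ge (R : realType) (rho x : R) : 0 < rho -> rho <= x ->
  exists i, rho * 2 ^+ i <= x < rho * 2 ^+ i.+1.
Proof.
move=> r0 rx.
have ex : exists i, x < rho * 2 ^+ i.+1.
  have [k kx] := le_exp2 (x / rho); exists k.
  rewrite mulrC -ltr_pdivrMr// (le_lt_trans kx)//.
  by rewrite ltr_eXn2l// ltr1n.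
have [[|j] Hj Hm] := ex_minnP ex; first by exists 0%N; rewrite Hj expr0 mulr1 rx.
by exists j.+1; rewrite Hj andbT leNgt; apply/negP => /Hm; rewrite ltnn.
Qed.

Lemma le_geo_sum (R : realType) (z : R) k : 0 <= z < 1 ->
  \sum_(i < k) z ^+ i <= (1 - z)^-1.
Proof.
move=> /andP[z0 z1]; have z1' : 0 < 1 - z by rewrite subr_gt0.
rewrite -[leRHS]mul1r ler_pdivlMr// mulrC -opprB mulNr -subrX1 opprB gerBl.
exact: exprn_ge0.
Qed.

Section kernel.
Context (R : realType) (n : nat) d (T : measurableType d)
  (mu : {sigma_finite_measure set T -> \bar R}) (pt : T -> 'rV[R]_n).
Hypothesis mod : lebesgue_model mu pt.
Variable s : R.
Hypothesis s01 : 0 < s < 1.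
Local Notation nball := (nball pt).
Notation p := (n%:R + s).

Let s0 : 0 < s. Proof. by case/andP: s01. Qed.
Let p0 : 0 < p. Proof. by rewrite ltr_wpDl. Qed.

Definition fkernel (z : T * T) : R := ((euclidean_norm (pt z.1 - pt z.2)) `^ p)^-1.

Lemma fkernel_ge0 z : 0 <= fkernel z.
Proof. by rewrite invr_ge0 powR_ge0. Qed.

Lemma fkernelC x y : fkernel (x, y) = fkernel (y, x).
Proof.
rewrite /fkernel /=; congr ((_ `^ _)^-1); rewrite /euclidean_norm; congr Num.sqrt.
by apply: eq_bigr => i _; rewrite !mxE -sqrrN opprB.
Qed.

Lemma fkernel_diag x : fkernel (x, x) = 0.
Proof. by rewrite /fkernel/= subrr euclidean_norm0 powR0 ?invr0// gt_eqF. Qed.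

Lemma measurable_fkernel : measurable_fun setT fkernel.
Proof.
pose S (z : T * T) : R := \sum_(i < n) (pt z.1 0 i - pt z.2 0 i) ^+ 2.
have S0 z : 0 <= S z by apply: sumr_ge0 => i _; exact: sqr_ge0.
have -> : fkernel = (fun x => x `^ (- (2^-1 * p))) \o S.
  apply/funext => z; rewrite /fkernel /= powRN powRrM (powR12_sqrt (S0 z)).
  congr ((_ `^ _)^-1); rewrite /euclidean_norm; congr Num.sqrt.
  by apply: eq_bigr => i _; rewrite !mxE.
apply: measurableT_comp; first exact: measurable_powR.
apply: measurable_sum => i; apply: measurable_funX; apply: measurable_funB.
  exact: (measurableT_comp (model_coord mod i) measurable_fst).
exact: (measurableT_comp (model_coord mod i) measurable_snd).
Qed.

Let le_powp (a b : R) : 0 < a -> a <= b -> a `^ p <= b `^ p.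
Proof.
move=> a0 ab; apply: ge0_ler_powR => //; first exact: ltW.
  by rewrite nnegrE ltW.
by rewrite nnegrE ltW// (lt_le_trans a0).
Qed.

Lemma fkernel_le x y (r : R) : 0 < r -> r <= `|pt x - pt y| ->
  fkernel (x, y) <= (r `^ p)^-1.
Proof.
move=> r0 rxy; have r1 : r <= euclidean_norm (pt x - pt y) by exact: le_trans (norm_le_euclidean _).
rewrite lef_pV2 ?posrE ?powR_gt0//; last exact: lt_le_trans r1.
exact: le_powp.
Qed.

(** The points must differ because the kernel is 0 on the diagonal; the factor [n] comes from
    comparing the two norms. *)
Lemma fkernel_ge x y (r : R) : x != y -> `|pt x - pt y| <= r ->
  ((n%:R * r) `^ p)^-1 <= fkernel (x, y).
Proof.
rewrite -(inj_eq (model_inj mod)) -subr_eq0 -normr_gt0 => xy rxy.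
have e0 := lt_le_trans xy (norm_le_euclidean _).
have le1 : euclidean_norm (pt x - pt y) <= n%:R * r.
  by apply: (le_trans (euclidean_le_norm _)); rewrite ler_wpM2l.
rewrite lef_pV2 ?posrE ?powR_gt0//; last exact: lt_le_trans le1.
exact: le_powp.
Qed.

Local Open Scope ereal_scope.

Local Notation q := (2 `^ s)%R.
Let q1 : (1 < q)%R.
Proof.
have /(_ 1%R 2%R) := @gt0_ltr_powR R _ s0; rewrite !nnegrE powR1/=; apply => //.
by rewrite ltr1n.
Qed.
Let q0 : (0 < q)%R. Proof. exact: lt_trans q1. Qed.

(** The shell of distances in [a, 2a) has kernel mass at most 4^n a^-s. The far shells, a = rho 2^i,
    sum up to 4^n rho^-s / (1 - 1/q); a near one, a = rho / 2^(j+1), gives 4^n q rho^-s q^j. The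
    constant majorises both prefactors. *)
Definition dyadic_cst : R := (4%:R ^+ n * q / (1 - q^-1))%R.

Let qV : (0 < 1 - q^-1)%R. Proof. by rewrite subr_gt0 invf_lt1. Qed.

Lemma dyadic_cst_gt0 : (0 < dyadic_cst)%R.
Proof. by rewrite divr_gt0// mulr_gt0// exprn_gt0. Qed.

(* A box of side 4a meets the kernel at distance a with mass 4^n a^-s. *)
Let shell (a : R) : (0 < a)%R ->
  ((a `^ p)^-1 * (2%:R * a *+ 2) ^+ n = 4%:R ^+ n * (a `^ s)^-1)%R.
Proof.
move=> a0; rewrite powRD; last by rewrite (gt_eqF a0) implybT.
rewrite powR_mulrn ?ltW// invfM (_ : (2%:R * a *+ 2)%R = (4%:R * a)%R); last first.
  by rewrite mulr2n; lra.
by rewrite exprMn; field; rewrite !gt_eqF// ?powR_gt0// exprn_gt0.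
Qed.

(** The integral is split into dyadic shells around [x]: on the shell between [rho / 2^(j+1)] and
    [rho / 2^j] the function is at most [gj j], and beyond [rho] at most [M]. *)
Lemma dyadic_pointwise (x : T) (g : T -> R) (rho M : R) (gj : nat -> R) :
  measurable_fun setT g -> (forall y, 0 <= g y)%R -> (0 < rho)%R -> (0 <= M)%R ->
  (forall j, 0 <= gj j)%R ->
  (forall y j, (`|pt x - pt y| < rho / 2 ^+ j)%R -> g y <= gj j)%R ->
  (forall y, (rho <= `|pt x - pt y|)%R -> g y <= M)%R ->
  \int[mu]_y (g y * fkernel (x, y))%:E <=
  (dyadic_cst * (rho `^ s)^-1)%:E * (M%:E + \sum_(j <oo) (q ^+ j * gj j)%:E).
Proof.
move=> mg g0 rho0 M0 gj0 Hj HM.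
(* Far shells go to [fA], near ones to [fB]. Each shell is enlarged to a full ball, whose measure is
   explicit; the overlaps only increase the sum. *)
pose fA i (y : T) : \bar R := (M * ((rho * 2 ^+ i) `^ p)^-1 * \1_(nball (pt x) (rho * 2 ^+ i.+1)) y)%R%:E.
pose fB j (y : T) : \bar R := (gj j * ((rho / 2 ^+ j.+1) `^ p)^-1 * \1_(nball (pt x) (rho / 2 ^+ j)) y)%R%:E.
have fA0 i y : 0 <= fA i y by rewrite lee_fin !mulr_ge0 ?invr_ge0 ?powR_ge0.
have fB0 i y : 0 <= fB i y by rewrite lee_fin !mulr_ge0 ?invr_ge0 ?powR_ge0.
have mfA i : measurable_fun setT (fA i).
  apply/measurable_EFinP; apply: measurable_funM => //.
  by apply: measurable_indic; exact: (measurable_nball mod).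
have mfB i : measurable_fun setT (fB i).
  apply/measurable_EFinP; apply: measurable_funM => //.
  by apply: measurable_indic; exact: (measurable_nball mod).
have mK : measurable_fun setT (fun y => fkernel (x, y)).
  exact: (measurableT_comp measurable_fkernel (measurable_pair1 x)).
have iA i : \int[mu]_y fA i y = (4%:R ^+ n * (rho `^ s)^-1 * M * q^-1 ^+ i)%:E.
  rewrite /fA; under eq_integral do rewrite EFinM.
  have a0 : (0 < rho * 2 ^+ i)%R by rewrite mulr_gt0// exprn_gt0.
  rewrite ge0_integralZl; last 4 first.
  - exact: measurableT.
  - by apply/measurable_EFinP; apply: measurable_indic; exact: (measurable_nball mod).
  - by move=> y _; rewrite lee_fin.
  - by rewrite lee_fin mulr_ge0 ?invr_ge0 ?powR_ge0.
  rewrite integral_indic ?setIT//; last exact: (measurable_nball mod).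
  rewrite [X in _ * X](mu_nball mod) ?mulr_gt0// ?exprn_gt0// -EFinM; congr (_%:E).
  rewrite exprS (mulrCA rho).
  rewrite -[LHS]mulrA.
  rewrite (shell a0) powRM ?ltW// ?exprn_gt0//.
  rewrite powR_exprn; last exact: ler0n.
  by rewrite invfM exprVn; lra.
have iB i : \int[mu]_y fB i y = (4%:R ^+ n * q * (rho `^ s)^-1 * (q ^+ i * gj i))%:E.
  rewrite /fB; under eq_integral do rewrite EFinM.
  have a0 : (0 < rho / 2 ^+ i.+1)%R by rewrite divr_gt0// exprn_gt0.
  rewrite ge0_integralZl; last 4 first.
  - exact: measurableT.
  - by apply/measurable_EFinP; apply: measurable_indic; exact: (measurable_nball mod).
  - by move=> y _; rewrite lee_fin.
  - by rewrite lee_fin mulr_ge0 ?invr_ge0 ?powR_ge0.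
  rewrite integral_indic ?setIT//; last exact: (measurable_nball mod).
  rewrite [X in _ * X](mu_nball mod) ?divr_gt0// ?exprn_gt0// -EFinM; congr (_%:E).
  rewrite (_ : rho / 2 ^+ i = 2%:R * (rho / 2 ^+ i.+1))%R; last first.
    by rewrite exprS; field; rewrite expf_neq0.
  rewrite -[LHS]mulrA (shell a0) powRM ?invr_ge0 ?(ltW rho0)// ?exprn_ge0//.
  rewrite powRV; last by rewrite exprn_ge0.
  rewrite powR_exprn; last exact: ler0n.
  by rewrite invfM invrK exprS; lra.
have rho2 k : (0 < rho * 2 ^+ k)%R by rewrite mulr_gt0// exprn_gt0.
have rhoV k : (0 < rho / 2 ^+ k)%R by rewrite divr_gt0// exprn_gt0.
apply: (@le_trans _ _ (\int[mu]_y (\sum_(i <oo) fA i y + \sum_(j <oo) fB j y))).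
  apply: ge0_le_integral => //.
  - by move=> y _; rewrite lee_fin mulr_ge0// fkernel_ge0.
  - by apply/measurable_EFinP; exact: measurable_funM.
  - by apply: emeasurable_funD; apply: ge0_emeasurable_sum.
  move=> y _.
  have hA i : fA i y <= \sum_(i <oo) fA i y + \sum_(j <oo) fB j y.
    apply: (@le_trans _ _ (\sum_(i <oo) fA i y)).
      by apply: (@le_nneseries_term _ (fun i => fA i y)).
    by rewrite leeDl// nneseries_ge0.
  have hB i : fB i y <= \sum_(i <oo) fA i y + \sum_(j <oo) fB j y.
    apply: (@le_trans _ _ (\sum_(i <oo) fB i y)).
      by apply: (@le_nneseries_term _ (fun i => fB i y)).
    by rewrite leeDr// nneseries_ge0.
  have [->|xy] := eqVneq y x.
    by rewrite fkernel_diag mulr0 adde_ge0// nneseries_ge0.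
  have d0 : (0 < `|pt x - pt y|)%R by rewrite normr_gt0 subr_eq0 (inj_eq (model_inj mod)) eq_sym.
  have [dr|rd] := ltP `|pt x - pt y|%R rho.
    have [j /andP[j1 j2]] := dyadic_lt d0 dr; apply: le_trans (hB j).
    rewrite /fB lee_fin indicE mem_set// mulr1 ler_pM ?fkernel_ge0//; first exact: Hj.
    exact: fkernel_le.
  have [j /andP[j1 j2]] := dyadic_ge rho0 rd; apply: le_trans (hA j).
  rewrite /fA lee_fin indicE mem_set// mulr1 ler_pM ?fkernel_ge0//; first exact: HM.
  exact: fkernel_le.
rewrite ge0_integralD//; last 4 first.
- by move=> y _; exact: nneseries_ge0.
- exact: ge0_emeasurable_sum.
- by move=> y _; exact: nneseries_ge0.
- exact: ge0_emeasurable_sum.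
rewrite !integral_nneseries//.
under eq_eseriesr do rewrite iA.
under [X in _ + X]eq_eseriesr do rewrite iB EFinM.
rewrite nneseriesZl//; last first.
  by move=> i _; rewrite lee_fin mulr_ge0 ?exprn_ge0 ?powR_ge0.
rewrite muleDr ?fin_num_adde_defr//; apply: leeD.
  apply: lime_le; first by apply: is_cvg_nneseries => i _ _; rewrite lee_fin !mulr_ge0 ?exprn_ge0 ?invr_ge0 ?powR_ge0.
  apply: nearW => k; rewrite sumEFin lee_fin -mulr_sumr big_mkord.
  have qV1 : (q^-1 < 1)%R by rewrite invf_lt1.
  have qn1 : (1 - q^-1 != 0)%R by rewrite gt_eqF.
  have gs : (\sum_(i < k) q^-1 ^+ i <= (1 - q^-1)^-1)%R.
    by apply: le_geo_sum; rewrite invr_ge0 ltW.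
  apply: (@le_trans _ _ (4%:R ^+ n * (rho `^ s)^-1 * M * (1 - q^-1)^-1)%R).
    by rewrite ler_wpM2l// !mulr_ge0 ?exprn_ge0 ?invr_ge0 ?powR_ge0.
  rewrite /dyadic_cst.
  have -> : (4%:R ^+ n * q / (1 - q^-1) / rho `^ s * M =
    q * (4%:R ^+ n * (rho `^ s)^-1 * M * (1 - q^-1)^-1))%R by lra.
  by rewrite ler_peMl ?(ltW q1)// !mulr_ge0 ?exprn_ge0 ?invr_ge0 ?powR_ge0// ltW.
apply: lee_wpmul2r; first by apply: nneseries_ge0 => i _ _; rewrite lee_fin mulr_ge0 ?exprn_ge0 ?powR_ge0.
rewrite lee_fin ler_wpM2r ?invr_ge0 ?powR_ge0// /dyadic_cst ler_peMr//.
by rewrite invf_ge1// gerBl invr_ge0 powR_ge0.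
Qed.

(** Reduces an integral against the singular kernel to the integrals of [gj j], weighted by [q^j]
    with q = 2^s. As q < 2, a decay of these integrals like 2^-j is enough for convergence. *)
Lemma dyadic_energy (g : T * T -> R) (rho : R) (M : T -> R) (gj : nat -> T -> R) :
  measurable_fun setT g -> (forall z, 0 <= g z)%R -> (0 < rho)%R ->
  measurable_fun setT M -> (forall x, 0 <= M x)%R ->
  (forall j, measurable_fun setT (gj j)) -> (forall j x, 0 <= gj j x)%R ->
  (forall x y j, (`|pt x - pt y| < rho / 2 ^+ j)%R -> g (x, y) <= gj j x)%R ->
  (forall x y, (rho <= `|pt x - pt y|)%R -> g (x, y) <= M x)%R ->
  \int[mu \x mu]_z (g z * fkernel z)%:E <=
  (dyadic_cst * (rho `^ s)^-1)%:E *
    (\int[mu]_x (M x)%:E + \sum_(j <oo) (q ^+ j)%:E * \int[mu]_x (gj j x)%:E).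
Proof.
move=> mg g0 rho0 mM M0 mgj gj0 Hj HM.
have qj0 j : (0 <= q ^+ j)%R by rewrite exprn_ge0// ltW.
have mS : measurable_fun setT (fun x => \sum_(j <oo) (q ^+ j * gj j x)%:E).
  apply: ge0_emeasurable_sum => [j x _ _|j _]; first by rewrite lee_fin mulr_ge0.
  by apply/measurable_EFinP; exact: measurable_funM.
have S0 x : 0 <= \sum_(j <oo) (q ^+ j * gj j x)%:E.
  by apply: nneseries_ge0 => j _ _; rewrite lee_fin mulr_ge0.
have C0 : 0 <= (dyadic_cst * (rho `^ s)^-1)%:E.
  by rewrite lee_fin mulr_ge0 ?invr_ge0 ?powR_ge0// ltW// dyadic_cst_gt0.
have mgK : measurable_fun setT (fun z => (g z * fkernel z)%:E).
  by apply/measurable_EFinP; apply: measurable_funM => //; exact: measurable_fkernel.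
have gK0 z : 0 <= (g z * fkernel z)%:E by rewrite lee_fin mulr_ge0// fkernel_ge0.
rewrite fubini_tonelli1//.
apply: (@le_trans _ _ (\int[mu]_x ((dyadic_cst * (rho `^ s)^-1)%:E *
   ((M x)%:E + \sum_(j <oo) (q ^+ j * gj j x)%:E)))).
  apply: ge0_le_integral => //.
  - by move=> x _; apply: integral_ge0.
  - exact: measurable_fun_fubini_tonelli_F.
  - apply: measurable_funeM; apply: emeasurable_funD => //; exact/measurable_EFinP.
  move=> x _; apply: dyadic_pointwise => //.
  - exact: (measurableT_comp mg (measurable_pair1 x)).
  - by move=> y; exact: Hj.
  - by move=> y; exact: HM.
have mME : measurable_fun setT (fun x => (M x)%:E) by exact/measurable_EFinP.
have ME0 x : 0 <= (M x)%:E by rewrite lee_fin.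
rewrite ge0_integralZl//; last 2 first.
- exact: emeasurable_funD.
- by move=> x _; rewrite adde_ge0.
rewrite ge0_integralD// integral_nneseries//; last 2 first.
- by move=> j; apply/measurable_EFinP; exact: measurable_funM.
- by move=> j x _; rewrite lee_fin mulr_ge0.
rewrite le_eqVlt; apply/orP; left; apply/eqP; congr (_ * (_ + _)).
apply: eq_eseriesr => j _; under eq_integral do rewrite EFinM.
rewrite ge0_integralZl//; first exact/measurable_EFinP.
by move=> x _; rewrite lee_fin.
Qed.
End kernel.

(** * Sums over dyadic scales *)

Section dyadic_series.
Variables (R : realType) (s : R).
Hypothesis s01 : 0 < s < 1.
Local Notation q := (2 `^ s).

(** Here s < 1 enters: the singularity loses a factor 2^s per scale, while neighbourhoods of a
    hypersurface gain a factor 2. *)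
Lemma dyadic_ratio : 0 < q / 2 < 1.
Proof.
have [s0 s1] := andP s01; rewrite divr_gt0 ?powR_gt0//= ltr_pdivrMr// mul1r.
have p0 : 0 < 1 - s by rewrite subr_gt0.
have H : 1 < 2 `^ (1 - s).
  have /(_ 1%R 2%R) := @gt0_ltr_powR R _ p0; rewrite !nnegrE powR1/=; apply => //.
  by rewrite ltr1n.
have E : q * 2 `^ (1 - s) = 2 by rewrite -powRD ?pnatr_eq0 ?implybT// addrC subrK powRr1.
by rewrite -[X in _ < X]E ltr_pMr// powR_gt0.
Qed.

(** The bound [a] is used for the scales below [J], the decaying one from [J] on. *)
Lemma dyadic_series (a beta : R) (b : (\bar R)^nat) (J : nat) :
  0 <= a -> 0 <= beta -> (forall j, 0 <= b j)%E ->
  (forall j, b j <= a%:E)%E -> (forall j, b j <= (beta / 2 ^+ j)%:E)%E ->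
  (\sum_(j <oo) (q ^+ j)%:E * b j <=
   (a * (\sum_(j < J) q ^+ j) + beta * ((q / 2) ^+ J / (1 - q / 2)))%:E)%E.
Proof.
move=> a0 be0 b0 ba bb; have /andP[r0 r1] := dyadic_ratio.
have q0 j : 0 <= q ^+ j by rewrite exprn_ge0 ?powR_ge0.
have t0 j : (0 <= (q ^+ j)%:E * b j)%E by rewrite mule_ge0.
apply: lime_le; first exact: is_cvg_nneseries.
near=> k.
have Jk : (J <= k)%N by near: k; exists J.
rewrite (big_cat_nat (leq0n J) Jk)//= EFinD; apply: leeD.
  rewrite big_mkord mulr_sumr -sumEFin; apply: lee_sum => j _.
  by rewrite mulrC EFinM lee_wpmul2l.
apply: (@le_trans _ _ (\sum_(J <= j < k) (beta * (q / 2) ^+ j)%:E)%E).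
  apply: lee_sum => j _; rewrite expr_div_n mulrCA EFinM lee_wpmul2l//.
rewrite sumEFin lee_fin -mulr_sumr ler_wpM2l//.
rewrite -{1}[J]add0n big_addn big_mkord.
under eq_bigr do rewrite addnC exprD.
by rewrite -mulr_sumr ler_wpM2l ?exprn_ge0 ?(ltW r0)// le_geo_sum// ltW.
Unshelve. all: by end_near.
Qed.

Lemma dyadic_series_bounded (beta : R) (b : (\bar R)^nat) :
  0 <= beta -> (forall j, 0 <= b j)%E -> (forall j, b j <= (beta / 2 ^+ j)%:E)%E ->
  (\sum_(j <oo) (q ^+ j)%:E * b j <= (beta / (1 - q / 2))%:E)%E.
Proof.
move=> be0 b0 bb.
have := @dyadic_series beta beta b 0 be0 be0 b0; rewrite big_ord0 mulr0 add0r expr0 div1r.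
apply => // j; apply: (le_trans (bb j)); rewrite lee_fin ler_pdivrMr ?exprn_gt0//.
by rewrite ler_peMr// exprn_ege1// ler1n.
Qed.

(** [J] is chosen first, to make the tail at most [e / 2], and then [a] for the first [J] terms. The
    threshold depends only on [beta] and [e], so it can be fixed before the sets to which it is
    applied. *)
Lemma dyadic_series_small (beta e : R) : 0 <= beta -> 0 < e ->
  exists2 a : R, 0 < a & forall b : (\bar R)^nat, (forall j, 0 <= b j)%E ->
  (forall j, b j <= a%:E)%E -> (forall j, b j <= (beta / 2 ^+ j)%:E)%E ->
  (\sum_(j <oo) (q ^+ j)%:E * b j <= e%:E)%E.
Proof.
move=> be0 e0; have /andP[r0 r1] := dyadic_ratio.
have e20 : 0 < e / 2 by rewrite divr_gt0.
have [J HJ] : exists J, beta * ((q / 2) ^+ J / (1 - q / 2)) <= e / 2.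
  have : (beta / (1 - q / 2)) * (q / 2) ^+ j @[j --> \oo] --> (0 : R).
    rewrite -(mulr0 (beta / (1 - q / 2))); apply: cvgZr.
    by apply: cvg_expr; rewrite ger0_norm ?(ltW r0).
  move=> /cvgr0Pnorm_le /(_ _ e20)[J _ /(_ J (leqnn J))] H; exists J.
  by rewrite mulrCA mulrC mulrAC; apply: le_trans H; rewrite mulrAC ler_norm.
have S0 : 0 <= \sum_(j < J) q ^+ j.
  by apply: sumr_ge0 => j _; rewrite exprn_ge0 ?powR_ge0.
have S1 : 0 < \sum_(j < J) q ^+ j + 1 by rewrite ltr_wpDl.
exists (e / 2 / (\sum_(j < J) q ^+ j + 1)); first by rewrite divr_gt0.
move=> b b0 ba bb.
have := @dyadic_series _ beta b J _ be0 b0 ba bb => /(_ (ltW (divr_gt0 e20 S1))).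
move=> /le_trans; apply; rewrite lee_fin [leRHS](splitr e) lerD//.
rewrite -mulrA ler_piMr ?(ltW e20)// mulrC ler_pdivrMr// mul1r lerDl//.
Qed.
End dyadic_series.

Lemma energyE d (T : measurableType d) (R : realType)
  (mu : {sigma_finite_measure set T -> \bar R}) (W : T * T -> R) A :
  (energy mu W A = \int[mu \x mu]_z (\1_(A `*` ~` A) z * W z)%:E)%E.
Proof.
rewrite /energy integral_mkcond; apply: eq_integral => z _.
by rewrite patchE indicE; case: ifPn => _; rewrite ?mul1r ?mul0r.
Qed.

Section minkowski.
Context (R : realType) (n : nat) d (T : measurableType d)
  (mu : {sigma_finite_measure set T -> \bar R}) (pt : T -> 'rV[R]_n).
Hypothesis mod : lebesgue_model mu pt.
Variable s : R.
Hypothesis s01 : 0 < s < 1.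
Local Notation q := (2 `^ s).
Local Notation K := (fkernel pt s).
Local Open Scope ereal_scope.

(** A pair leaving [A] at distance below [rho / 2^j] starts in [B j], so the indicator of [B j]
    serves as [gj j], and that of [A] as the far bound. *)
Lemma energy_minkowski (A : set T) (B : (set T)^nat) (m beta rho : R) :
  measurable A -> (forall j, measurable (B j)) -> (0 < rho)%R -> (0 <= beta)%R ->
  (forall x y j, A x -> ~ A y -> (`|pt x - pt y| < rho / 2 ^+ j)%R -> B j x) ->
  mu A <= m%:E -> (forall j, mu (B j) <= (beta / 2 ^+ j)%:E) ->
  energy mu K A <= (dyadic_cst n s * (rho `^ s)^-1 * (m + beta / (1 - q / 2)))%:E.
Proof.
move=> mA mB rho0 be0 HB Am Bb.
have mAA : measurable (A `*` ~` A) by apply: measurableX => //; exact: measurableC.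
have C0 : (0 <= dyadic_cst n s * (rho `^ s)^-1)%R.
  by rewrite mulr_ge0 ?invr_ge0 ?powR_ge0// ltW// dyadic_cst_gt0.
rewrite energyE; apply: (le_trans (@dyadic_energy _ _ _ _ _ _ mod _ s01
   (\1_(A `*` ~` A)) rho (\1_A) (fun j => \1_(B j)) _ _ _ _ _ _ _ _ _)) => //.
- move=> x y j xy; rewrite !indicE ler_nat.
  case: (boolP ((x, y) \in _)) => //; rewrite inE => -[/= Ax Ay].
  by rewrite mem_set//; exact: HB xy.
- move=> x y _; rewrite !indicE ler_nat.
  by case: (boolP ((x, y) \in _)) => //; rewrite inE => -[/= Ax Ay]; rewrite mem_set.
rewrite [leRHS]EFinM lee_wpmul2l// EFinD; apply: leeD.
  by rewrite integral_indic// setIT.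
under eq_eseriesr do rewrite integral_indic// setIT.
exact: dyadic_series_bounded.
Qed.
End minkowski.

(** * Cubes *)

Lemma measure_bigsetU_le d (T : measurableType d) (R : realType)
    (mu : {measure set T -> \bar R}) (I : Type) (r : seq I) (F : I -> set T) :
  (forall i, measurable (F i)) ->
  (mu (\big[setU/set0]_(i <- r) F i) <= \sum_(i <- r) mu (F i))%E.
Proof.
move=> mF; elim: r => [|i r IH]; first by rewrite !big_nil measure0.
rewrite !big_cons (le_trans (measureU2 _ _ _))//; last by rewrite leeD2l.
by apply: bigsetU_measurable => j _.
Qed.

Section cell.
Context (R : realType) (n : nat) d (T : measurableType d)
  (mu : {sigma_finite_measure set T -> \bar R}) (pt : T -> 'rV[R]_n).
Hypothesis mod : lebesgue_model mu pt.
Implicit Types (c : 'rV[R]_n) (h r : R).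

Definition cell c h : set T := [set x | forall i, c 0 i <= pt x 0 i < c 0 i + h].

Definition collar c h r : set T :=
  [set x | cell c h x /\ exists i, pt x 0 i < c 0 i + r \/ c 0 i + h - r <= pt x 0 i].

(** One slab per face: [i] is the direction, [e] distinguishes the lower face from the upper one.
    [Num.min r h] keeps the slab inside the cell when [r] exceeds [h]. *)
Let slab c h r (e : bool) (i : 'I_n) : set T :=
  [set x | forall j, ((if j == i then
    if e then `[c 0 j, c 0 j + Num.min r h[ else `[c 0 j + h - Num.min r h, c 0 j + h[
    else `[c 0 j, c 0 j + h[)%classic : set (measurableTypeR R)) (pt x 0 j)].

Lemma cellE c h : cell c h = [set x | forall j, `[c 0 j, c 0 j + h[%classic (pt x 0 j)].
Proof. by apply/seteqP; split=> x H j; have := H j; rewrite /= in_itv. Qed.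

Lemma measurable_cell c h : measurable (cell c h).
Proof.
rewrite cellE; apply: (@measurable_box _ _ _ _ _ _ mod (fun j => `[c 0 j, c 0 j + h[%classic)).
by move=> j; exact: measurable_itv.
Qed.

Lemma mu_cell c h : 0 < h -> mu (cell c h) = (h ^+ n)%:E.
Proof.
move=> h0; rewrite cellE (@model_box _ _ _ _ _ _ mod (fun j => `[c 0 j, c 0 j + h[%classic)); last first.
  by move=> j; exact: measurable_itv.
transitivity (\prod_(i < n) h%:E)%E; last by rewrite prodEFin prodr_const card_ord.
apply: eq_bigr => i _; rewrite lebesgue_measure_itv/= lte_fin ltrDl h0.
by rewrite -EFinD addrC addKr.
Qed.

Let measurable_slab c h r e i : measurable (slab c h r e i).
Proof.
apply: (@measurable_box _ _ _ _ _ _ mod (fun j => (if j == i then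
    if e then `[c 0 j, c 0 j + Num.min r h[ else `[c 0 j + h - Num.min r h, c 0 j + h[
    else `[c 0 j, c 0 j + h[)%classic)).
by move=> j; case: ifP => _; [case: e|]; exact: measurable_itv.
Qed.

Let mu_slab c h r e i : 0 <= r -> 0 < h -> (mu (slab c h r e i) <= (r * (h ^+ n / h))%:E)%E.
Proof.
move=> r0 h0.
rewrite (@model_box _ _ _ _ _ _ mod (fun j => (if j == i then
    if e then `[c 0 j, c 0 j + Num.min r h[ else `[c 0 j + h - Num.min r h, c 0 j + h[
    else `[c 0 j, c 0 j + h[)%classic)); last first.
  by move=> j; case: ifP => _; [case: e|]; exact: measurable_itv.
have m0 : 0 <= Num.min r h by rewrite le_min r0 ltW.
rewrite (bigD1 i)//= eqxx.
rewrite [X in (_ * X)%E](_ : _ = (h ^+ n / h)%:E); last first.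
  transitivity (\prod_(j < n | j != i) h%:E)%E.
    apply: eq_bigr => j /negbTE ->; rewrite lebesgue_measure_itv/= lte_fin ltrDl h0.
    by rewrite -EFinD addrC addKr.
  rewrite prodEFin; congr (_%:E).
  have <- : \prod_(j < n) h = h ^+ n by rewrite prodr_const card_ord.
  by rewrite [in RHS](bigD1 i)//= mulrC mulKf ?gt_eqF.
rewrite [leRHS]EFinM; apply: lee_wpmul2r; first by rewrite lee_fin divr_ge0 ?exprn_ge0 ?ltW.
apply: (@le_trans _ _ (Num.min r h)%:E); last by rewrite lee_fin ge_min lexx.
case: e; rewrite lebesgue_measure_itv/= lte_fin; case: ifPn => _; rewrite ?lee_fin//.
  by rewrite addrC addKr.
by rewrite opprB addrCA subrr addr0.
Qed.

Let collarE c h r : 0 <= r -> 0 < h -> collar c h r =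
  \big[setU/set0]_(p <- enum {: bool * 'I_n}) slab c h r p.1 p.2.
Proof.
move=> r0 h0; rewrite -bigcup_seq; apply/seteqP; split=> x.
  move=> [Qx [i Hi]].
  have ex (e : bool) : (if e then pt x 0 i < c 0 i + r else c 0 i + h - r <= pt x 0 i) ->
      (\bigcup_(p in [set` enum {: bool * 'I_n}]) slab c h r p.1 p.2) x.
    move=> He; exists (e, i); first by rewrite /= mem_enum.
    move=> j /=; have /andP[Qj1 Qj2] := Qx j; case: eqP => [ji|_] /=; last by rewrite in_itv/= Qj1.
    rewrite ji in Qj1 Qj2 *; case: e He => He; rewrite /= in_itv/=.
      by rewrite Qj1/= minElt; case: ifP.
    by rewrite Qj2 andbT minElt; case: ifP => // _; rewrite addrK.
  by case: Hi => Hi; [exact: (ex true)|exact: (ex false)].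
move=> [[e i] _] /= Sx; split.
  move=> j; have := Sx j; case: eqP => [->|_] /=; last by rewrite in_itv.
  case: e {Sx} => /=; rewrite in_itv/= => /andP[H1 H2]; apply/andP; split => //.
    by rewrite (lt_le_trans H2)// lerD2l ge_min lexx orbT.
  by rewrite (le_trans _ H1)// -addrA lerDl subr_ge0 ge_min lexx orbT.
exists i; have := Sx i; rewrite eqxx; case: e {Sx} => /=; rewrite in_itv/= => /andP[H1 H2].
  by left; rewrite (lt_le_trans H2)// lerD2l ge_min lexx.
by right; rewrite (le_trans _ H1)// lerD2l lerN2 ge_min lexx.
Qed.

Lemma measurable_collar c h r : 0 <= r -> 0 < h -> measurable (collar c h r).
Proof.
by move=> r0 h0; rewrite collarE//; apply: bigsetU_measurable => p _; exact: measurable_slab.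
Qed.

(** There are [2 n] faces, each of area [h ^+ n / h]. *)
Lemma mu_collar c h r : 0 <= r -> 0 < h ->
  (mu (collar c h r) <= ((2 * n)%:R * (r * (h ^+ n / h)))%:E)%E.
Proof.
move=> r0 h0; rewrite collarE//; apply: le_trans (measure_bigsetU_le _ _ _) _ => //.
apply: (@le_trans _ _ (\sum_(p <- enum {: bool * 'I_n}) (r * (h ^+ n / h))%:E)%E).
  by apply: lee_sum => p _; exact: mu_slab.
rewrite sumEFin lee_fin big_enum/= sumr_const card_prod card_bool card_ord.
by rewrite [leRHS]mulr_natl.
Qed.

Lemma near_collar c h r x y : cell c h x -> ~ cell c h y -> `|pt x - pt y| < r ->
  collar c h r x.
Proof.
move=> Qx Qy xy; split => //.
have r0 : 0 < r by exact: le_lt_trans xy.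
move: Qy => /existsNP[i Hi]; exists i.
have := (rV_norm_ltP _ r0).1 xy i; rewrite !mxE ltr_norml => /andP[xy1 xy2].
move: Hi => /negP; rewrite negb_and -!leNgt -ltNge => /orP[Hi|Hi]; [left|right]; lra.
Qed.

Variable s : R.
Hypothesis s01 : 0 < s < 1.

(** The collars of width [h / 2^j] have measure at most [2 n h^n / 2^j]; at the scale [rho = h] this
    is the setting of [energy_minkowski]. *)
Lemma energy_cell c h : 0 < h -> (energy mu (fkernel pt s) (cell c h) <=
  (dyadic_cst n s * (1 + (2 * n)%:R / (1 - 2 `^ s / 2)) * ((h `^ s)^-1 * h ^+ n))%:E)%E.
Proof.
move=> h0.
have h2 j : 0 <= h / 2 ^+ j by rewrite divr_ge0 ?exprn_ge0// ltW.
have -> : dyadic_cst n s * (1 + (2 * n)%:R / (1 - 2 `^ s / 2)) * ((h `^ s)^-1 * h ^+ n) =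
    dyadic_cst n s / h `^ s * (h ^+ n + (2 * n)%:R * h ^+ n / (1 - 2 `^ s / 2)) by lra.
apply: (@energy_minkowski _ _ _ _ _ _ mod s s01 (cell c h) (fun j => collar c h (h / 2 ^+ j)) _ _ _ (measurable_cell c h)) => //.
- by move=> j; exact: measurable_collar.
- by rewrite mulr_ge0// exprn_ge0// ltW.
- by move=> x y j Qx Qy; exact: near_collar.
- by rewrite mu_cell.
- move=> j; apply: (le_trans (mu_collar c (h2 j) h0)); rewrite lee_fin.
  have -> : h / 2 ^+ j * (h ^+ n / h) = h ^+ n / 2 ^+ j.
    have h1 : h != 0 by rewrite gt_eqF.
    have j1 : (2 : R) ^+ j != 0 by rewrite expf_neq0.
    by field; rewrite h1 j1.
  by rewrite mulrA.
Qed.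

End cell.

Section power_inequalities.
Variable R : realType.
Implicit Types a b x : R.

Lemma bernoulli_ge x M : 0 <= 1 + x -> 1 + M%:R * x <= (1 + x) ^+ M.
Proof.
move=> x0; elim: M => [|M IH]; first by rewrite mul0r addr0 expr0.
rewrite exprS; apply: (le_trans _ (ler_wpM2l x0 IH)); rewrite -natr1.
have : 0 <= M%:R * x ^+ 2 by rewrite mulr_ge0 ?sqr_ge0.
by rewrite expr2; lra.
Qed.

Lemma lipschitz_exprn a b M : `|a| <= 1 -> `|b| <= 1 -> `|a ^+ M - b ^+ M| <= M%:R * `|a - b|.
Proof.
move=> a1 b1; rewrite subrXX normrM mulrC ler_wpM2r// (le_trans (ler_norm_sum _ _ _))//.
apply: (@le_trans _ _ (\sum_(i < M) 1)); last by rewrite sumr_const card_ord.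
by apply: ler_sum => i _; rewrite normrM !normrX mulr_ile1 ?exprn_ge0// exprn_ile1.
Qed.

(** Bernoulli bounds 1 + M x by (1 + x)^M, and (1 - x)(1 + x) <= 1. *)
Lemma expr1Bn_le x M : 0 <= x <= 1 -> (1 - x) ^+ M * (1 + M%:R * x) <= 1.
Proof.
move=> /andP[x0 x1].
have y0 : 0 <= 1 - x by rewrite subr_ge0.
apply: (@le_trans _ _ ((1 - x) ^+ M * (1 + x) ^+ M)).
  by rewrite ler_wpM2l ?exprn_ge0// bernoulli_ge// addr_ge0.
rewrite -exprMn exprn_ile1//; first by rewrite mulr_ge0// addr_ge0.
by have := sqr_ge0 x; rewrite expr2; lra.
Qed.
End power_inequalities.

Section rounded_cell.
Variables (R : realType) (n : nat).
Hypothesis n0 : (0 < n)%N.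
Implicit Types (c x y : 'rV[R]_n) (h t : R) (N : nat).

(* The sublevel sets of [bulge N c h] at height below 1 are smooth and fill the
   cube of corner [c] and side [h] as [N] tends to infinity. *)
Definition bulge N c h x : R :=
  \sum_(i < n) ((x 0 i - (c 0 i + h / 2)) / (h / 2)) ^+ (2 * N).

Let z c h x i := (x 0 i - (c 0 i + h / 2)) / (h / 2).

Lemma bulge_margin N c h x : 0 < h -> (0 < N)%N -> bulge N c h x <= 3 / 4 ->
  forall i, c 0 i + h / (16 * N)%:R <= x 0 i <= c 0 i + h - h / (16 * N)%:R.
Proof.
move=> h0 N0 Gx i; have N0' : 0 < N%:R :> R by rewrite ltr0n.
have zi : `|z c h x i| ^+ (2 * N) <= 3 / 4.
  apply: le_trans Gx; rewrite /bulge (bigD1 i)//= -normrX ger0_norm.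
    by rewrite lerDl sumr_ge0// => j _; rewrite exprM exprn_ge0// sqr_ge0.
  by rewrite exprM exprn_ge0// sqr_ge0.
pose k : R := (8 * N)%:R^-1.
have k0 : 0 < k by rewrite invr_gt0 ltr0n muln_gt0.
have k1 : k <= 1 by rewrite invf_le1 ?ltr0n ?muln_gt0// ler1n muln_gt0.
have zk : `|z c h x i| <= 1 - k.
  rewrite leNgt; apply/negP => Hz; move: zi; apply/negP; rewrite -ltNge.
  have y0 : 0 <= 1 - k by rewrite subr_ge0.
  apply: (@le_lt_trans _ _ ((1 - k) ^+ (2 * N))).
    apply: le_trans (bernoulli_ge _ y0); rewrite mulrN /k !natrM.
    have -> : 2 * N%:R / (8 * N%:R) = 1 / 4 :> R by field; rewrite gt_eqF.
    by lra.
  by rewrite ltrXn2r// muln_eq0 negb_or/= -lt0n.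
have Nk : h / (16 * N)%:R = h / 2 * k.
  by rewrite /k !natrM; field; rewrite gt_eqF.
have E : x 0 i = c 0 i + h / 2 + h / 2 * z c h x i.
  by rewrite /z; field; rewrite gt_eqF.
move: zk; rewrite ler_norml => /andP[z1 z2].
have h20 : 0 <= h / 2 by rewrite divr_ge0// ltW.
have := ler_wpM2l h20 z1; have := ler_wpM2l h20 z2.
by rewrite Nk E; lra.
Qed.

Lemma bulge_lipschitz N c h x y : 0 < h ->
  (forall i, c 0 i <= x 0 i <= c 0 i + h) -> (forall i, c 0 i <= y 0 i <= c 0 i + h) ->
  `|bulge N c h x - bulge N c h y| <= (4 * n * N)%:R / h * `|x - y|.
Proof.
move=> h0 Qx Qy; rewrite /bulge -sumrB.
have z1 (w : 'rV[R]_n) i : (forall i, c 0 i <= w 0 i <= c 0 i + h) -> `|z c h w i| <= 1.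
  move=> /(_ i) /andP[w1 w2]; rewrite /z normrM normfV [`|h / 2|]gtr0_norm ?divr_gt0//.
  by rewrite ler_pdivrMr ?divr_gt0// mul1r ler_norml; apply/andP; split; lra.
apply: (le_trans (ler_norm_sum _ _ _)).
apply: (@le_trans _ _ (\sum_(i < n) ((2 * N)%:R * (`|x - y| / (h / 2))))).
  apply: ler_sum => i _; apply: (le_trans (lipschitz_exprn _ (z1 _ _ Qx) (z1 _ _ Qy))).
  rewrite ler_wpM2l//; rewrite /z -mulrBl normrM normfV [`|h / 2|]gtr0_norm ?divr_gt0//.
  have -> : x 0 i - (c 0 i + h / 2) - (y 0 i - (c 0 i + h / 2)) = (x - y) 0 i.
    by rewrite !mxE; lra.
  by apply: ler_wpM2r; [rewrite invr_ge0 divr_ge0// ltW|exact: le_coord_norm].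
rewrite sumr_const card_ord -[leLHS]mulr_natl !natrM le_eqVlt; apply/orP; left; apply/eqP.
by field; rewrite gt_eqF.
Qed.

(** With k = n/N, rescaled coordinates all at most 1 - k would give a sum at most n (1 - k)^(2N) <=
    n / (1 + 2n) < 1/2. *)
Lemma bulge_collar N c h x : 0 < h -> (0 < N)%N ->
  (forall i, c 0 i <= x 0 i <= c 0 i + h) -> 1 / 2 <= bulge N c h x ->
  exists i, x 0 i < c 0 i + h * n%:R / (2 * N)%:R \/ c 0 i + h - h * n%:R / (2 * N)%:R <= x 0 i.
Proof.
move=> h0 N0 Qx Gx; apply: contrapT => /forallNP Hi.
pose k : R := n%:R / N%:R.
have N0' : 0 < N%:R :> R by rewrite ltr0n.
have nR0 : 0 < n%:R :> R by rewrite ltr0n.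
have k0 : 0 < k by rewrite divr_gt0.
have Nk : h * n%:R / (2 * N)%:R = h / 2 * k.
  by rewrite /k !natrM; field; rewrite gt_eqF.
have zk i : `|z c h x i| <= 1 - k.
  have /not_orP[/negP H1 /negP H2] := Hi i.
  rewrite -leNgt Nk in H1; rewrite -ltNge Nk in H2.
  have E : x 0 i = c 0 i + h / 2 + h / 2 * z c h x i.
    by rewrite /z; field; rewrite gt_eqF.
  have h20 : 0 < h / 2 by rewrite divr_gt0.
  rewrite ler_norml -(ler_pM2l h20) -[X in _ && X](ler_pM2l h20).
  by apply/andP; split; lra.
have k1 : k <= 1.
  by have := le_trans (normr_ge0 _) (zk (Ordinal n0)); rewrite subr_ge0.
have : bulge N c h x <= n%:R * (1 - k) ^+ (2 * N).
  rewrite /bulge mulr_natl -[X in _ <= _ *+ X](card_ord n) -sumr_const.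
  apply: ler_sum => i _; apply: le_trans (ler_norm _) _; rewrite normrX.
  by apply: lerXn2r; rewrite ?nnegrE ?subr_ge0//; exact: zk.
have := @expr1Bn_le R k (2 * N); rewrite (ltW k0) k1 => /(_ isT).
have -> : (2 * N)%:R * k = 2 * n%:R by rewrite /k natrM; field; rewrite gt_eqF.
set w := (1 - k) ^+ (2 * N) => H1 H2.
have w0 : 0 <= w by rewrite exprn_ge0// subr_ge0.
have : 1 / 2 <= n%:R * w by exact: le_trans H2.
move: H1; rewrite mulrDr mulr1 mulrCA mulrC => H1 H3.
have wn : 0 < w.
  by rewrite lt_neqAle w0 andbT; apply/eqP => w00; move: H3; rewrite -w00 mulr0; lra.
by lra.
Qed.

End rounded_cell.

Section measurable_comparison.
Context d (T : measurableType d) (R : realType) (f g : T -> R).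
Hypotheses (mf : measurable_fun setT f) (mg : measurable_fun setT g).

Lemma measurable_ler_set : measurable [set x | f x <= g x].
Proof.
have := measurable_fun_ler mf mg measurableT (Y := [set true]) I.
by rewrite setTI (_ : _ @^-1` _ = [set x | f x <= g x]).
Qed.

Lemma measurable_ltr_set : measurable [set x | f x < g x].
Proof.
have := measurable_fun_ltr mf mg measurableT (Y := [set true]) I.
by rewrite setTI (_ : _ @^-1` _ = [set x | f x < g x]).
Qed.
End measurable_comparison.

Section rounded_cell_energy.
Context (R : realType) (n : nat) d (T : measurableType d)
  (mu : {sigma_finite_measure set T -> \bar R}) (pt : T -> 'rV[R]_n).
Hypothesis mod : lebesgue_model mu pt.
Hypothesis n0 : (0 < n)%N.
Variable s : R.
Hypothesis s01 : 0 < s < 1.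
Local Notation q := (2 `^ s).
Local Notation K := (fkernel pt s).
Local Notation cell := (cell pt).
Local Notation collar := (collar pt).

Lemma measurable_bulge N c h : measurable_fun setT (fun x => bulge N c h (pt x)).
Proof.
apply: measurable_sum => i; apply: measurable_funX; apply: measurable_funM => //.
by apply: measurable_funB => //; exact: (model_coord mod).
Qed.

(** All the removed layers [D] lie in [gap], of measure O(1/N), and a level chosen by averaging
    makes the energy small as well. [N] does not depend on the corner [c], so one exponent serves
    all cells of a grid. *)
Lemma rounded_cell (h e : R) : 0 < h -> 0 < e ->
  exists2 N, (0 < N)%N & forall c, exists2 t, 1 / 2 < t < 3 / 4 &
    let D := cell c h `\` [set x | bulge N c h (pt x) < t] in
    (energy mu K D <= e%:E)%E /\ (mu D <= e%:E)%E.
Proof.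
move=> h0 e0.
pose C := dyadic_cst n s * (h `^ s)^-1.
have C0 : 0 < C by rewrite divr_gt0 ?powR_gt0// dyadic_cst_gt0.
(* At scale [j] the integral of [gj j] is at most (4nN/h)(h/2^j)(n^2 h^n / N) + 2n h^n / 2^j: the
   slope of the bulge times the measure of the gap, plus the collar. [N] cancels, so [beta] can be
   fixed before it. *)
pose beta : R := (4 * n ^ 3 + 2 * n)%:R * h ^+ n.
have be0 : 0 <= beta by rewrite mulr_ge0// exprn_ge0// ltW.
have e1 : 0 < e / (16 * C) by rewrite divr_gt0// mulr_gt0.
have [a a0 Ha] := dyadic_series_small s01 be0 e1.
(* The three bounds on the measure of the gap serve the near scales, the measure of [D] and the far
   part of the energy. *)
pose a' := Num.min (Num.min a e) (e / (16 * C)).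
have a'0 : 0 < a' by rewrite !lt_min a0 e0.
have hn0 : 0 < h ^+ n by rewrite exprn_gt0.
pose N := (Num.bound ((n ^ 2)%:R * h ^+ n / a')).+1.
exists N => // c.
have N0 : 0 < N%:R :> R by rewrite ltr0n.
pose G x := bulge N c h (pt x).
have mG : measurable_fun setT G by exact: measurable_bulge.
pose gap : set T := cell c h `&` [set x | 1 / 2 <= G x].
have mgap : measurable gap.
  apply: measurableI; first exact: (measurable_cell mod).
  by apply: measurable_ler_set => //; exact: measurable_cst.
have gapE : (mu gap <= ((n ^ 2)%:R * h ^+ n / N%:R)%:E)%E.
  have r0 : 0 <= h * n%:R / (2 * N)%:R by rewrite divr_ge0// mulr_ge0// ltW.
  apply: (@le_trans _ _ (mu (collar c h (h * n%:R / (2 * N)%:R)))).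
    apply: le_measure; rewrite ?inE//; first exact: (measurable_collar mod).
    move=> x [Qx Gx]; split => //; apply: (bulge_collar n0 h0) Gx => //.
    by move=> i; have /andP[-> /ltW ->] := Qx i.
  apply: (le_trans (mu_collar mod c r0 h0)); rewrite lee_fin.
  rewrite !natrM le_eqVlt; apply/orP; left; apply/eqP.
  by field; rewrite !gt_eqF.
have gapa : (mu gap <= a'%:E)%E.
  apply: (le_trans gapE); rewrite lee_fin ler_pdivrMr// [a' * _]mulrC -ler_pdivrMr//.
  rewrite ltW// (lt_le_trans (archi_boundP _))// ?ler_nat//.
  by rewrite divr_ge0 ?mulr_ge0 ?(ltW hn0) ?(ltW a'0).
pose D t : set T := cell c h `\` [set x | bulge N c h (pt x) < t].
(* For [y] in the cell, the levels separating [x] from [y] fill at most an interval between [G y]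
   and [G x]; for [y] outside, any level may, hence the bound 1. *)
pose g (z : T * T) : R := \1_gap z.1 * Num.min 1 (`|G z.1 - G z.2| + \1_(~` cell c h) z.2).
pose L : R := (4 * n * N)%:R / h.
pose gj j (x : T) : R := \1_gap x * Num.min 1 (L * (h / 2 ^+ j) + \1_(collar c h (h / 2 ^+ j)) x).
have L0 : 0 <= L by rewrite divr_ge0// ltW.
have h2 j : 0 <= h / 2 ^+ j by rewrite divr_ge0 ?exprn_ge0// ltW.
have mcol j : measurable (collar c h (h / 2 ^+ j)) by exact: (measurable_collar mod).
have mc := measurable_cell mod c h.
have mg : measurable_fun setT g.
  apply: measurable_funM.
    exact: (measurableT_comp (measurable_indic mgap) measurable_fst).
  apply: measurable_minr; first exact: measurable_cst.
  apply: measurable_funD.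
    apply: measurableT_comp => //; apply: measurable_funB.
      exact: (measurableT_comp mG measurable_fst).
    exact: (measurableT_comp mG measurable_snd).
  exact: (measurableT_comp (measurable_indic (measurableC mc)) measurable_snd).
have mgj j : measurable_fun setT (gj j).
  apply: measurable_funM; first exact: measurable_indic.
  apply: measurable_minr; first exact: measurable_cst.
  by apply: measurable_funD; [exact: measurable_cst|exact: measurable_indic].
have g0 z : 0 <= g z by rewrite mulr_ge0// le_min ler01/= addr_ge0.
have gj0 j x : 0 <= gj j x by rewrite mulr_ge0// le_min ler01/= addr_ge0// mulr_ge0.
have min1 (w : R) : Num.min 1 w <= 1 by rewrite ge_min lexx.
(* The levels fill an interval of length 1/4, so [e / 4] would be the borderline; [e / 8] makes the
   selection inequality strict. *)
have Ig : (\int[mu \x mu]_z (g z * K z)%:E <= (e / 8)%:E)%E.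
  apply: (@le_trans _ _ (C%:E * (a'%:E + (e / (16 * C))%:E))%E); last first.
    rewrite -EFinD -EFinM lee_fin.
    have : a' <= e / (16 * C) by rewrite ge_min lexx orbT.
    move=> H; apply: (@le_trans _ _ (C * (e / (16 * C) + e / (16 * C)))).
      by rewrite ler_wpM2l ?(ltW C0)// lerD2r.
    by rewrite le_eqVlt; apply/orP; left; apply/eqP; field; rewrite gt_eqF.
  apply: (le_trans (dyadic_energy mod s01 (M := \1_gap) mg g0 h0 _ _ mgj gj0 _ _)) => //.
  - move=> x y j xy; rewrite /g /gj /=.
    rewrite [X in X * _]indicE [X in _ <= X * _]indicE; case: (boolP (x \in gap)); rewrite ?mul0r// inE => -[Qx _].
    rewrite !mul1r; have [Qy|Qy] := pselect (cell c h y).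
      have -> : \1_(~` cell c h) y = 0 :> R by rewrite indicE memNset.
      rewrite addr0 le_min ge_min lexx/=; rewrite ge_min; apply/orP; right.
      apply: (@le_trans _ _ (L * (h / 2 ^+ j))); last by rewrite lerDl.
      apply: (le_trans (bulge_lipschitz _ h0 _ _)).
      + by move=> i; have /andP[-> /ltW ->] := Qx i.
      + by move=> i; have /andP[-> /ltW ->] := Qy i.
      + by rewrite ler_wpM2l// ltW.
    have -> : \1_(collar c h (h / 2 ^+ j)) x = 1 :> R.
      by rewrite indicE mem_set//; exact: near_collar xy.
    by rewrite (le_trans (min1 _))// le_min lexx/= lerDr mulr_ge0.
  - move=> x y _; rewrite /g /= -[leRHS]mulr1 ler_wpM2l//.
  rewrite -/C lee_wpmul2l//; first by rewrite lee_fin ltW.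
  apply: leeD; first by rewrite integral_indic// setIT.
  have gjgap j : (\int[mu]_x (gj j x)%:E <= mu gap)%E.
    rewrite -[X in (_ <= mu X)%E]setIT -integral_indic//; apply: ge0_le_integral => //.
    - by move=> x _; rewrite lee_fin.
    - by apply/measurable_EFinP.
    - by apply/measurable_EFinP; exact: measurable_indic.
    - by move=> x _; rewrite lee_fin /gj -[leRHS]mulr1 ler_wpM2l.
  apply: Ha.
  - by move=> j; apply: integral_ge0 => x _; rewrite lee_fin.
  - move=> j; apply: (le_trans (gjgap j)); apply: (le_trans gapa).
    by rewrite lee_fin !ge_min lexx.
  move=> j.
  apply: (@le_trans _ _ (\int[mu]_x ((L * (h / 2 ^+ j))%:E * (\1_gap x)%:E + (\1_(collar c h (h / 2 ^+ j)) x)%:E))%E).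
    apply: ge0_le_integral => //.
    - by move=> x _; rewrite lee_fin.
    - by apply/measurable_EFinP.
    - apply: emeasurable_funD; last by apply/measurable_EFinP; exact: measurable_indic.
      by apply: measurable_funeM; apply/measurable_EFinP; exact: measurable_indic.
    move=> x _; rewrite -EFinM -EFinD lee_fin /gj indicE; case: (x \in gap).
      by rewrite mul1r mulr1 ge_min lexx orbT.
    by rewrite mul0r mulr0 add0r.
  have Lh0 : 0 <= L * (h / 2 ^+ j) by rewrite mulr_ge0.
  have mind (A : set T) : measurable A -> measurable_fun setT (fun x => (\1_A x)%:E : \bar R).
    by move=> mA; apply/measurable_EFinP; exact: measurable_indic.
  have ind0 (A : set T) x : (0 <= (\1_A x)%:E :> \bar R)%E by rewrite lee_fin.
  have mZ : measurable_fun setT (fun x => (L * (h / 2 ^+ j))%:E * (\1_gap x)%:E)%E.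
    by apply: measurable_funeM; exact: mind.
  have Z0 x : (0 <= (L * (h / 2 ^+ j))%:E * (\1_gap x)%:E)%E by rewrite mule_ge0// lee_fin.
  rewrite (ge0_integralD _ measurableT (fun x _ => Z0 x) mZ (fun x _ => ind0 _ x) (mind _ (mcol j))).
  rewrite (ge0_integralZl _ measurableT (mind _ mgap) (fun x _ => ind0 _ x)); last by rewrite lee_fin.
  rewrite !integral_indic// !setIT.
  apply: (@le_trans _ _ ((L * (h / 2 ^+ j))%:E * ((n ^ 2)%:R * h ^+ n / N%:R)%:E +
     ((2 * n)%:R * (h / 2 ^+ j * (h ^+ n / h)))%:E)%E).
    apply: leeD; first by rewrite lee_wpmul2l// lee_fin.
    exact: (mu_collar mod).
  rewrite -EFinM -EFinD lee_fin /L /beta !natrD !natrM ?natrX ?expr2.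
  have j1 : (2 : R) ^+ j != 0 by rewrite expf_neq0.
  by rewrite le_eqVlt; apply/orP; left; apply/eqP; field; rewrite !gt_eqF.
have mD : measurable [set p : measurableTypeR R * T | D p.1 p.2].
  have -> : [set p : measurableTypeR R * T | D p.1 p.2] =
      (snd @^-1` cell c h) `&` [set p | p.1 <= G p.2].
    apply/seteqP; split=> [p [Qp Gp]|p [Qp Gp]]; split => //.
      by rewrite /= leNgt; apply/negP.
    by apply/negP; rewrite -leNgt.
  apply: measurableI.
    by rewrite -[X in measurable X]setTI; exact: measurable_snd.
  apply: measurable_ler_set; first exact: measurable_fst.
  exact: (measurableT_comp mG measurable_snd).
have Dg z : (lebesgue_measure [set t | [/\ (1 / 2 < t < 3 / 4)%R, D t z.1 & ~ D t z.2]] <= (g z)%:E)%E.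
  rewrite /g; have [zg|zg] := pselect (gap z.1); last first.
    rewrite (_ : mkset _ = set0) ?measure0 ?lee_fin//.
    apply/seteqP; split=> // t [t12 [Qz /negP]]; rewrite -leNgt => Gz _; apply: zg.
    by split => //=; case/andP: t12 => t12 _; rewrite (le_trans (ltW t12)).
  have -> : \1_gap z.1 = 1 :> R by rewrite indicE mem_set.
  have l14 (A : set (measurableTypeR R)) : measurable A ->
      (lebesgue_measure (`]((1 / 2)%R : R), (3 / 4)%R[%classic `&` A) <= 1%:E)%E.
    move=> mA; apply: (@le_trans _ _ (lebesgue_measure (`]((1 / 2)%R : R), (3 / 4)%R[%classic : set R))).
      by apply: le_measure; rewrite ?inE//; exact: measurableI.
    by rewrite lebesgue_measure_itv/= lte_fin; case: ifPn => _; rewrite ?lee_fin//; lra.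
  rewrite [X in (_ <= X%:E)%E]mul1r; have [Qz|Qz] := pselect (cell c h z.2).
    have -> : [set t | [/\ (1 / 2 < t < 3 / 4)%R, D t z.1 & ~ D t z.2]] =
       `]((1 / 2)%R : R), (3 / 4)%R[%classic `&` `]G z.2, G z.1]%classic.
      apply/seteqP; split=> [t [t12 [Q1 /negP G1] nD]|t].
        rewrite -leNgt in G1; split; first by rewrite /= in_itv.
        by rewrite /= in_itv/= G1 andbT ltNge; apply/negP => H; apply: nD; split => //; apply/negP; rewrite -leNgt.
      rewrite /= !in_itv/= => -[t12 /andP[H1 H2]]; split => //; last by move=> [_]; rewrite /= -/(G z.2) H1.
      by split; [exact: zg.1|apply/negP; rewrite -leNgt].
    rewrite EFin_min le_min l14/=; last exact: measurable_itv.
    apply: (@le_trans _ _ (lebesgue_measure (`]G z.2, G z.1]%classic : set R))).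
      by apply: le_measure; rewrite ?inE//; exact: measurableI.
    rewrite lebesgue_measure_itv/= lte_fin; case: ifPn => _; rewrite lee_fin; last by rewrite addr_ge0.
    by rewrite (le_trans (ler_norm _))// lerDl.
  have -> : [set t | [/\ (1 / 2 < t < 3 / 4)%R, D t z.1 & ~ D t z.2]] =
     `]((1 / 2)%R : R), (3 / 4)%R[%classic `&` `]-oo, G z.1]%classic.
    apply/seteqP; split=> [t [t12 [Q1 /negP G1] nD]|t].
      by rewrite -leNgt in G1; split; rewrite /= in_itv.
    rewrite /= !in_itv/= => -[t12 H2]; split => //; last by move=> [].
    by split; [exact: zg.1|apply/negP; rewrite -leNgt].
  have -> : \1_(~` cell c h) z.2 = 1 :> R by rewrite indicE mem_set.
  by rewrite min_l ?lerDr// l14//; exact: measurable_itv.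
have t12 : (1 / 2 : R) < 3 / 4 by lra.
have Ie : (\int[mu \x mu]_z (g z * K z)%:E < (e * (3 / 4 - 1 / 2))%:E)%E.
  by apply: (le_lt_trans Ig); rewrite lte_fin; lra.
have [t [t1 t2]] := energy_selection (measurable_fkernel mod s) (fkernel_ge0 _ _) mD mg t12 Dg Ie.
exists t => //; split => //.
apply: (@le_trans _ _ (mu gap)); last first.
  by apply: (le_trans gapa); rewrite lee_fin !ge_min lexx orbT.
apply: le_measure; rewrite ?inE//.
  apply: measurableD => //.
  by apply: measurable_ltr_set => //; exact: measurable_cst.
move=> x [Qx Gx]; split => //; rewrite /=; apply: (@le_trans _ _ t).
  by move/andP: t1 => [/ltW].
by rewrite leNgt; apply/negP.
Qed.
End rounded_cell_energy.

(** * Averages over a grid *)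

Section grid.
Context (R : realType) (n : nat) d (T : measurableType d)
  (mu : {sigma_finite_measure set T -> \bar R}) (pt : T -> 'rV[R]_n).
Hypothesis mod : lebesgue_model mu pt.
Variable h : R.
Hypothesis h0 : 0 < h.
Local Notation cell := (cell pt).

Definition grid (m : 'rV[int]_n) : 'rV[R]_n := \row_i (h * (m 0 i)%:~R).

Definition grid_index (x : 'rV[R]_n) : 'rV[int]_n := \row_i Num.floor (x 0 i / h).

Lemma cell_grid m x : cell (grid m) h x <-> grid_index (pt x) = m.
Proof.
split=> [H|<- i].
  apply/rowP => i; rewrite !mxE; apply: floor_def.
  have /andP[H1 H2] := H i; rewrite mxE in H1 H2.
  by rewrite ler_pdivlMr// ltr_pdivrMr// mulrC H1/= intrD mulrC mulrDr mulr1.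
have := floor_itv (pt x 0 i / h); rewrite !mxE intrD ler_pdivlMr// ltr_pdivrMr//.
by rewrite mulrDl mul1r ![_%:~R * h]mulrC.
Qed.

Lemma cell_near m x y : cell (grid m) h x -> cell (grid m) h y -> `|pt x - pt y| < h.
Proof.
move=> Hx Hy; apply/rV_norm_ltP => // i; have /andP[x1 x2] := Hx i; have /andP[y1 y2] := Hy i.
by rewrite !mxE ltr_norml; apply/andP; split; lra.
Qed.

Definition same_cell : set (T * T) :=
  [set z | grid_index (pt z.1) = grid_index (pt z.2)].

Lemma measurable_same_cell : measurable same_cell.
Proof.
rewrite (_ : same_cell = \bigcup_(m in [set: 'rV[int]_n]) (cell (grid m) h `*` cell (grid m) h)).
  apply: countable_bigcupT_measurable => // m.
  by apply: measurableX; exact: (measurable_cell mod).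
apply/seteqP; split=> [[x y] /= E|[x y] [m _ [/cell_grid E1 /cell_grid E2]]].
  by exists (grid_index (pt x)) => //; split; apply/cell_grid.
by rewrite /same_cell/= E1 E2.
Qed.

Lemma xsection_same_cell x : xsection same_cell x = cell (grid (grid_index (pt x))) h.
Proof.
apply/seteqP; split=> y; rewrite /xsection/=.
  by rewrite inE => E; apply/cell_grid; exact/esym.
by move=> /cell_grid E; rewrite inE; exact/esym.
Qed.

Lemma mu_grid_cell m : mu (cell (grid m) h) = (h ^+ n)%:E.
Proof. exact: (mu_cell mod). Qed.

Variable A : set T.
Hypothesis mA : measurable A.

Local Notation Q x := (cell (grid (grid_index (pt x))) h).

Let mQ x : measurable (Q x). Proof. exact: (measurable_cell mod). Qed.

Let muQ x : mu (A `&` Q x) \is a fin_num.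
Proof.
rewrite ge0_fin_numE//; apply: (@le_lt_trans _ _ (mu (Q x))).
  by apply: le_measure; rewrite ?inE//; exact: measurableI.
by rewrite [ltLHS]mu_grid_cell ltry.
Qed.

Definition cell_mean (x : T) : R := fine (mu (A `&` Q x)) / h ^+ n.

Lemma cell_meanE x : (cell_mean x * h ^+ n)%:E = mu (A `&` Q x).
Proof. by rewrite divfK ?fineK// expf_neq0// gt_eqF. Qed.

Lemma cell_meanC x : ((1 - cell_mean x) * h ^+ n)%:E = mu (~` A `&` Q x).
Proof.
rewrite mulrBl mul1r EFinB cell_meanE -[in LHS](mu_grid_cell (grid_index (pt x))).
rewrite [in RHS]setIC -setDE measureD//; last by rewrite [ltLHS]mu_grid_cell ltry.
by rewrite [in RHS]setIC.
Qed.

Lemma cell_mean01 x : 0 <= cell_mean x <= 1.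
Proof.
have hn0 : 0 < h ^+ n by rewrite exprn_gt0.
apply/andP; split; first by rewrite -(pmulr_lge0 _ hn0) -lee_fin cell_meanE.
by rewrite -subr_ge0 -(pmulr_lge0 _ hn0) -lee_fin cell_meanC.
Qed.

Lemma measurable_cell_mean : measurable_fun setT cell_mean.
Proof.
apply: measurable_funM => //.
rewrite (_ : (fun x => _) = fun x => fine (mu (xsection (same_cell `&` (setT `*` A)) x))); last first.
  apply/funext => x; congr (fine (mu _)); rewrite setIC -xsection_same_cell.
  by apply/seteqP; split=> y; rewrite /xsection/= !inE => -[] // ? [].
apply: (measurableT_comp (fine_measurable measurableT)).
apply: measurable_fun_xsection; apply: measurableI; first exact: measurable_same_cell.
exact: measurableX.
Qed.

Lemma same_cell_mean x y : same_cell (x, y) -> cell_mean x = cell_mean y.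
Proof. by rewrite /same_cell/= /cell_mean => ->. Qed.

End grid.

Lemma integral_rectangle d1 d2 (T1 : measurableType d1) (T2 : measurableType d2) (R : realType)
    (m1 : {sigma_finite_measure set T1 -> \bar R}) (m2 : {sigma_finite_measure set T2 -> \bar R})
    (P : set T1) (Q : set T2) (v : R) : measurable P -> measurable Q -> 0 <= v ->
  (\int[sf_product m1 m2]_z (v * \1_(P `*` Q) z)%:E = v%:E * (m1 P * m2 Q))%E.
Proof.
move=> mP mQ v0.
have mPQ : measurable (P `*` Q) by exact: measurableX.
under eq_integral do rewrite EFinM.
rewrite (ge0_integralZl (sf_product m1 m2) measurableT _ (fun z _ => _)) ?lee_fin//.
- by rewrite integral_indic// setIT -product_measure1E.
- by apply/measurable_EFinP; exact: measurable_indic.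
Qed.

Section step_energy.
Context (R : realType) (n : nat) d (T : measurableType d)
  (mu : {sigma_finite_measure set T -> \bar R}) (pt : T -> 'rV[R]_n).
Hypothesis mod : lebesgue_model mu pt.
Variable h : R.
Hypothesis h0 : 0 < h.
Variable A : set T.
Hypothesis mA : measurable A.
Variable W : T * T -> R.
Hypothesis mW : measurable_fun setT W.
Hypothesis W0 : forall z, 0 <= W z.

Local Notation same := (same_cell pt h).
Local Notation Q x := (cell pt (grid h (grid_index h (pt x))) h).
Local Notation u := (cell_mean mu pt h A).
Local Notation nu := (sf_product mu mu).

(** Pairs in a common cell are left out: a function constant on cells does not separate them, and
    the kernel is not integrable on the square of a cell. *)
Definition cell_average (z : T * T) : \bar R :=
  ((h ^+ n * h ^+ n)^-1%:E * \int[mu \x mu]_(w in Q z.1 `*` Q z.2) (\1_(~` same) w * W w)%:E)%E.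

Let V (w : T * T) := \1_(~` same) w * W w.

Let mS : measurable same. Proof. exact: (measurable_same_cell mod h0). Qed.

Let mV : measurable_fun setT V.
Proof. by apply: measurable_funM => //; apply: measurable_indic; exact: measurableC. Qed.

Let V0 w : 0 <= V w. Proof. by rewrite mulr_ge0. Qed.

(** The two pairs lie in the same product of cells. This relation is symmetric, so averaging can be
    moved from the kernel to the set. *)
Let S4 : set ((T * T) * (T * T)) := [set p | same (p.1.1, p.2.1) /\ same (p.1.2, p.2.2)].

Let mS4 : measurable S4.
Proof.
have m1 : measurable_fun [set: (T * T) * (T * T)] (fun p => (p.1.1, p.2.1)).
  apply/measurable_fun_pairP; split.
    exact: (measurableT_comp measurable_fst measurable_fst).
  exact: (measurableT_comp measurable_fst measurable_snd).
have m2 : measurable_fun [set: (T * T) * (T * T)] (fun p => (p.1.2, p.2.2)).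
  apply/measurable_fun_pairP; split.
    exact: (measurableT_comp measurable_snd measurable_fst).
  exact: (measurableT_comp measurable_snd measurable_snd).
rewrite (_ : S4 = (fun p => (p.1.1, p.2.1)) @^-1` same `&` (fun p => (p.1.2, p.2.2)) @^-1` same)//.
apply: measurableI; rewrite -[X in measurable X]setTI.
  exact: (m1 measurableT _ mS).
exact: (m2 measurableT _ mS).
Qed.

Let H (p : (T * T) * (T * T)) : \bar R := (\1_S4 p * V p.1)%:E.

Let mH : measurable_fun setT H.
Proof.
apply/measurable_EFinP; apply: measurable_funM; first exact: measurable_indic.
exact: (measurableT_comp mV measurable_fst).
Qed.

Let H0 p : (0 <= H p)%E. Proof. by rewrite lee_fin mulr_ge0. Qed.

Let S4E w z : S4 (w, z) <-> (Q z.1 `*` Q z.2) w.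
Proof.
rewrite /S4 /same_cell /=; split=> -[H1 H2].
  by split; apply/(cell_grid _ h0); exact/esym.
by split => /=; apply/(cell_grid _ h0).
Qed.

Let HE z : (\int[mu \x mu]_w H (w, z) = \int[mu \x mu]_(w in Q z.1 `*` Q z.2) (V w)%:E)%E.
Proof.
rewrite [RHS]integral_mkcond; apply: eq_integral => w _.
rewrite patchE /H indicE; case: (boolP (w \in _)) => wQ.
  by rewrite mem_set ?mul1r//; apply/S4E; rewrite inE in wQ.
by rewrite memNset ?mul0r// => /S4E wQ'; move/negP: wQ; apply; rewrite inE.
Qed.

Lemma cell_average_ge0 z : (0 <= cell_average z)%E.
Proof.
rewrite mule_ge0 ?lee_fin ?invr_ge0 ?mulr_ge0 ?exprn_ge0 ?(ltW h0)//.
by apply: integral_ge0 => w _; rewrite lee_fin; exact: V0.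
Qed.

Lemma measurable_cell_average : measurable_fun setT cell_average.
Proof.
apply: measurable_funeM.
rewrite (_ : (fun z => _) = fun z => (\int[nu]_w H (w, z))%E); last by apply/funext => z; rewrite -HE.
exact: (@measurable_fun_fubini_tonelli_G _ _ _ _ _ nu H mH H0).
Qed.

Let F (p : (T * T) * (T * T)) : \bar R := (H p * (\1_(A `*` ~` A) p.2)%:E)%E.

Let mAA : measurable (A `*` ~` A).
Proof. by apply: measurableX => //; exact: measurableC. Qed.

Let mF : measurable_fun setT F.
Proof.
apply: emeasurable_funM => //; apply/measurable_EFinP.
exact: (measurableT_comp (measurable_indic mAA) measurable_snd).
Qed.

Let F0 p : (0 <= F p)%E.
Proof. by rewrite mule_ge0// lee_fin. Qed.

Let k := (h ^+ n * h ^+ n)^-1.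

Let k0 : 0 <= k.
Proof. by rewrite invr_ge0 mulr_ge0 ?exprn_ge0 ?(ltW h0). Qed.

Let FzE z : (k%:E * \int[nu]_w F (w, z) = (cell_average \_ (A `*` ~` A)) z)%E.
Proof.
rewrite patchE /cell_average -HE.
case: (boolP (z \in _)) => zA.
  by congr (_ * _)%E; apply: eq_integral => w _; rewrite /F /= indicE zA mule1.
rewrite [X in (_ * X)%E]integral0_eq ?mule0// => w _.
by rewrite /F /= indicE (negbTE zA) mule0.
Qed.

Let FwE w : (k%:E * \int[nu]_z F (w, z) =
  (u w.1 * (1 - u w.2) * \1_(~` same) w * W w)%:E)%E.
Proof.
have mQ x : measurable (Q x) by exact: (measurable_cell mod).
have mAC := measurableC mA.
have -> : (\int[nu]_z F (w, z) = \int[nu]_z (V w * \1_((A `&` Q w.1) `*` (~` A `&` Q w.2)) z)%:E)%E.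
  apply: eq_integral => z _; rewrite /F /H /= -!EFinM; congr (_%:E).
  rewrite [\1_S4 _ * _]mulrC -mulrA; congr (_ * _).
  rewrite !indicE -natrM mulnb; congr (_%:R); congr nat_of_bool.
  apply/andP/idP => [[]|]; rewrite !inE.
    move=> [/= s1 s2] [A1 A2]; split; split=> //; apply/(cell_grid _ h0); exact/esym.
  move=> [[A1 /(cell_grid _ h0) s1] [A2 /(cell_grid _ h0) s2]]; split=> //.
rewrite (integral_rectangle mu mu (measurableI _ _ mA (mQ _)) (measurableI _ _ mAC (mQ _)) (V0 w)).
rewrite -(cell_meanE mod h0 mA) -(cell_meanC mod h0 mA) -!EFinM; congr (_%:E).
by rewrite /V /k; field; rewrite gt_eqF ?exprn_gt0.
Qed.

(** Tonelli for [F], in which [w] and [z] share a product of cells and [z] leaves [A]. For fixed [z]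
    the inner integral averages [W]; for fixed [w] it counts the admissible [z] and yields the
    densities of [A] and of its complement. *)
Lemma step_energy :
  (\int[mu \x mu]_z (u z.1 * (1 - u z.2) * \1_(~` same) z * W z)%:E =
   \int[mu \x mu]_(z in A `*` ~` A) cell_average z)%E.
Proof.
pose Gz z := (\int[nu]_w F (w, z))%E; pose Gw w := (\int[nu]_z F (w, z))%E.
have mGz : measurable_fun setT Gz := @measurable_fun_fubini_tonelli_G _ _ _ _ _ nu F mF F0.
have mGw : measurable_fun setT Gw := @measurable_fun_fubini_tonelli_F _ _ _ _ _ nu F mF F0.
have Gz0 z : setT z -> (0 <= Gz z)%E by move=> _; apply: integral_ge0.
have Gw0 w : setT w -> (0 <= Gw w)%E by move=> _; apply: integral_ge0.
have kE0 : (0 <= k%:E)%E by rewrite lee_fin.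
have Ez := ge0_integralZl nu measurableT mGz Gz0 kE0.
have Ew := ge0_integralZl nu measurableT mGw Gw0 kE0.
rewrite [RHS]integral_mkcond.
transitivity (\int[nu]_w (k%:E * Gw w))%E.
  by apply: (congr1 (integral nu setT)); apply/funext => w; rewrite FwE.
transitivity (\int[nu]_z (k%:E * Gz z))%E; last first.
  by apply: (congr1 (integral nu setT)); apply/funext => z; rewrite -FzE.
exact: (etrans Ew (etrans (congr1 (mule k%:E) (fubini_tonelli F mF F0)) (esym Ez))).
Qed.

(** A level separates x from y with measure at most u(x) - u(y) <= u(x)(1 - u(y)), because u(x) u(y)
    <= u(y). Levels near 0 and 1 are excluded so that, where [A] and the superlevel set disagree,
    the density is off by at least [eta]; the interval of length 1 - 2 eta accounts for the factor
    in the hypothesis. *)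
Lemma energy_superlevel (eta I : R) : 0 < eta < 1 / 2 ->
  (\int[mu \x mu]_(z in A `*` ~` A) cell_average z < (I * (1 - eta - eta))%:E)%E ->
  exists t, eta < t < 1 - eta /\ (energy mu W [set x | (t < u x)%R] <= I%:E)%E.
Proof.
move=> /andP[e0 e1]; rewrite -step_energy => HI.
have mu_ : measurable_fun setT u by exact: (measurable_cell_mean mod).
pose g (z : T * T) := u z.1 * (1 - u z.2) * \1_(~` same) z.
have mg : measurable_fun setT g.
  apply: measurable_funM; last by apply: measurable_indic; exact: measurableC.
  apply: measurable_funM; first exact: (measurableT_comp mu_ measurable_fst).
  apply: measurable_funB; first exact: measurable_cst.
  exact: (measurableT_comp mu_ measurable_snd).
apply: (@energy_selection _ _ _ _ W mW W0 (fun t => [set x | t < u x]) g) => //.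
- rewrite (_ : [set p | _] = [set p : measurableTypeR R * T | p.1 < u p.2])//.
  apply: measurable_ltr_set; first exact: measurable_fst.
  exact: (measurableT_comp mu_ measurable_snd).
- lra.
move=> z; rewrite /g.
have /andP[u10 u11] := cell_mean01 mod h0 mA z.1; have /andP[u20 u21] := cell_mean01 mod h0 mA z.2.
have v20 : 0 <= 1 - u z.2 by rewrite subr_ge0.
have g0 : 0 <= u z.1 * (1 - u z.2) * \1_(~` same) z.
  by rewrite indicE; exact: mulr_ge0 (mulr_ge0 u10 v20) (ler0n _ _).
have [sz|sz] := pselect (same z).
  rewrite (_ : mkset _ = set0) ?measure0 ?lee_fin//.
  apply/seteqP; split=> // t [_ /= tu]; apply.
  by case: z sz tu {u10 u11 u20 u21 v20 g0} => x y sz /=; rewrite (same_cell_mean _ _ sz).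
have -> : \1_(~` same) z = 1 :> R by rewrite indicE mem_set.
rewrite mulr1; apply: (@le_trans _ _ (lebesgue_measure (`[u z.2, u z.1[%classic : set R))).
  rewrite [X in (lebesgue_measure X <= _)%E](_ : _ = `]eta, (1 - eta)%R[%classic `&` `[u z.2, u z.1[%classic).
    by apply: le_measure; rewrite ?inE//; first apply: measurableI; exact: measurable_itv.
  apply/seteqP; split=> t /=; rewrite !in_itv/=.
    by move=> [-> -> /negP]; rewrite -leNgt => ->.
  by move=> [-> /andP[t2 t1]]; split=> //; apply/negP; rewrite -leNgt.
rewrite lebesgue_measure_itv/= lte_fin; case: ifPn => _; rewrite lee_fin; last exact: mulr_ge0.
have : u z.1 * u z.2 <= u z.2 by rewrite ler_piMl.
by lra.
Qed.

End step_energy.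

Section cell_average_limit.
Context (R : realType) (n : nat) d (T : measurableType d)
  (mu : {sigma_finite_measure set T -> \bar R}) (pt : T -> 'rV[R]_n).
Hypothesis mod : lebesgue_model mu pt.
Hypothesis n0 : (0 < n)%N.
Variable s : R.
Hypothesis s01 : 0 < s < 1.
Local Notation p := (n%:R + s).
Local Notation K := (fkernel pt s).
Variable W : T * T -> R.
Hypothesis mW : measurable_fun setT W.
Hypothesis W0 : forall z, 0 <= W z.
Hypothesis WK : forall z, W z <= K z.

Let C1 := dyadic_cst n s * (1 + (2 * n)%:R / (1 - 2 `^ s / 2)).
(** [C1] is the energy constant of a cell. The factor [(3 n)^p] turns a bound by [(r / 3)^-p], with
    [r] the sup distance, into one by the Euclidean kernel. *)
Definition average_cst := (3 * n%:R) `^ p * (1 + C1).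

Let C10 : 0 <= C1.
Proof.
have /andP[_ q1] := dyadic_ratio s01.
by rewrite mulr_ge0 ?(ltW (dyadic_cst_gt0 n s01))// addr_ge0// divr_ge0// subr_ge0 ltW.
Qed.

Lemma average_cst_ge0 : 0 <= average_cst.
Proof. by rewrite mulr_ge0 ?powR_ge0// addr_ge0. Qed.

Section one_scale.
Variable h : R.
Hypothesis h0 : 0 < h.
Local Notation same := (same_cell pt h).
Local Notation Q x := (cell pt (grid h (grid_index h (pt x))) h).

Let mV : measurable_fun setT (fun w => \1_(~` same) w * W w).
Proof.
apply: measurable_funM => //; apply: measurable_indic; apply: measurableC.
exact: (measurable_same_cell mod h0).
Qed.

Let mQQ x y : measurable (Q x `*` Q y).
Proof. by apply: measurableX; exact: (measurable_cell mod). Qed.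

Let QQE x y (k : R) :
  ((h ^+ n * h ^+ n)^-1%:E * \int[mu \x mu]_(w in Q x `*` Q y) k%:E = k%:E)%E.
Proof.
have hn0 : 0 < h ^+ n by rewrite exprn_gt0.
have E : ((mu \x mu) (Q x `*` Q y) = (h ^+ n * h ^+ n)%:E)%E.
  have mQ v : measurable (Q v) by exact: (measurable_cell mod).
  rewrite (product_measure1E mu mu (mQ x) (mQ y)) EFinM.
  by congr (_ * _)%E; exact: (mu_grid_cell mod h0).
rewrite integral_cst// [X in (_ * (_ * X))%E]E -!EFinM; congr (_%:E).
by field; rewrite gt_eqF.
Qed.

Lemma cell_average_le z : z.1 != z.2 ->
  (cell_average mu pt h W z <= (average_cst * K z)%:E)%E.
Proof.
case: z => x y /= xy.
have hn0 : 0 < h ^+ n by rewrite exprn_gt0.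
have k0 : 0 <= (h ^+ n * h ^+ n)^-1 by rewrite invr_ge0 mulr_ge0 ?(ltW hn0).
have [/andP[s0 _]] := s01.
have p0 : 0 < p by rewrite ltr_wpDl.
set r := `|pt x - pt y|.
have r0 : 0 < r.
  by rewrite normr_gt0 subr_eq0; apply: contra_neq xy; exact: (model_inj mod).
set k := ((r / 3) `^ p)^-1.
have rp0 : 0 < (r / 3) `^ p by rewrite powR_gt0// divr_gt0.
have kp : 0 <= k by rewrite invr_ge0 ltW.
have kK : k <= (3 * n%:R) `^ p * K (x, y).
  apply: (@le_trans _ _ ((3 * n%:R) `^ p * ((n%:R * r) `^ p)^-1)); last first.
    by apply: ler_wpM2l; [exact: powR_ge0|exact: (fkernel_ge mod)].
  have c0 : 0 < (3 * n%:R) `^ p by rewrite powR_gt0// mulr_gt0// ltr0n.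
  have -> : (n%:R * r) `^ p = (3 * n%:R) `^ p * (r / 3) `^ p.
    rewrite -powRM; [|by rewrite mulr_ge0|by rewrite divr_ge0// ltW].
    by congr (_ `^ _); field.
  by rewrite invfM mulrA divff ?mul1r// gt_eqF.
have xQ : Q x x by apply/(cell_grid _ h0).
have yQ : Q y y by apply/(cell_grid _ h0).
suff : (cell_average mu pt h W (x, y) <= ((1 + C1) * k)%:E)%E.
  move=> /le_trans; apply; rewrite lee_fin /average_cst mulrC [X in _ <= X]mulrAC.
  by rewrite ler_wpM2r// addr_ge0.
(* When [3 h <= r], points of the two cells are at distance at least [r - 2 h >= r / 3], and the
   kernel is bounded pointwise. *)
have [rh|rh] := leP (3 * h) r.
  apply: (@le_trans _ _ k%:E); last by rewrite lee_fin ler_peMl// lerDl.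
  rewrite -(QQE x y k); apply: lee_wpmul2l; first by rewrite lee_fin.
  apply: ge0_le_integral; first exact: mQQ.
  - by move=> w _; rewrite lee_fin mulr_ge0.
  - by apply/measurable_EFinP; exact: measurable_funS mV.
  - exact: measurable_cst.
  move=> -[v w] [/= vQ wQ]; rewrite lee_fin.
  apply: (@le_trans _ _ (W (v, w))); first by rewrite ler_piMl// indicE lern1 leq_b1.
  apply: (le_trans (WK _)); apply: fkernel_le => //; first by rewrite divr_gt0.
  have := cell_near h0 vQ xQ; have := cell_near h0 yQ wQ => h1 h2.
  have : r <= `|pt x - pt v| + `|pt v - pt w| + `|pt w - pt y|.
    rewrite /r (_ : pt x - pt y = (pt x - pt v) + (pt v - pt w) + (pt w - pt y)).
      by rewrite (le_trans (ler_normD _ _))// lerD2r ler_normD.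
    by rewrite !addrA !subrK.
  rewrite [`|pt x - pt v|]distrC [`|pt w - pt y|]distrC.
  by move: h1 h2 rh; rewrite -/r; lra.
have [sxy|sxy] := pselect (same (x, y)).
  rewrite /cell_average /= integral0_eq ?mule0 ?lee_fin ?mulr_ge0 ?addr_ge0// => -[v w] [/= vQ wQ].
  rewrite indicE memNset ?mul0r//; apply; rewrite /same_cell/=.
  by move: vQ wQ => /(cell_grid _ h0) -> /(cell_grid _ h0) ->.
(* For close but distinct cells the kernel may be singular, but the second cell lies in the
   complement of the first, so the energy of one cell bounds the integral; it gives [C1 h^-p], and
   [h > r / 3]. *)
apply: (@le_trans _ _ ((h ^+ n * h ^+ n)^-1%:E * (C1 * ((h `^ s)^-1 * h ^+ n))%:E)%E).
  apply: lee_wpmul2l; first by rewrite lee_fin.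
  apply: (@le_trans _ _ (\int[mu \x mu]_(w in Q x `*` Q y) (K w)%:E)%E).
    apply: ge0_le_integral; first exact: mQQ.
    - by move=> w _; rewrite lee_fin mulr_ge0.
    - by apply/measurable_EFinP; exact: measurable_funS mV.
    - by apply/measurable_EFinP; apply: measurable_funS (measurable_fkernel mod s).
    move=> w _; rewrite lee_fin (le_trans _ (WK _))// ler_piMl// indicE lern1 leq_b1//.
  apply: le_trans (energy_cell mod s01 (grid h (grid_index h (pt x))) h0).
  apply: ge0_subset_integral; first exact: mQQ.
  - by apply: measurableX; [|apply: measurableC]; exact: (measurable_cell mod).
  - by apply/measurable_EFinP; apply: measurable_funS (measurable_fkernel mod s).
  - by move=> w _; rewrite lee_fin fkernel_ge0.
  move=> -[v w] [/= vQ wQ]; split=> //= wQ'; apply: sxy.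
  by rewrite /same_cell/=; move: wQ wQ' => /(cell_grid _ h0) <- /(cell_grid _ h0) <-.
rewrite -EFinM lee_fin.
rewrite (_ : (h ^+ n * h ^+ n)^-1 * _ = C1 * (h `^ p)^-1); last first.
  rewrite powRD; last by rewrite gt_eqF// implybT.
  rewrite powR_mulrn ?(ltW h0)//.
  have hs0 : 0 < h `^ s by exact: powR_gt0.
  move: (h ^+ n) (h `^ s) C1 hn0 hs0 => a b c a0 b0.
  by field; rewrite !gt_eqF.
rewrite mulrDl mul1r (@le_trans _ _ (C1 * k)) ?lerDr//.
have r30 : 0 < r / 3 by rewrite divr_gt0.
rewrite ler_wpM2l// lef_pV2 ?posrE ?powR_gt0//.
by rewrite ge0_ler_powR ?nnegrE ?divr_ge0 ?(ltW p0) ?(ltW r0) ?(ltW h0)//; lra.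
Qed.

Lemma cell_average_near z (eps : R) : ~ same z ->
  (forall w, `|pt w.1 - pt z.1| < h -> `|pt w.2 - pt z.2| < h -> `|W w - W z| <= eps) ->
  ((W z - eps)%:E <= cell_average mu pt h W z <= (W z + eps)%:E)%E.
Proof.
case: z => x y sxy /= H.
have hn0 : 0 < h ^+ n by rewrite exprn_gt0.
have k0 : 0 <= (h ^+ n * h ^+ n)^-1 by rewrite invr_ge0 mulr_ge0 ?(ltW hn0).
have xQ : Q x x by apply/(cell_grid _ h0).
have yQ : Q y y by apply/(cell_grid _ h0).
have HQ w : (Q x `*` Q y) w -> \1_(~` same) w * W w = W w /\ `|W w - W (x, y)| <= eps.
  case: w => v w [/= vQ wQ]; split.
    rewrite indicE mem_set ?mul1r//= => svw; apply: sxy.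
    by move: vQ wQ svw; rewrite /same_cell/= => /(cell_grid _ h0) -> /(cell_grid _ h0) ->.
  by apply: H => /=; [exact: cell_near vQ xQ|exact: cell_near wQ yQ].
have e0 : 0 <= eps by have [_ /(le_trans _)->] := HQ (x, y) (conj xQ yQ).
apply/andP; split.
  (* If [W (x, y) <= eps] the lower bound is nonpositive; otherwise the constant is positive and the
     comparison of nonnegative integrals applies. *)
  have [We|We] := leP (W (x, y)) eps.
    by apply: (@le_trans _ _ 0%E); [rewrite lee_fin subr_le0|exact: cell_average_ge0].
  rewrite -(QQE x y); apply: lee_wpmul2l; first by rewrite lee_fin.
  apply: ge0_le_integral; first exact: mQQ.
  - by move=> w _; rewrite lee_fin subr_ge0 ltW.
  - exact: measurable_cst.
  - by apply/measurable_EFinP; exact: measurable_funS mV.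
  by move=> w /HQ[-> /ler_normlP[]]; rewrite lee_fin; lra.
rewrite -(QQE x y); apply: lee_wpmul2l; first by rewrite lee_fin.
apply: ge0_le_integral; first exact: mQQ.
- by move=> w _; rewrite lee_fin mulr_ge0.
- by apply/measurable_EFinP; exact: measurable_funS mV.
- exact: measurable_cst.
by move=> w /HQ[-> /ler_normlP[]]; rewrite lee_fin; lra.
Qed.

End one_scale.
End cell_average_limit.

Lemma cvge_dist_le (R : realType) (u : (\bar R)^nat) (a : R) :
  (forall e : R, 0 < e -> \forall k \near \oo, ((a - e)%:E <= u k <= (a + e)%:E)%E) ->
  u @ \oo --> a%:E.
Proof.
move=> H; apply/fine_cvgP; split.
  near=> k; have /andP[uk1 uk2] : ((a - 1)%:E <= u k <= (a + 1)%:E)%E by near: k; exact: H.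
  by rewrite fin_real// (lt_le_trans (ltNyr _) uk1) (le_lt_trans uk2 (ltry _)).
apply/cvgrPdist_le => e e0; near=> k.
have : ((a - e)%:E <= u k <= (a + e)%:E)%E by near: k; exact: H.
rewrite /= => /andP[]; case: (u k) => [r| |]; rewrite ?leye_eq ?leeNy_eq// !lee_fin /= => r1 r2.
by apply/ler_normlP; split; move: r1 r2; lra.
Unshelve. all: by end_near.
Qed.

Lemma near_invn_le (R : realType) (e : R) : 0 < e -> \forall k \near \oo, k.+1%:R^-1 <= e.
Proof.
move=> e0; near=> k.
have : e^-1 <= k%:R by near: k; exact: nbhs_infty_ger.
move=> ek; rewrite -(invrK e) lef_pV2 ?posrE ?invr_gt0// (le_trans ek)// ler_nat.
exact: leqnSn.
Unshelve. all: by end_near.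
Qed.

Section step_approximation.
Context (R : realType) (n : nat) d (T : measurableType d)
  (mu : {sigma_finite_measure set T -> \bar R}) (pt : T -> 'rV[R]_n).
Hypothesis mod : lebesgue_model mu pt.
Hypothesis n0 : (0 < n)%N.
Variable s : R.
Hypothesis s01 : 0 < s < 1.
Local Notation p := (n%:R + s).
Local Notation K := (fkernel pt s).

Section defect.
Variable h : R.
Hypothesis h0 : 0 < h.
Local Notation same := (same_cell pt h).
Local Notation Q x := (cell pt (grid h (grid_index h (pt x))) h).

(** Every [x] in [B] sees at least [eta h^n] of the complement of [A] in its own cell, where the
    kernel is at least [(n h)^-p]. Since p = n + s, a set of finite energy satisfies this only with
    a measure O(h^s) for [B]. *)
Lemma mean_defect (A B : set T) (eta : R) : measurable A -> measurable B -> B `<=` A ->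
  0 <= eta -> (forall x, B x -> eta <= 1 - cell_mean mu pt h A x) ->
  ((eta * h ^+ n)%:E * mu B <= ((n%:R * h) `^ p)%:E * energy mu K A)%E.
Proof.
move=> mA mB BA e0 eB.
have hn0 : 0 < h ^+ n by rewrite exprn_gt0.
have c0 : 0 < (n%:R * h) `^ p by rewrite powR_gt0// mulr_gt0// ltr0n.
have mAA : measurable (A `*` ~` A) by apply: measurableX => //; exact: measurableC.
have mS := measurable_same_cell mod h0.
have mK := measurable_fkernel mod s.
pose S := A `*` ~` A `&` same.
have mSS : measurable S by exact: measurableI.
apply: (@le_trans _ _ ((mu \x mu)%E S)); last first.
  rewrite -ge0_integralZl//; last 3 first.
  - by apply/measurable_EFinP; exact: measurable_funS mK.
  - by move=> z _; rewrite lee_fin fkernel_ge0.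
  - by rewrite lee_fin ltW.
  rewrite -[X in ((mu \x mu) X)%E]setIT -integral_indic// [leRHS]integral_mkcond.
  apply: ge0_le_integral => //.
  - by apply/measurable_EFinP; exact: measurable_indic.
  - apply/(measurable_restrictT _ _).1 => //; apply: measurable_funeM.
    by apply/measurable_EFinP; exact: measurable_funS mK.
  move=> -[x y] _; rewrite patchE indicE; case: (boolP ((x, y) \in A `*` ~` A)) => xyA.
    case: (boolP (_ \in S)) => [|_]; last by rewrite mule_ge0// lee_fin ?fkernel_ge0// ltW.
    rewrite inE => -[[/= Ax nAy] sxy]; rewrite -EFinM lee_fin mulrC -ler_pdivrMr// mul1r.
    apply: (fkernel_ge mod) => //; first by apply/eqP => xy; apply: nAy; rewrite -xy.
    by apply: ltW; apply: (cell_near h0); apply/(cell_grid _ h0); [exact: sxy|].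
  rewrite memNset// => -[H _]; move/negP: xyA; apply; by rewrite inE.
rewrite /product_measure1 -integral_cst// integral_mkcond.
apply: ge0_le_integral => //.
- by move=> x _; apply: erestrict_ge0 => y _; rewrite lee_fin mulr_ge0// ltW.
- by apply/(measurable_restrictT _ _).1.
- exact: measurable_fun_xsection.
move=> x _; rewrite patchE; case: ifPn => [|_ /=]; last exact: measure_ge0.
rewrite inE => Bx /=.
rewrite (_ : xsection S x = ~` A `&` Q x); last first.
  rewrite -(xsection_same_cell pt h0); apply/seteqP; split=> y; rewrite /xsection/= !inE.
    by move=> [[]].
  by move=> [nAy sxy]; split=> //; split=> //=; exact: BA.
by rewrite -(cell_meanC mod h0 mA) lee_fin ler_wpM2r ?(ltW hn0)// eB.
Qed.

Lemma cell_mean_setC (A : set T) x : measurable A ->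
  cell_mean mu pt h (~` A) x = 1 - cell_mean mu pt h A x.
Proof.
move=> mA; have hn0 : h ^+ n != 0 by rewrite gt_eqF// exprn_gt0.
apply: (mulIf hn0); apply: EFin_inj.
by rewrite (cell_meanE mod h0 (measurableC mA)) (cell_meanC mod h0 mA).
Qed.

End defect.

Variable W : T * T -> R.
Hypothesis mW : measurable_fun setT W.
Hypothesis W0 : forall z, 0 <= W z.
Hypothesis WK : forall z, W z <= K z.
Variable N : set T.
Hypothesis mN : measurable N.
Hypothesis N0 : mu N = 0%E.
Hypothesis Wcont : forall z, ~ N z.1 -> ~ N z.2 -> z.1 != z.2 -> forall e : R, 0 < e ->
  exists2 del : R, 0 < del & forall w, `|pt w.1 - pt z.1| < del -> `|pt w.2 - pt z.2| < del ->
    `|W w - W z| <= e.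

(** Dominated convergence: the averages converge at every off-diagonal pair avoiding [N], and the
    multiple of [K] that dominates them is integrable exactly because the K-energy is finite. *)
Lemma cell_average_cvg (A : set T) : measurable A -> (energy mu K A < +oo)%E ->
  (\int[mu \x mu]_(z in A `*` ~` A) cell_average mu pt k.+1%:R^-1 W z)%E @[k --> \oo] -->
    energy mu W A.
Proof.
move=> mA Afin.
have h0 k : 0 < k.+1%:R^-1 :> R by rewrite invr_gt0.
have mAA : measurable (A `*` ~` A) by apply: measurableX => //; exact: measurableC.
have mK := measurable_fkernel mod s.
have AAneq z : (A `*` ~` A) z -> z.1 != z.2 by move=> [Az nAz]; apply/eqP => E; apply: nAz; rewrite -E.
have c0 := average_cst_ge0 n s01.
have [] := @dominated_convergence _ _ _ (mu \x mu)%E _ mAA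
  (fun k => cell_average mu pt k.+1%:R^-1 W) (fun z => (W z)%:E)
  (fun z => (average_cst n s * K z)%:E) => //.
- by move=> k; apply: measurable_funS (measurable_cell_average mod (h0 k) mW W0).
- by apply/measurable_EFinP; exact: measurable_funS mW.
- exists (N `*` setT `|` setT `*` N); split.
  + by apply: measurableU; exact: measurableX.
  + apply/eqP; rewrite eq_le measure_ge0 andbT.
    have m1 : measurable (N `*` [set: T]) by exact: measurableX.
    have m2 : measurable ([set: T] `*` N) by exact: measurableX.
    apply: (le_trans (measureU2 (mu \x mu)%E m1 m2)).
    have E1 : ((mu \x mu) (N `*` [set: T]) = 0)%E.
      by rewrite (product_measure1E mu mu mN measurableT) [X in (X * _)%E]N0 mul0e.
    have E2 : ((mu \x mu) ([set: T] `*` N) = 0)%E.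
      by rewrite (product_measure1E mu mu measurableT mN) [X in (_ * X)%E]N0 mule0.
    by rewrite [X in (X + _ <= _)%E]E1 [X in (_ + X <= _)%E]E2 adde0.
  move=> z /= /not_implyP[zA nC]; apply: contrapT => /not_orP[nN1 nN2]; apply: nC.
  have zn := AAneq _ zA.
  have nz1 : ~ N z.1 by move=> ?; apply: nN1.
  have nz2 : ~ N z.2 by move=> ?; apply: nN2.
  apply: cvge_dist_le => e e0; have [del del0 Hdel] := Wcont nz1 nz2 zn e0.
  have r0 : 0 < `|pt z.1 - pt z.2|.
    by rewrite normr_gt0 subr_eq0; apply: contra_neq zn; exact: (model_inj mod).
  near=> k.
  have kdel : k.+1%:R^-1 <= del by near: k; exact: near_invn_le.
  have kr : k.+1%:R^-1 <= `|pt z.1 - pt z.2| by near: k; exact: near_invn_le.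
  apply: (cell_average_near mod mW W0 (h0 k)) => [sz|w w1 w2]; last first.
    by apply: Hdel; [exact: lt_le_trans w1 kdel|exact: lt_le_trans w2 kdel].
  have := cell_near (h0 k) (iffRL (cell_grid _ (h0 k) _ _) sz) (iffRL (cell_grid _ (h0 k) _ _) erefl).
  by rewrite ltNge kr.
- apply/integrableP; split.
    by apply/measurable_EFinP; apply: measurable_funM => //; exact: measurable_funS mK.
  rewrite (_ : (\int[mu \x mu]_(z in A `*` ~` A) `|(average_cst n s * K z)%:E|)%E =
    (\int[mu \x mu]_(z in A `*` ~` A) ((average_cst n s)%:E * (K z)%:E))%E); last first.
    by apply: eq_integral => z _; rewrite gee0_abs ?EFinM// mule_ge0// lee_fin// fkernel_ge0.
  rewrite ge0_integralZl//; last 2 first.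
  - by apply/measurable_EFinP; exact: measurable_funS mK.
  - by move=> z _; rewrite lee_fin fkernel_ge0.
  by rewrite lte_mul_pinfty ?lee_fin.
- apply: aeW => z k zA; rewrite gee0_abs; last exact: cell_average_ge0.
  exact: (cell_average_le mod n0 s01 mW W0 WK (h0 k) (AAneq _ zA)).
Unshelve. all: by end_near.
Qed.

Lemma grid_index_bounded (A : set T) (h M : R) : 0 < h -> (forall x, A x -> `|pt x| <= M) ->
  exists idx : seq 'rV[int]_n, forall x, A x -> grid_index h (pt x) \in idx.
Proof.
move=> h0 AM; pose L := Num.bound (M / h + 1).
exists [seq \row_i ((f i : nat)%:Z - L%:Z) | f : {ffun 'I_n -> 'I_(2 * L).+1}] => x /AM xM.
have mL i : 0 <= grid_index h (pt x) 0 i + L%:Z <= (2 * L)%:Z.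
  have := le_trans (le_coord_norm (pt x) i) xM; rewrite ler_norml => /andP[x1 x2].
  rewrite mxE; set y := pt x 0 i / h.
  have y1 : - (M / h) <= y by rewrite -mulNr ler_pM2r ?invr_gt0.
  have y2 : y <= M / h by rewrite ler_pM2r ?invr_gt0.
  have M0 : 0 <= M / h by rewrite divr_ge0 ?(ltW h0)// (le_trans _ xM).
  have LM : M / h + 1 < L%:R.
    by apply: archi_boundP; rewrite addr_ge0.
  have f1 := floor_le y; have f2 := floorD1_gt y.
  rewrite -!(ler_int R) !rmorphD/= mulr0z.
  have -> : (2 * L)%N%:~R = 2 * L%:R :> R by rewrite -natrM.
  have -> : L%:~R = L%:R :> R by [].
  move: f2; rewrite rmorphD/= => f2; apply/andP; split; lra.
pose f := [ffun i => inord `|(grid_index h (pt x) 0 i + L%:Z)%R|%N : 'I_(2 * L).+1].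
apply/mapP; exists f; rewrite ?mem_enum//; apply/rowP => i; rewrite [RHS]mxE ffunE inordK.
  by have /andP[m0 _] := mL i; rewrite gez0_abs// addrK.
by have /andP[m0 m1] := mL i; rewrite ltnS -lez_nat gez0_abs.
Qed.

Lemma step_approximation (A : set T) (M e : R) : measurable A ->
  (forall x, A x -> `|pt x| <= M) -> (energy mu K A < +oo)%E -> 0 < e ->
  exists2 h, 0 < h & exists idx : seq 'rV[int]_n,
    let D := [set x | grid_index h (pt x) \in idx] in
    [/\ measurable D, (energy mu W D <= energy mu W A + e%:E)%E,
       (mu (A `\` D) <= e%:E)%E & (mu (D `\` A) <= e%:E)%E].
Proof.
move=> mA AM Afin e0.
have /andP[s0 s1] := s01.
have mAC := measurableC mA.
have mK := measurable_fkernel mod s.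
have mAA : measurable (A `*` ~` A) by exact: measurableX.
have WAK : (energy mu W A <= energy mu K A)%E.
  apply: ge0_le_integral => //.
  - by move=> z _; rewrite lee_fin.
  - by apply/measurable_EFinP; exact: measurable_funS mW.
  - by apply/measurable_EFinP; exact: measurable_funS mK.
  - by move=> z _; rewrite lee_fin.
have := le_lt_trans WAK Afin; have := energy_ge0 mu W0 A.
have := Afin; have := energy_ge0 mu (fkernel_ge0 pt s) A.
case EKE : (energy mu K A) => [EK| |]//; rewrite lee_fin => EK0 _.
case EWE : (energy mu W A) => [I| |]//; rewrite lee_fin => I0 _.
have Ie0 : 0 < I + e by rewrite ltr_wpDl.
(* Then (I + e)(1 - 2 eta) = I + 3e/4 lies strictly above the limit [I] of the averaged energies. *)
pose eta := e / (8 * (I + e)).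
have eta0 : 0 < eta by rewrite divr_gt0// mulr_gt0.
have etaE : eta * (8 * (I + e)) = e by rewrite divfK// gt_eqF// mulr_gt0.
have eta1 : eta <= 1 / 8 by rewrite ler_pdivrMr ?mulr_gt0//; lra.
have np0 : 0 < n%:R `^ p :> R by rewrite powR_gt0// ltr0n.
(* [h^s <= c] makes the bound of [mean_defect] at most [e]; the 1 added to [EK] keeps the
   denominator positive. *)
pose c := e * eta / (n%:R `^ p * (EK + 1)).
have EK1 : 0 < EK + 1 by rewrite ltr_wpDl.
have c0 : 0 < c := divr_gt0 (mulr_gt0 e0 eta0) (mulr_gt0 np0 EK1).
have Hlt : (I%:E < ((I + e) * (1 - eta - eta))%:E)%E.
  by rewrite lte_fin; move: etaE; rewrite -[X in _ < X]/((I + e) * (1 - eta - eta)); lra.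
have cvg := cell_average_cvg mA Afin; rewrite EWE in cvg.
have cvg_lt : \forall k \near \oo, (\int[mu \x mu]_(z in A `*` ~` A)
    cell_average mu pt k.+1%:R^-1 W z < ((I + e) * (1 - eta - eta))%:E)%E.
  exact: (cvg _ (open_ereal_lt' Hlt)).
near \oo => k.
have hc : k.+1%:R^-1 <= c `^ s^-1 by near: k; apply: near_invn_le; exact: powR_gt0.
have avg : (\int[mu \x mu]_(z in A `*` ~` A) cell_average mu pt k.+1%:R^-1 W z <
    ((I + e) * (1 - eta - eta))%:E)%E.
  by near: k.
set h : R := k.+1%:R^-1 in hc avg.
have h0 : 0 < h by rewrite invr_gt0.
have hn0 : 0 < h ^+ n by exact: exprn_gt0.
have eta12 : 0 < eta < 1 / 2 by lra.
have [t [/andP[t0 t1] Ht]] := energy_superlevel mod h0 mA mW W0 eta12 avg.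
exists h => //.
have mu_ := measurable_cell_mean mod h0 mA.
have mD : measurable [set x | t < cell_mean mu pt h A x].
  by apply: measurable_ltr_set => //; exact: measurable_cst.
have hs : (n%:R * h) `^ p * EK <= eta * h ^+ n * e.
  have -> : (n%:R * h) `^ p = n%:R `^ p * h `^ s * h ^+ n.
    rewrite powRM ?(ltW h0)// [h `^ p]powRD; last by rewrite (gt_eqF h0) implybT.
    by rewrite powR_mulrn ?(ltW h0)//; ring.
  have hs : h `^ s <= c.
    rewrite (_ : c = (c `^ s^-1) `^ s); last by rewrite -powRrM mulVf ?gt_eqF// powRr1 ?(ltW c0).
    by rewrite ge0_ler_powR ?nnegrE ?powR_ge0 ?(ltW s0) ?(ltW h0).
  have : n%:R `^ p * h `^ s * EK <= e * eta.
    apply: (@le_trans _ _ (n%:R `^ p * c * (EK + 1))).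
      by rewrite ler_pM ?mulr_ge0 ?powR_ge0// ?ler_pM2l// lerDl.
    rewrite /c le_eqVlt; apply/orP; left; apply/eqP; field.
    by rewrite !gt_eqF.
  move: (h ^+ n) hn0 (n%:R `^ p * h `^ s) => a a0 b; rewrite mulrAC => H.
  by rewrite [X in _ <= X](_ : _ = e * eta * a) ?ler_pM2r//; ring.
(* Used for [A] and for its complement, whose density is [1 - u] and whose energy is the same by
   symmetry: this gives both halves of the symmetric difference. *)
have small (B C : set T) : measurable B -> measurable C -> C `<=` B ->
    (forall x, C x -> eta <= 1 - cell_mean mu pt h B x) -> energy mu K B = EK%:E ->
    (mu C <= e%:E)%E.
  move=> mB mC CB HC EB.
  have := mean_defect h0 mB mC CB (ltW eta0) HC; rewrite EB -EFinM => /le_trans.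
  move=> /(_ (eta * h ^+ n * e)%:E); rewrite lee_fin => /(_ hs).
  by rewrite [in X in (_ <= X)%E -> _]EFinM lee_pmul2l// ?fin_numE// lte_fin mulr_gt0.
have [idx Hidx] := grid_index_bounded h0 AM.
(* A cell on which the density exceeds [t > 0] meets [A], so its index is already in the finite list
   obtained from boundedness. *)
pose idx' := [seq m <- idx | `[< exists x, t < cell_mean mu pt h A x /\ grid_index h (pt x) = m >]].
exists idx'.
rewrite (_ : mkset _ = [set x | t < cell_mean mu pt h A x]); last first.
  apply/seteqP; split=> x /=; rewrite mem_filter.
    move=> /andP[/asboolP[y [ty yx]] _]; rewrite (_ : cell_mean _ _ _ _ _ = cell_mean mu pt h A y)//.
    exact/same_cell_mean/esym.
  move=> tx; apply/andP; split; first by apply/asboolP; exists x.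
  have : mu (A `&` cell pt (grid h (grid_index h (pt x))) h) != 0%E.
    rewrite -(cell_meanE mod h0 mA) eqe gt_eqF// mulr_gt0//; exact: lt_trans (lt_trans eta0 t0) tx.
  move=> /eqP nz; have /set0P[y [Ay yQ]] : A `&` cell pt (grid h (grid_index h (pt x))) h != set0.
    by apply/eqP => E; apply: nz; rewrite E measure0.
  by move/(cell_grid _ h0) : yQ => <-; exact: Hidx.
split=> //.
- apply: (small A) => //; first exact: measurableD.
  by move=> x [_ /negP]; rewrite -leNgt => H; lra.
- apply: (small (~` A)) => //; first exact: measurableD.
  + by move=> x [/= tx _]; rewrite (cell_mean_setC h0)//; lra.
  exact: etrans (energyC mu (measurable_fkernel mod s) (fkernel_ge0 pt s) (fun x y => fkernelC pt s x y) mA) EKE.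
Unshelve. all: by end_near.
Qed.

End step_approximation.

(** * Finite unions of rounded cubes *)

Lemma le_integral_bigsetU d (S : measurableType d) (R : realType) (m : {measure set S -> \bar R})
    (I : Type) (r : seq I) (F : I -> set S) (f : S -> \bar R) :
  (forall i, measurable (F i)) -> measurable_fun setT f -> (forall x, 0 <= f x)%E ->
  (\int[m]_(x in \big[setU/set0]_(i <- r) F i) f x <= \sum_(i <- r) \int[m]_(x in F i) f x)%E.
Proof.
move=> mF mf f0; elim: r => [|i r IH]; first by rewrite !big_nil integral_set0.
rewrite !big_cons; apply: (le_trans (le_integral_setU m (mF i) _ mf f0)).
  exact: bigsetU_measurable.
exact: leeD2l.
Qed.

Section rounded_cells.
Context (R : realType) (n : nat) d (T : measurableType d)
  (mu : {sigma_finite_measure set T -> \bar R}) (pt : T -> 'rV[R]_n).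
Hypothesis mod : lebesgue_model mu pt.
Hypothesis n0 : (0 < n)%N.
Variable s : R.
Hypothesis s01 : 0 < s < 1.
Local Notation K := (fkernel pt s).
Variable W : T * T -> R.
Hypothesis mW : measurable_fun setT W.
Hypothesis W0 : forall z, 0 <= W z.
Hypothesis WK : forall z, W z <= K z.

(** No intersection with the cells is needed: for levels below 3/4, [bulge_margin] confines each
    sublevel set to its own cell. *)
Definition rounded_cells (N : nat) (h : R) (t : 'rV[int]_n -> R) (idx : seq 'rV[int]_n) :
    set 'rV[R]_n :=
  [set x | exists2 m, m \in idx & bulge N (grid h m) h x < t m].

(** A pair leaving [U] either leaves [D], or ends in one of the removed pieces [C m], to which its
    first point does not belong. The latter pairs cost the energy of the complement of [C m], which
    equals that of [C m] for the symmetric kernel. *)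
Lemma rounded_cells_energy (h e : R) (idx : seq 'rV[int]_n) : 0 < h -> 0 < e ->
  exists N t, [/\ (0 < N)%N, forall m, 1 / 2 < t m < 3 / 4 &
    let D := [set x | grid_index h (pt x) \in idx] in
    let U := pt @^-1` rounded_cells N h t idx in
    [/\ measurable U, (energy mu W U <= energy mu W D + e%:E)%E, U `<=` D &
      (mu (D `\` U) <= e%:E)%E]].
Proof.
move=> h0 e0.
(* The tolerance is shared among the cells; the successor covers the empty list. *)
pose k : R := (size idx).+1%:R.
have k0 : 0 < k by rewrite ltr0n.
have ek0 : 0 < e / k by rewrite divr_gt0.
have [N N0 HN] := rounded_cell mod n0 s01 h0 ek0.
have /boolp.choice[t Ht] (m : 'rV[int]_n) : exists t, 1 / 2 < t < 3 / 4 /\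
    let D := cell pt (grid h m) h `\` [set x | bulge N (grid h m) h (pt x) < t] in
    (energy mu K D <= (e / k)%:E)%E /\ (mu D <= (e / k)%:E)%E.
  by have [x x1 x2] := HN (grid h m); exists x.
exists N, t; split=> //; first by move=> m; have [] := Ht m.
pose B m := [set x | bulge N (grid h m) h (pt x) < t m].
pose C m := cell pt (grid h m) h `\` B m.
have mB m : measurable (B m).
  by apply: measurable_ltr_set; [exact: (measurable_bulge mod)|exact: measurable_cst].
have mC m : measurable (C m) by apply: measurableD => //; exact: (measurable_cell mod).
have BQ m x : B m x -> grid_index h (pt x) = m.
  move=> /= bt; apply/(cell_grid _ h0) => i.
  have [/andP[_ t3] _] := Ht m.
  have /andP[x1 x2] := bulge_margin h0 N0 (ltW (lt_trans bt t3)) i.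
  have m0 : 0 < h / (16 * N)%:R by rewrite divr_gt0// ltr0n muln_gt0.
  by move: x1 x2; lra.
have UE : pt @^-1` rounded_cells N h t idx = \big[setU/set0]_(m <- idx) B m.
  by apply/seteqP; split=> x; rewrite -bigcup_seq => -[m]; exists m.
have mQ m : measurable (cell pt (grid h m) h) by exact: (measurable_cell mod).
have DE : [set x | grid_index h (pt x) \in idx] = \big[setU/set0]_(m <- idx) cell pt (grid h m) h.
  apply/seteqP; split=> x /=; rewrite -bigcup_seq.
    by move=> xi; exists (grid_index h (pt x)) => //; apply/(cell_grid _ h0).
  by move=> [m mi /(cell_grid _ h0) ->].
have mU : measurable (pt @^-1` rounded_cells N h t idx) by rewrite UE; exact: bigsetU_measurable.
have mD : measurable [set x | grid_index h (pt x) \in idx].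
  by rewrite DE; exact: bigsetU_measurable.
have sum_le (F : 'rV[int]_n -> \bar R) : (forall m, F m <= (e / k)%:E)%E ->
    (\sum_(m <- idx) F m <= e%:E)%E.
  move=> HF; apply: (@le_trans _ _ (\sum_(m <- idx) (e / k)%:E)%E); first exact: lee_sum.
  rewrite sumEFin big_const_seq count_predT iter_addr_0 lee_fin -mulr_natr -mulrA.
  rewrite -[X in _ <= X]mulr1 ler_wpM2l ?(ltW e0)// mulrC ler_pdivrMr// mul1r ler_nat.
  exact: leqnSn.
have UC m x : (pt @^-1` rounded_cells N h t idx) x -> ~ C m x.
  move=> [m' _ bt] [xQ nB]; apply: nB.
  by move/(cell_grid _ h0) : xQ => <-; rewrite (BQ m').
have DU : [set x | grid_index h (pt x) \in idx] `\` pt @^-1` rounded_cells N h t idx `<=`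
    \big[setU/set0]_(m <- idx) C m.
  move=> x [/= xi xU]; rewrite -bigcup_seq; exists (grid_index h (pt x)) => //; split.
    by apply/(cell_grid _ h0).
  by move=> bt; apply: xU; exists (grid_index h (pt x)).
split=> //.
- apply: (@le_trans _ _ (\int[mu \x mu]_(z in ([set x | grid_index h (pt x) \in idx] `*`
      ~` [set x | grid_index h (pt x) \in idx]) `|`
      \big[setU/set0]_(m <- idx) (~` C m `*` ~` ~` C m)) (W z)%:E)%E).
    apply: ge0_subset_integral.
    + by apply: measurableX => //; exact: measurableC.
    + apply: measurableU; first by apply: measurableX => //; exact: measurableC.
      apply: bigsetU_measurable => m _; apply: measurableX; first exact: measurableC.
      by rewrite setCK.
    + by apply/measurable_EFinP; exact: measurable_funS mW.
    + by move=> z _; rewrite lee_fin.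
    move=> [x y] [/= xU yU].
    have xD : grid_index h (pt x) \in idx by case: xU => m mi /BQ ->.
    have [yD|yD] := boolP (grid_index h (pt y) \in idx); last by left; split=> //; exact/negP.
    have := DU y (conj yD yU); rewrite -!bigcup_seq => -[m mi Cy]; right; exists m => //.
    by split; [exact: UC|exact].
  have mCC m : measurable (~` C m `*` ~` ~` C m).
    by apply: measurableX; [exact: measurableC|rewrite setCK].
  have mWE : measurable_fun setT (fun z => (W z)%:E) by exact/measurable_EFinP.
  have WE0 z : (0 <= (W z)%:E)%E by rewrite lee_fin.
  apply: le_trans (le_integral_setU _ _ _ mWE WE0) _.
  + by apply: measurableX => //; exact: measurableC.
  + exact: bigsetU_measurable.
  apply: leeD => //.
  apply: (le_trans (le_integral_bigsetU _ _ mCC mWE WE0)); apply: sum_le => m.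
  have [_ [HE _]] := Ht m; apply: le_trans HE.
  rewrite -(energyC mu (measurable_fkernel mod s) (fkernel_ge0 pt s) (fun x y => fkernelC pt s x y) (mC m)).
  apply: ge0_le_integral; first exact: mCC.
  + by move=> z _; rewrite lee_fin.
  + exact: measurable_funS mWE.
  + by apply/measurable_EFinP; exact: measurable_funS (measurable_fkernel mod s).
  + by move=> z _; rewrite lee_fin.
- by move=> x [m mi /BQ /= ->].
- apply: (@le_trans _ _ (mu (\big[setU/set0]_(m <- idx) C m))).
    apply: le_measure => //; rewrite inE; first exact: measurableD.
    exact: bigsetU_measurable.
  apply: (le_trans (measure_bigsetU_le _ _ mC)); apply: sum_le => m.
  by have [_ [_]] := Ht m.
Qed.

End rounded_cells.

(** * Smooth functions *)

(** Reduces directional derivatives to derivatives of one variable, so that the one-variable chain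
    rule can be used. *)
Lemma is_derive_line (R : realType) (V : normedModType R) (f : V -> R) (x v : V) (a : R) :
  is_derive x v f a <-> is_derive (0 : R) 1 (fun h : R => f (h *: v + x)) a.
Proof.
have E : 'D_1 (fun h : R => f (h *: v + x)) 0 = 'D_v f x.
  rewrite /derive; apply: (congr1 (fun F : R -> R^o => lim (F h @[h --> 0^']))); apply/funext => h /=.
  by rewrite scale0r add0r addr0 [h *: 1]mulr1.
split=> -[d dE]; split; [exact: (derivable1P _ _ _).1 d|by rewrite E| |by rewrite -E].
exact: (derivable1P _ _ _).2 d.
Qed.

Lemma is_derive_comp (R : realType) (V : normedModType R) (f : V -> R) (g : R -> R)
    (x v : V) (a b : R) :
  is_derive x v f a -> is_derive (f x) 1 g b -> is_derive x v (g \o f) (b * a).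
Proof.
move=> /is_derive_line df dg; apply/is_derive_line.
apply: (@is_derive1_comp _ g (fun h : R => f (h *: v + x))).
by rewrite scale0r add0r.
Qed.

Section Dk.
Variable R : realType.

(** One-variable regularity on [P] only, since real powers are regular on the positive half-line
    alone. The derivative is a witness rather than ['D_], so nothing is asked of it outside [P]. *)
Fixpoint Dk (P : set R) k (g : R -> R) : Prop :=
  (forall x, P x -> {for x, continuous g}) /\
  if k is k'.+1 then
    exists2 dg, Dk P k' dg & forall x, P x -> is_derive x 1 g (dg x)
  else True.

Lemma Dk_continuous P k g x : Dk P k g -> P x -> {for x, continuous g}.
Proof. by case: k => [|k] [cg _]; exact: cg. Qed.

End Dk.

Section Ck_closure.
Variables (R : realType) (m : nat).
Implicit Types f g : 'rV[R]_m -> R.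

Lemma Ck_continuous k f x : Ck k f -> {for x, continuous f}.
Proof. by case: k => [|k] [cf _]; exact: cf. Qed.

Lemma CkS k f : Ck k.+1 f -> Ck k f.
Proof.
elim: k f => [|k IH] f [cf df]; split=> // i; have [d Cd] := df i; split=> //.
exact: IH.
Qed.

Lemma CkS_intro k f (df : 'I_m -> 'rV[R]_m -> R) :
  continuous f -> (forall i x, is_derive x (delta_mx 0 i) f (df i x)) ->
  (forall i, Ck k (df i)) -> Ck k.+1 f.
Proof.
move=> cf Df Cdf; split=> // i; split; first by move=> x; have [] := Df i x.
rewrite (_ : (fun x => 'D_(delta_mx 0 i) f x) = df i)//.
by apply/funext => x; have [] := Df i x.
Qed.

Lemma CkS_elim k f : Ck k.+1 f -> forall i x, is_derive x (delta_mx 0 i) f ('D_(delta_mx 0 i) f x).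
Proof. by move=> [_ df] i x; apply: derivableP; have [] := df i. Qed.

Lemma Ck_cst k (a : R) : Ck k (cst a : 'rV[R]_m -> R).
Proof.
elim: k a => [|k IH] a; first by split=> //; exact: cst_continuous.
apply: (@CkS_intro _ _ (fun _ => cst 0)) => //; first exact: cst_continuous.
Qed.

Lemma Ck_add k f g : Ck k f -> Ck k g -> Ck k (fun x => f x + g x).
Proof.
elim: k f g => [|k IH] f g Cf Cg.
  by split=> // x; exact: (continuousD (Ck_continuous Cf) (Ck_continuous Cg)).
have c x : {for x, continuous (fun x => f x + g x)}.
  exact: (continuousD (Ck_continuous Cf) (Ck_continuous Cg)).
have [_ df] := Cf; have [_ dg] := Cg.
apply: (@CkS_intro _ _ (fun i x => 'D_(delta_mx 0 i) f x + 'D_(delta_mx 0 i) g x)) => //.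
  by move=> i x; exact: (is_deriveD (CkS_elim Cf i x) (CkS_elim Cg i x)).
by move=> i; apply: IH; [have [] := df i|have [] := dg i].
Qed.

Lemma Ck_mul k f g : Ck k f -> Ck k g -> Ck k (fun x => f x * g x).
Proof.
elim: k f g => [|k IH] f g Cf Cg.
  by split=> // x; exact: (continuousM (Ck_continuous Cf) (Ck_continuous Cg)).
have c x : {for x, continuous (fun x => f x * g x)}.
  exact: (continuousM (Ck_continuous Cf) (Ck_continuous Cg)).
have [_ df] := Cf; have [_ dg] := Cg.
apply: (@CkS_intro _ _ (fun i x => f x * 'D_(delta_mx 0 i) g x + g x * 'D_(delta_mx 0 i) f x)) => //.
  by move=> i x; exact: (is_deriveM (CkS_elim Cf i x) (CkS_elim Cg i x)).
move=> i; have [_ Cdf] := df i; have [_ Cdg] := dg i.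
by apply: Ck_add; apply: IH => //; exact: CkS.
Qed.

Lemma Ck_coord k j : Ck k (fun x : 'rV[R]_m => x 0 j).
Proof.
case: k => [|k]; first by split=> // x; exact: coord_continuous.
apply: (@CkS_intro _ _ (fun i => cst ((j == i)%:R))) => [x|i x|i]; last exact: Ck_cst.
  exact: coord_continuous.
apply/is_derive_line.
rewrite (_ : (fun h : R => _) = (fun h => (j == i)%:R *: h + x 0 j)).
  by apply: is_derive_eq; rewrite addr0 [_ *: _]mulr1.
by apply/funext => h; rewrite !mxE eqxx /= mulrC.
Qed.

Lemma Ck_exp k f N : Ck k f -> Ck k (fun x => f x ^+ N).
Proof.
move=> Cf; elim: N => [|N IH].
  by rewrite (_ : (fun x => _) = cst 1); [exact: Ck_cst|apply/funext => x; rewrite expr0].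
rewrite (_ : (fun x => _) = fun x => f x * f x ^+ N); first exact: Ck_mul.
by apply/funext => x; rewrite exprS.
Qed.

Lemma Ck_sum k (I : Type) (r : seq I) (F : I -> 'rV[R]_m -> R) :
  (forall i, Ck k (F i)) -> Ck k (fun x => \sum_(i <- r) F i x).
Proof.
move=> CF; elim: r => [|i r IH].
  by rewrite (_ : (fun x => _) = cst 0); [exact: Ck_cst|apply/funext => x; rewrite big_nil].
rewrite (_ : (fun x => _) = fun x => F i x + \sum_(i <- r) F i x); first exact: Ck_add.
by apply/funext => x; rewrite big_cons.
Qed.

Lemma Ck_comp P k f (g : R -> R) : Dk P k g -> (forall x, P (f x)) -> Ck k f -> Ck k (g \o f).
Proof.
move=> Dg Pf; elim: k g Dg f Pf => [|k IH] g Dg f Pf Cf.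
  split=> // x; apply: continuous_comp; first exact: (Ck_continuous Cf).
  exact: (Dk_continuous Dg).
have [cg [dg Ddg dgE]] := Dg; have [cf df] := Cf.
apply: (@CkS_intro _ _ (fun i x => dg (f x) * 'D_(delta_mx 0 i) f x)).
- by move=> x; apply: continuous_comp; [exact: cf|exact: cg].
- by move=> i x; apply: is_derive_comp; [exact: CkS_elim|exact: dgE].
- move=> i; have [_ Cdf] := df i; apply: Ck_mul => //.
  by apply: (IH dg Ddg f Pf); exact: CkS.
Qed.

End Ck_closure.

Section one_variable.
Variable R : realType.

Lemma is_derive_continuous (g : R -> R) (x a : R) : is_derive x 1 g a -> {for x, continuous g}.
Proof. by move=> [/derivable1_diffP/differentiable_continuous]. Qed.

Lemma DkS_intro (P : set R) k (g dg : R -> R) : Dk P k dg ->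
  (forall x, P x -> is_derive x 1 g (dg x)) -> Dk P k.+1 g.
Proof.
move=> Ddg dgE; split; last by exists dg.
by move=> x Px; exact: is_derive_continuous (dgE x Px).
Qed.

Lemma Dk_lin (P : set R) k (f g : R -> R) a b : Dk P k f -> Dk P k g ->
  Dk P k (fun x => a * f x + b * g x).
Proof.
elim: k f g => [|k IH] f g [cf df] [cg dg].
  by split=> // x Px; apply: continuousD; apply: continuousM; [exact: cvg_cst|exact: cf|exact: cvg_cst|exact: cg].
have [f' Df' f'E] := df; have [g' Dg' g'E] := dg.
apply: (@DkS_intro _ _ _ (fun x => a * f' x + b * g' x)); first exact: IH.
move=> x Px; apply: is_deriveD.
  by apply: (@is_deriveZ _ _ _ f a x 1 (f' x)); exact: f'E.
by apply: (@is_deriveZ _ _ _ g b x 1 (g' x)); exact: g'E.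
Qed.

Lemma Dk_cstM (P : set R) k (f : R -> R) a : Dk P k f -> Dk P k (fun x => a * f x).
Proof.
move=> Df; rewrite (_ : (fun x => _) = fun x => a * f x + 0 * f x); first exact: Dk_lin.
by apply/funext => x; rewrite mul0r addr0.
Qed.

Lemma Dk_powR k (a : R) : Dk [set x | 0 < x] k (fun x => x `^ a).
Proof.
elim: k a => [|k IH] a.
  by split=> // x x0; have := is_derive1_powR a x0; exact: is_derive_continuous.
apply: (@DkS_intro _ _ _ (fun x => a * x `^ (a - 1))).
exact: Dk_cstM.
Qed.

(* the functions [x^-k exp (-1/x)], extended by 0, are stable by derivation up to
   linear combinations *)
Definition flat (k : nat) (x : R) : R := if 0 < x then x^-1 ^+ k * expR (- x^-1) else 0.

Lemma flat_gt0 k x : 0 < x -> 0 < flat k x.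
Proof. by move=> x0; rewrite /flat x0 mulr_gt0 ?exprn_gt0 ?invr_gt0// expR_gt0. Qed.

Lemma flat_ge0 k x : 0 <= flat k x.
Proof. by have [/(flat_gt0 k)/ltW//|x0] := ltP 0 x; rewrite /flat ltNge x0. Qed.

Lemma flat_le0 k x : x <= 0 -> flat k x = 0.
Proof. by move=> x0; rewrite /flat ltNge x0. Qed.

(** From exp(1/x) >= (1 + 1/((k+2) x))^(k+2); the exponent k + 2 leaves a factor x^2 after the
    division by x^k, which makes the derivative at 0 vanish. *)
Lemma flat_quadratic k : exists C, forall x, `|flat k x| <= C * x ^+ 2.
Proof.
exists (k.+2%:R ^+ k.+2) => x; rewrite ger0_norm ?flat_ge0//.
have [x0|x0] := ltP 0 x; last by rewrite flat_le0// mulr_ge0 ?sqr_ge0 ?exprn_ge0.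
rewrite /flat x0 expRN.
have E : (x^-1 / k.+2%:R) ^+ k.+2 <= expR x^-1.
  rewrite (_ : expR x^-1 = expR (x^-1 / k.+2%:R) ^+ k.+2); last first.
    by rewrite -expRM_natr divfK.
  rewrite lerXn2r ?nnegrE ?expR_ge0 ?divr_ge0 ?invr_ge0 ?(ltW x0)//.
  by apply: le_trans (expR_ge1Dx _); rewrite lerDr.
have p0 : 0 < (x^-1 / k.+2%:R) ^+ k.+2 by rewrite exprn_gt0// divr_gt0// invr_gt0.
apply: (@le_trans _ _ (x^-1 ^+ k * ((x^-1 / k.+2%:R) ^+ k.+2)^-1)).
  by rewrite ler_wpM2l ?exprn_ge0 ?invr_ge0 ?(ltW x0)// lef_pV2 ?posrE ?expR_gt0.
rewrite exprMn invfM -!exprVn !invrK !exprVn.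
rewrite (_ : x ^+ k.+2 = x ^+ k * x ^+ 2); last by rewrite -exprD addn2.
have xk : x ^+ k != 0 by rewrite expf_neq0// gt_eqF.
have -> : x ^- k * (x ^+ k * x ^+ 2 * k.+2%:R ^+ k.+2) = x ^- k * x ^+ k * (k.+2%:R ^+ k.+2 * x ^+ 2) by ring.
by rewrite mulVf// mul1r.
Qed.

Lemma is_derive_quadratic (f : R -> R) (C : R) : (forall x, `|f x| <= C * x ^+ 2) ->
  is_derive (0 : R) 1 f 0.
Proof.
move=> fC; have f0 : f 0 = 0.
  by apply/eqP; rewrite -normr_le0 (le_trans (fC 0))// expr2 mul0r mulr0.
have C0 : 0 <= C by have := fC 1; rewrite expr1n mulr1; exact: le_trans.
have H : h^-1 *: ((f \o shift 0) (h *: (1 : R^o)) - f 0) @[h --> 0^'] --> (0 : R^o).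
  apply/cvgrPdist_le => e e0; have r0 : 0 < e / (C + 1) by rewrite divr_gt0// ltr_wpDl.
  near=> h.
  have h0 : h != 0 by near: h; exact: nbhs_dnbhs_neq.
  have hr : `|h| < e / (C + 1).
    near: h; apply: dnbhs0_lt; exact: r0.
  rewrite /= f0 subr0 addr0 sub0r normrN [h *: 1]mulr1 [_ *: _]/(_ * _) normrM normfV.
  rewrite mulrC ler_pdivrMr ?normr_gt0// (le_trans (fC h))//.
  rewrite -[h ^+ 2]ger0_norm ?sqr_ge0// normrX expr2 mulrA ler_wpM2r//.
  apply: (@le_trans _ _ ((C + 1) * (e / (C + 1)))).
    by rewrite ler_pM// ?lerDl ?ltW.
  by rewrite mulrC divfK// gt_eqF// ltr_wpDl.
split; first exact: (cvgP _ H).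
exact: (cvg_lim _ H).
Unshelve. all: by end_near.
Qed.

(** Differentiating x^-k exp(-1/x) gives the functions of indices k + 2 and k + 1, so the family is
    closed up to linear combinations, written in the form of [Dk_lin]. *)
Lemma is_derive_flat k (x : R) : is_derive x 1 (flat k) (1 * flat k.+2 x + (- k%:R) * flat k.+1 x).
Proof.
have [x0|x0|->] := ltgtP x 0.
- rewrite !flat_le0 ?(ltW x0)// !mulr0 addr0.
  apply: near_eq_is_derive (is_derive_cst (0 : R^o) x 1).
  by near=> y; rewrite flat_le0//; apply: ltW; near: y; exact: lt_nbhsl.
- have xn : x != 0 by rewrite gt_eqF.
  have dV : is_derive x 1 (fun y : R => y^-1) (- x ^- 2).
    by have := @is_deriveV R id x 1 1 xn (is_derive_id x 1); rewrite [_ *: _]mulr1.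
  have dX := is_deriveX k dV; rewrite exprfctE in dX.
  have dE : is_derive x 1 (expR \o (fun y : R => - y^-1)) (expR (- x^-1) * x ^- 2).
    have dN : is_derive x 1 (fun y : R => - y^-1) (x ^- 2).
      by have := is_deriveN dV; rewrite opprK.
    exact: is_derive_comp dN (is_derive_expR _).
  have dM : is_derive x 1 (fun y : R => y^-1 ^+ k * expR (- y^-1))
      (1 * flat k.+2 x + (- k%:R) * flat k.+1 x).
    have E : x^-1 ^+ k * (expR (- x^-1) * x ^- 2) +
        expR (- x^-1) * (k%:R * x^-1 ^+ k.-1 * - x ^- 2) =
        1 * flat k.+2 x + (- k%:R) * flat k.+1 x.
      rewrite /flat x0; case: k {dX} => [|k] /=; first by rewrite !expr0; field.
      by rewrite !exprS; field.
    exact: (is_derive_eq (is_deriveM dX dE) E).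
  apply: near_eq_is_derive dM.
  by near=> y; rewrite /flat ifT//; near: y; exact: lt_nbhsr.
- rewrite !flat_le0// !mulr0 addr0.
  by have [C HC] := flat_quadratic k; exact: is_derive_quadratic HC.
Unshelve. all: by end_near.
Qed.

Lemma Dk_flat k j : Dk setT k (flat j).
Proof.
elim: k j => [|k IH] j.
  by split=> // x _; exact: is_derive_continuous (is_derive_flat j x).
apply: (@DkS_intro _ _ _ (fun x => 1 * flat j.+2 x + (- j%:R) * flat j.+1 x)).
  exact: Dk_lin.
by move=> x _; exact: is_derive_flat.
Qed.

End one_variable.

Section smooth_functions.
Variables (R : realType) (m : nat).
Implicit Types f g : 'rV[R]_m -> R.

Lemma smooth_powR f (a : R) : smooth f -> (forall y, 0 < f y) -> smooth (fun y => f y `^ a).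
Proof. by move=> sf f0 k; apply: (Ck_comp (Dk_powR k a) f0 (sf k)). Qed.

Lemma smooth_affine f (a b : R) : smooth f -> smooth (fun y => a * f y + b).
Proof.
by move=> sf k; apply: (Ck_add (Ck_mul (Ck_cst _ k a) (sf k)) (Ck_cst _ k b)).
Qed.

(* the value of f is frozen at [f y0] as soon as it leaves a neighbourhood of
   [f y0], by means of the transition function
   [flat 0 (2 - S) / (flat 0 (2 - S) + flat 0 (S - 1))] *)
Lemma smooth_localisation f y0 : smooth f -> 0 < f y0 ->
  exists g, [/\ smooth g, forall y, 0 < g y &
    forall y, `|f y - f y0| <= f y0 / 2 -> g y = f y].
Proof.
set w0 := f y0 => sf w00.
pose S y := (2 / w0 * f y + - 2) ^+ 2.
have sS : smooth S by move=> k; apply: Ck_exp; apply: smooth_affine.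
have r0 : 0 < w0 / 2 by exact: divr_gt0.
have SE y : S y = (`|f y - w0| / (w0 / 2)) ^+ 2.
  rewrite /S -[LHS]real_normK ?num_real//; congr (_ ^+ 2).
  rewrite (_ : _ + _ = (f y - w0) / (w0 / 2)); last by field; rewrite gt_eqF.
  by rewrite normrM normfV (gtr0_norm r0).
have S0 y : 0 <= S y by exact: sqr_ge0.
pose P y := flat 0 (- 1 * S y + 2).
pose D y := P y + flat 0 (1 * S y + - 1).
have sP : smooth P by move=> k; apply: (Ck_comp (Dk_flat R k 0) (fun _ => I) (smooth_affine _ _ sS k)).
have sD : smooth D.
  by move=> k; apply: (Ck_add (sP k) (Ck_comp (Dk_flat R k 0) (fun _ => I) (smooth_affine _ _ sS k))).
have P0 y : 0 <= P y by exact: flat_ge0.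
have PD y : P y <= D y by rewrite lerDl flat_ge0.
have D0 y : 0 < D y.
  have [S2|S2] := ltP (S y) 2.
    by apply: lt_le_trans (PD y); apply: flat_gt0; lra.
  by apply: ltr_wpDl => //; apply: flat_gt0; lra.
pose chi y := P y * D y `^ (- 1).
have chiE y : chi y = P y / D y by rewrite /chi powR_inv1// ltW.
have sg : smooth (fun y => chi y * (1 * f y + - w0) + w0).
  move=> k; apply: Ck_add (Ck_cst _ k w0).
  apply: (Ck_mul (Ck_mul (sP k) (smooth_powR (-1) sD D0 k))).
  exact: smooth_affine.
exists (fun y => chi y * (1 * f y + - w0) + w0); split=> // y.
  rewrite mul1r; have [S2|S2] := ltP (S y) 2; last first.
    by rewrite chiE /P flat_le0 ?mul0r ?add0r//; lra.
  have c0 : 0 <= chi y by rewrite chiE divr_ge0// ltW.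
  have c1 : chi y <= 1 by rewrite chiE ler_pdivrMr// mul1r.
  have dw : `|f y - w0| < w0.
    rewrite ltNge; apply/negP => wd; move: S2; apply/negP; rewrite -leNgt SE.
    have : 2 <= `|f y - w0| / (w0 / 2) by rewrite ler_pdivlMr// mulrC divfK.
    by nra.
  have : `|chi y * (f y - w0)| < w0.
    rewrite normrM (ger0_norm c0); apply: le_lt_trans dw.
    by rewrite ler_piMl.
  by rewrite ltr_norml; lra.
move=> fy; have S1 : S y <= 1.
  have q1 : `|f y - w0| / (w0 / 2) <= 1 by rewrite ler_pdivrMr// mul1r.
  have q0 : 0 <= `|f y - w0| / (w0 / 2) by rewrite divr_ge0// ltW.
  by rewrite SE; nra.
have DP : D y = P y by rewrite /D [flat 0 (1 * _ + _)]flat_le0 ?addr0//; lra.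
have := D0 y; rewrite chiE DP => Py; rewrite divff ?gt_eqF//.
by rewrite !mul1r subrK.
Qed.

End smooth_functions.

(** * Regularity of the boundary of the rounded cubes *)

Section rounded_cells_boundary.
Variables (R : realType) (n : nat).
Hypothesis n0 : (0 < n)%N.
Variables (N : nat) (h : R) (t : 'rV[int]_n -> R) (idx : seq 'rV[int]_n).
Hypotheses (N0 : (0 < N)%N) (h0 : 0 < h) (t0 : forall m, 1 / 2 < t m < 3 / 4).
Local Notation U := (rounded_cells N h t idx).
Local Notation f m := (bulge N (grid h m) h).
Local Notation z c j x := ((x 0 j - (c 0 j + h / 2)) / (h / 2)).

Let smooth_z (c : 'rV[R]_n) j : smooth (fun x : 'rV[R]_n => z c j x).
Proof.
move=> k; rewrite (_ : (fun x => _) = fun x : 'rV[R]_n => (h / 2)^-1 * x 0 j + - ((c 0 j + h / 2) / (h / 2))).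
  by apply: smooth_affine => l; exact: Ck_coord.
by apply/funext => x; rewrite mulrBl mulrC.
Qed.

Lemma smooth_bulge (c : 'rV[R]_n) : smooth (bulge N c h).
Proof. by move=> k; apply: Ck_sum => i; apply: Ck_exp; exact: smooth_z. Qed.

Let bulge_continuous (c x : 'rV[R]_n) : {for x, continuous (bulge N c h)}.
Proof. exact: Ck_continuous (smooth_bulge c 0%N). Qed.

Lemma open_rounded_cells : open U.
Proof.
rewrite (_ : U = \bigcup_(m in [set` idx]) (f m @^-1` [set y | y < t m])); last first.
  by apply/seteqP; split=> x [m]; exists m.
apply: bigcup_open => m _; apply: open_comp; last exact: open_lt.
by move=> x _; exact: bulge_continuous.
Qed.

(** By the margin of [x], the point [y] is still in the cell of [m]; it also lies in the cell of
    [m'], and cells are disjoint. *)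
Lemma rounded_cells_separated x y m m' : f m x < t m -> f m' y < t m' ->
  `|x - y| < h / (16 * N)%:R -> m = m'.
Proof.
move=> fx fy xy.
have /andP[_ tm] := t0 m; have /andP[_ tm'] := t0 m'.
have ym : cell id (grid h m) h y.
  move=> i; have /andP[x1 x2] := bulge_margin h0 N0 (ltW (lt_trans fx tm)) i.
  have := le_lt_trans (le_coord_norm (x - y) i) xy; rewrite !mxE ltr_norml => /andP[y1 y2].
  by move: x1 x2 y1 y2; rewrite !mxE /=; lra.
have ym' : cell id (grid h m') h y.
  move=> i; have /andP[x1 x2] := bulge_margin h0 N0 (ltW (lt_trans fy tm')) i.
  have m0 : 0 < h / (16 * N)%:R by rewrite divr_gt0// ltr0n muln_gt0.
  by move: x1 x2; rewrite !mxE /=; lra.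
by move: ym ym' => /(cell_grid _ h0) <- /(cell_grid _ h0) <-.
Qed.

(** Points of [U] within half the separation distance from [p] all belong to one piece, so near [p]
    the set is a single sublevel set, and continuity fixes the value at [p]. *)
Lemma rounded_cells_boundary p : boundary U p -> exists m, f m p = t m /\
  \forall x \near p, U x <-> f m x < t m.
Proof.
move=> [clp nip].
have nUp : ~ U p by move=> Up; apply: nip; exact: open_nbhs_nbhs (conj open_rounded_cells Up).
have d0 : 0 < h / (16 * N)%:R / 2 by rewrite !divr_gt0// ltr0n muln_gt0.
have [x [[m mi fx] /= px]] := clp _ (nbhsx_ballx p _ d0).
have loc y : ball p (h / (16 * N)%:R / 2) y -> U y -> f m y < t m.
  move=> py [m' _ fy]; rewrite (rounded_cells_separated fx fy)//.
  move: px py; rewrite -!ball_normE /= distrC => px py.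
  rewrite (_ : x - y = (x - p) + (p - y)); last by rewrite addrA subrK.
  by rewrite (splitr (h / _)) (le_lt_trans (ler_normD _ _))// ltrD.
exists m; split; last first.
  near=> y; split; first by apply: loc; near: y; exact: nbhsx_ballx.
  by exists m.
apply/eqP; rewrite eq_le; apply/andP; split; rewrite leNgt; apply/negP => ft.
  have nb : nbhs p ((f m @^-1` [set y | t m < y]) `&` ball p (h / (16 * N)%:R / 2)).
    apply: filterI; last exact: nbhsx_ballx.
    apply: open_nbhs_nbhs; split=> //; apply: open_comp; last exact: open_gt.
    by move=> y _; exact: bulge_continuous.
  have [y [Uy [/= fy py]]] := clp _ nb.
  by have := loc _ py Uy; rewrite ltNge (ltW fy).
by apply: nUp; exists m.
Unshelve. all: by end_near.
Qed.

(** The level is positive, so some rescaled coordinate of [p] is nonzero, and the equation of the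
    boundary can be solved for it explicitly by a 2N-th root. No implicit function theorem is
    required. *)
Lemma smooth_boundary_rounded_cells : smooth_boundary U.
Proof.
move=> p /rounded_cells_boundary[m [fp Um]].
set c := grid h m in fp Um.
have /andP[t1 t2] := t0 m.
have [i zi] : exists i, z c i p != 0.
  apply: contrapT => /forallNP H; move: t1; rewrite -fp /bulge big1 ?ltNge ?divr_ge0// => i _.
  by have /negP := H i; rewrite negbK => /eqP ->; rewrite expr0n muln_eq0/= -leqn0 leqNgt N0.
(* The sign of that coordinate. The isometry [- sg] puts the set above the graph, as an epigraph
   requires. *)
pose sg : R := if 0 < z c i p then 1 else -1.
have sg2 : sg * sg = 1 by rewrite /sg; case: ifP => _; rewrite ?mulr1// mulrNN mulr1.
have sgz : 0 < sg * z c i p.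
  rewrite /sg; case: ifPn => [?|]; first by rewrite mul1r.
  by rewrite -leNgt mulN1r oppr_gt0 lt_neqAle zi.
have xQ (x : 'rV[R]_n) j : (x *m (- sg)%:M) 0 j = - sg * x 0 j.
  by rewrite mul_mx_scalar !mxE.
(* The value that the 2N-th power of the i-th rescaled coordinate takes on the boundary, as a
   function of the others. *)
pose om (y : 'rV[R]_n.-1) := -1 * (\sum_(k < n.-1)
  ((h / 2)^-1 * (- sg * y 0 k) + - ((c 0 (lift i k) + h / 2) / (h / 2))) ^+ (2 * N)) + t m.
have som : smooth om.
  apply: smooth_affine => k; apply: Ck_sum => j; apply: Ck_exp.
  by apply: smooth_affine => l; apply: (Ck_mul (Ck_cst _ _ _) (Ck_coord _ _ _)).
have omE x : om (col' i (x *m (- sg)%:M)) = t m - f m x + z c i x ^+ (2 * N).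
  rewrite /om /bulge (bigD1_ord i)//= mulN1r.
  rewrite (_ : \sum_(k < n.-1) _ = \sum_(k < n.-1) z c (lift i k) x ^+ (2 * N)); last first.
    apply: eq_bigr => k _; congr (_ ^+ _); rewrite mxE xQ [_ * (_ * x 0 _)]mulrA mulrNN sg2 mul1r.
    by rewrite mulrBl mulrC.
  by rewrite -/c; ring.
have omp : om (col' i (p *m (- sg)%:M)) = z c i p ^+ (2 * N) by rewrite omE fp subrr add0r.
have omp0 : 0 < om (col' i (p *m (- sg)%:M)).
  by rewrite omp exprM exprn_gt0// exprn_even_gt0.
(* The graph function must be smooth on the whole space, whereas the root is smooth only where [om]
   is positive; [g] is positive everywhere and agrees with [om] near the point considered. *)
have [g [sG g0 gE]] := smooth_localisation som omp0.
pose phi y := - (h / 2) * g y `^ (2 * N)%:R^-1 + - sg * (c 0 i + h / 2).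
exists (- sg)%:M, i, phi; split.
- by rewrite tr_scalar_mx -scalar_mxM mulrNN sg2.
- by apply: smooth_affine; exact: smooth_powR.
have csz : {for p, continuous (fun x : 'rV[R]_n => sg * z c i x)}.
  by apply: (@Ck_continuous _ _ 0%N); apply: (Ck_mul (Ck_cst _ _ _) (smooth_z c i 0%N)).
have com : {for p, continuous (fun x : 'rV[R]_n => om (col' i (x *m (- sg)%:M)))}.
  apply: (@Ck_continuous _ _ 0%N).
  rewrite (_ : (fun x : 'rV[R]_n => _) = fun x => (-1 * f m x + t m) + z c i x ^+ (2 * N)).
    by apply: Ck_add; [apply: smooth_affine; exact: smooth_bulge|apply: Ck_exp; exact: smooth_z].
  by apply/funext => x; rewrite omE mulN1r [- _ + _]addrC.
near=> x.
have Ux : U x <-> f m x < t m by near: x.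
have sx : 0 < sg * z c i x.
  by near: x; exact: (cvgr_gt _ csz _ sgz).
have ox : `|om (col' i (x *m (- sg)%:M)) - om (col' i (p *m (- sg)%:M))| <= om (col' i (p *m (- sg)%:M)) / 2.
  by near: x; move/cvgrPdist_le : com => /(_ _ (divr_gt0 omp0 (ltr0Sn _ 1))); under eq_near do rewrite distrC.
have gx := gE _ ox; rewrite omE in gx.
set y := col' i (x *m _) in gx *.
have gy0 := g0 y.
have NN : (0 < 2 * N)%N by rewrite muln_gt0.
set v := g y `^ (2 * N)%:R^-1.
have v0 : 0 <= v by exact: powR_ge0.
have vE : v ^+ (2 * N) = g y.
  by rewrite -powR_mulrn// /v -powRrM mulVf ?powRr1 ?(ltW gy0)// pnatr_eq0 -lt0n.
apply: (iff_trans Ux).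
have -> : (f m x < t m) = (sg * z c i x < v).
  rewrite -[RHS](ltr_pXn2r NN) ?nnegrE ?(ltW sx)// vE gx exprMn exprM expr2 sg2 expr1n mul1r.
  by rewrite ltrDr subr_gt0.
rewrite /phi xQ -/v; have h20 : 0 < h / 2 by rewrite divr_gt0.
rewrite -subr_gt0 -[X in _ <-> is_true X]subr_gt0.
rewrite (_ : - sg * x 0 i - _ = h / 2 * (v - sg * z c i x)) ?pmulr_rgt0//.
by field; rewrite gt_eqF.
Unshelve. all: by end_near.
Qed.

End rounded_cells_boundary.

(** * Lipschitz boundaries *)

(** The rows of [Q] are unit vectors, so its entries are at most 1; isometries do not preserve the
    sup norm, whence the factor [n]. *)
Lemma isometry_norm_le (R : realType) (n : nat) (Q : 'M[R]_n) (x : 'rV[R]_n) :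
  Q *m Q^T = 1%:M -> `|x *m Q| <= n%:R * `|x|.
Proof.
move=> QQ; have Q1 i j : `|Q i j| <= 1.
  have E : (Q *m Q^T) i i = \sum_k Q i k ^+ 2.
    by rewrite mxE; apply: eq_bigr => k _; rewrite mxE.
  have : Q i j ^+ 2 <= 1.
    rewrite (_ : 1 = \sum_k Q i k ^+ 2); last by rewrite -E QQ mxE eqxx.
    by rewrite (bigD1 j)//= lerDl sumr_ge0// => k _; exact: sqr_ge0.
  by rewrite -real_normK ?num_real// expr_le1.
apply/rV_norm_leP => [|j]; first by rewrite mulr_ge0.
rewrite mxE (le_trans (ler_norm_sum _ _ _))//.
apply: (@le_trans _ _ (\sum_(k < n) `|x|)).
  apply: ler_sum => k _; rewrite normrM -[leRHS]mulr1 ler_pM//.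
  exact: le_coord_norm.
by rewrite big_const_ord iter_addr_0 mulr_natl.
Qed.

Section thin.
Context (R : realType) (n : nat) d (T : measurableType d)
  (mu : {sigma_finite_measure set T -> \bar R}) (pt : T -> 'rV[R]_n).
Hypothesis mod : lebesgue_model mu pt.

(* finite upper Minkowski content of codimension one *)
Definition thin (S : set 'rV[R]_n) := exists2 C, 0 <= C & forall r, 0 < r <= 1 ->
  exists B, [/\ measurable B, (mu B <= (C * r)%:E)%E &
    forall x q, S q -> `|pt x - q| <= r -> B x].

Lemma thinS (S S' : set 'rV[R]_n) : S `<=` S' -> thin S' -> thin S.
Proof.
move=> SS [C C0 H]; exists C => // r /H[B [mB muB HB]]; exists B; split=> // x q Sq.
by apply: HB; exact: SS.
Qed.

Lemma thin_bigsetU (I : Type) (s : seq I) (S : I -> set 'rV[R]_n) :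
  (forall i, thin (S i)) -> thin (\big[setU/set0]_(i <- s) S i).
Proof.
move=> H; elim: s => [|i s [C C0 HC]].
  rewrite big_nil; exists 0 => // r _; exists set0; split => //.
  by rewrite measure0 mul0r.
have [C' C'0 HC'] := H i; exists (C' + C); first exact: addr_ge0.
move=> r r01; have [B [mB muB HB]] := HC r r01; have [B' [mB' muB' HB']] := HC' r r01.
exists (B' `|` B); split; first exact: measurableU.
  apply: (le_trans (measureU2 _ mB' mB)); rewrite mulrDl EFinD; exact: leeD.
by move=> x q; rewrite big_cons => -[Sq|Sq] xq; [left; exact: HB' xq|right; exact: HB xq].
Qed.

(** The base coordinates are cut into about [r^-(n-1)] cubes of side [r]. Over each of them the
    Lipschitz graph stays within O(r) of one of its points, so as many balls of volume O(r^n) cover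
    the [r]-neighbourhood. *)
Lemma thin_graph (S : set 'rV[R]_n) (M : R) (Q : 'M[R]_n) (i : 'I_n)
    (phi : 'rV[R]_n.-1 -> R) (lam : R) :
  (forall q, S q -> `|q| <= M) -> Q *m Q^T = 1%:M ->
  (forall x y, `|phi x - phi y| <= lam * `|x - y|) ->
  (forall q, S q -> phi (col' i (q *m Q)) = (q *m Q) 0 i) -> thin S.
Proof.
move=> SM QQ philam SQ.
have QQ' : Q^T *m Q^T^T = 1%:M by rewrite trmxK; exact: mulmx1C.
pose M' := n%:R * `|M|; have M'0 : 0 <= M' by exact: mulr_ge0.
(* Points of [S] with the same index are within [(L - 2) r]. Of the remaining [2 r], one [r] is for
   the neighbourhood and the other for the strict inequality in [nball]. *)
pose L := n%:R * (1 + `|lam|) + 2.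
have L0 : 0 < L by rewrite ltr_wpDl// mulr_ge0// addr_ge0.
have n0 : (0 < n)%N by exact: leq_ltn_trans (ltn_ord i).
exists ((2 * M' + 1) ^+ n.-1 * (2 * L) ^+ n).
  by rewrite mulr_ge0 ?exprn_ge0 ?addr_ge0 ?mulr_ge0 ?(ltW L0).
move=> r /andP[r0 r1].
pose K := (Num.truncn (2 * M' / r)).+1.
pose ind (q : 'rV[R]_n) : {ffun 'I_n.-1 -> 'I_K} :=
  [ffun k => inord (Num.truncn (((q *m Q) 0 (lift i k) + M') / r))].
pose rep f : 'rV[R]_n := xget 0 [set q | S q /\ ind q = f].
have qM q k : S q -> 0 <= ((q *m Q) 0 (lift i k) + M') / r <= 2 * M' / r.
  move=> Sq; have := le_trans (le_coord_norm (q *m Q) (lift i k)) (isometry_norm_le q QQ).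
  have qM' : n%:R * `|q| <= M' by rewrite ler_wpM2l// (le_trans (SM _ Sq))// ler_norm.
  move=> /le_trans/(_ qM'); rewrite ler_norml => /andP[q1 q2].
  rewrite divr_ge0 ?(ltW r0)//=; last by lra.
  by rewrite ler_pM2r ?invr_gt0//; lra.
have indE q k : S q -> ind q k = Num.truncn (((q *m Q) 0 (lift i k) + M') / r) :> nat.
  move=> Sq; rewrite ffunE inordK// ltnS.
  by have /andP[q1 q2] := qM q k Sq; exact: le_truncn.
have rep_near q : S q -> `|q - rep (ind q)| <= (L - 2) * r.
  move=> Sq; have [Srep indrep] : S (rep (ind q)) /\ ind (rep (ind q)) = ind q.
    exact: (@xgetPex _ 0 [set q' | S q' /\ ind q' = ind q] (ex_intro _ q (conj Sq erefl))).
  set q' := rep (ind q) in Srep indrep *.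
  have near_k k : `|((q - q') *m Q) 0 (lift i k)| <= r.
    have := indE q' k Srep; rewrite indrep (indE q k Sq) => E.
    have /andP[a0 _] := qM q k Sq; have /andP[b0 _] := qM q' k Srep.
    have /andP[a1 a2] := truncn_itv a0; have /andP[b1 b2] := truncn_itv b0.
    move: a1 a2 b1 b2; rewrite E -[(_.+1)%:R]natr1 !ler_pdivlMr// !ltr_pdivrMr// => a1 a2 b1 b2.
    rewrite mulmxBl mxE [X in _ + X]mxE ler_norml.
    by move: a1 a2 b1 b2; lra.
  have near_y : `|col' i (q *m Q) - col' i (q' *m Q)| <= r.
    apply/rV_norm_leP => [|k]; first exact: ltW.
    by have := near_k k; rewrite mulmxBl !mxE.
  have near_i : `|((q - q') *m Q) 0 i| <= `|lam| * r.
    rewrite mulmxBl mxE [X in _ + X]mxE -(SQ _ Sq) -(SQ _ Srep).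
    apply: (le_trans (philam _ _)); apply: (le_trans (ler_wpM2r (normr_ge0 _) (ler_norm lam))).
    exact: ler_wpM2l.
  have nearQ : `|(q - q') *m Q| <= (1 + `|lam|) * r.
    apply/rV_norm_leP => [|j]; first by rewrite mulr_ge0 ?addr_ge0// ltW.
    have [k ->|->] := unliftP i j.
      by apply: (le_trans (near_k k)); rewrite ler_peMl ?lerDl// ltW.
    by apply: (le_trans near_i); rewrite ler_wpM2r ?lerDr// ltW.
  rewrite (_ : q - q' = (q - q') *m Q *m Q^T); last by rewrite -mulmxA QQ mulmx1.
  apply: (le_trans (isometry_norm_le _ QQ')).
  by rewrite /L addrK -mulrA ler_wpM2l.
have Lr0 : 0 < L * r by exact: mulr_gt0.
exists (\big[setU/set0]_(f : {ffun 'I_n.-1 -> 'I_K}) nball pt (rep f) (L * r)); split.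
- by apply: bigsetU_measurable => f _; exact: (measurable_nball mod).
- apply: (le_trans (measure_bigsetU_le _ _ (fun f => measurable_nball mod (rep f) (L * r)))).
  rewrite (eq_bigr (fun _ => (((L * r) *+ 2) ^+ n)%:E)); last first.
    by move=> f _; exact: (mu_nball mod).
  rewrite sumEFin sumr_const lee_fin cardT -cardE card_ffun !card_ord.
  have KM : K%:R <= (2 * M' + 1) / r.
    have /andP[t0 _] : (Num.truncn (2 * M' / r))%:R <= 2 * M' / r < (Num.truncn (2 * M' / r)).+1%:R.
      by apply: truncn_itv; rewrite divr_ge0 ?mulr_ge0// ltW.
    rewrite [leRHS]mulrDl [leLHS](_ : _ = (Num.truncn (2 * M' / r))%:R + 1); last by rewrite natr1.
    by rewrite lerD// mul1r invf_ge1.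
  have XE (x : R) : x ^+ n = x * x ^+ n.-1 by rewrite -exprS prednK.
  rewrite -[leLHS]mulr_natr natrX.
  apply: (@le_trans _ _ ((L * r *+ 2) ^+ n * ((2 * M' + 1) / r) ^+ n.-1)).
    rewrite ler_wpM2l ?exprn_ge0 ?mulrn_wge0 ?(ltW Lr0)//.
    by rewrite lerXn2r ?nnegrE ?divr_ge0 ?addr_ge0 ?mulr_ge0// ltW.
  rewrite (_ : L * r *+ 2 = 2 * L * r); last by ring.
  rewrite [(2 * L * r) ^+ n]exprMn [r ^+ n]XE [((2 * M' + 1) / r) ^+ _]exprMn exprVn.
  have rn : r ^+ n.-1 != 0 by rewrite expf_neq0// gt_eqF.
  by rewrite le_eqVlt; apply/orP; left; apply/eqP; field.
- move=> x q Sq xq; rewrite -bigcup_seq; exists (ind q); first by rewrite /= mem_index_enum.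
  rewrite /nball/= distrC (_ : pt x - _ = (pt x - q) + (q - rep (ind q))); last by rewrite addrA subrK.
  apply: (le_lt_trans (ler_normD _ _)).
  apply: (@le_lt_trans _ _ (r + (L - 2) * r)); first by apply: lerD => //; exact: rep_near.
  by rewrite mulrBl; lra.
Qed.

End thin.

Section lipschitz_domain.
Context (R : realType) (n : nat).

Lemma lipschitz_cst (m : nat) (f : 'rV[R]_m -> R) : lipschitz (f : 'rV[R]_m -> R^o) ->
  exists lam, forall x y, `|f x - f y| <= lam * `|x - y|.
Proof.
move=> [k [_ H]]; exists (k + 1) => x y.
have kk : k < k + 1 by rewrite ltrDl.
exact: (H _ kk (x, y)).
Qed.

Lemma lipschitz_continuous (m : nat) (f : 'rV[R]_m -> R) (lam : R) :
  (forall x y, `|f x - f y| <= lam * `|x - y|) -> continuous f.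
Proof.
move=> H x; apply: (@cvgrPdist_lt _ _ _ (nbhs x) _ f (f x)).2 => e e0.
have r0 : 0 < e / (`|lam| + 1) by rewrite divr_gt0// ltr_wpDl.
near=> y; have xy : `|x - y| < e / (`|lam| + 1).
  by near: y; apply: (@cvgr_dist_lt _ _ _ (nbhs x) _ id x) => //; exact: cvg_id.
apply: (le_lt_trans (H x y)); apply: (@le_lt_trans _ _ ((`|lam| + 1) * `|x - y|)).
  by rewrite ler_wpM2r// (le_trans (ler_norm _))// lerDl.
by rewrite mulrC -ltr_pdivlMr// ltr_wpDl.
Unshelve. all: by end_near.
Qed.

(** If the two sides differed at [q], continuity would put [q] in the interior of [U] or outside its
    closure. *)
Lemma boundary_graph (U : set 'rV[R]_n) (V : set 'rV[R]_n) (Q : 'M[R]_n) (i : 'I_n)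
    (phi : 'rV[R]_n.-1 -> R) q : open V -> V q -> boundary U q -> continuous phi ->
  (forall x, V x -> (U x <-> phi (col' i (x *m Q)) < (x *m Q) 0 i)) ->
  phi (col' i (q *m Q)) = (q *m Q) 0 i.
Proof.
move=> oV Vq [clq niq] cphi H.
have cxQ j (x : 'rV[R]_n) : {for x, continuous (fun x : 'rV[R]_n => (x *m Q) 0 j)}.
  apply: (@Ck_continuous _ _ 0%N).
  rewrite (_ : (fun x => _) = fun x : 'rV[R]_n => \sum_k (x 0 k * Q k j)).
    by apply: Ck_sum => k; apply: (Ck_mul (Ck_coord _ _ _) (Ck_cst _ _ _)).
  by apply/funext => y; rewrite mxE.
have ccol (x : 'rV[R]_n) : {for x, continuous (fun x : 'rV[R]_n => col' i (x *m Q))}.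
  apply: (@cvgrPdist_lt _ _ _ (nbhs x) _ (fun x => col' i (x *m Q)) (col' i (x *m Q))).2 => e e0.
  have nk : \forall y \near x, forall k, `|(x *m Q) 0 (lift i k) - (y *m Q) 0 (lift i k)| < e.
    have FF : Filter (nbhs x) := nbhs_filter x.
    have near_k k := (@cvgrPdist_lt _ _ _ (nbhs x) FF _ _).1 (cxQ (lift i k) x) e e0.
    exact: (@filter_forall _ _ _ (nbhs x) FF near_k).
  apply: filterS nk => y H'; apply/rV_norm_ltP => // k.
  by have := H' k; rewrite !mxE.
pose F (x : 'rV[R]_n) := (x *m Q) 0 i - phi (col' i (x *m Q)).
have cF (x : 'rV[R]_n) : {for x, continuous F}.
  apply: continuousB; first exact: cxQ.
  apply: continuous_comp; first exact: ccol.
  exact: cphi.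
apply/eqP; rewrite eq_le; apply/andP; split; rewrite leNgt; apply/negP => lt.
  have nb : nbhs q (V `&` [set x | F x < 0]).
    apply: filterI; first exact: open_nbhs_nbhs.
    by apply: (cvgr_lt _ (cF q)); rewrite subr_lt0.
  have [x [Ux [Vx /= Fx]]] := clq _ nb.
  by have /H := Vx => -[/(_ Ux)]; move: Fx; rewrite /F subr_lt0 => /ltW; rewrite leNgt => /negP.
apply: niq; have nb : nbhs q (V `&` [set x | 0 < F x]).
  apply: filterI; first exact: open_nbhs_nbhs.
  by apply: (cvgr_gt _ (cF q)); rewrite subr_gt0.
apply: filterS nb => x [Vx /=]; rewrite /F subr_gt0 => Fx.
by apply/H.
Unshelve. all: by end_near.
Qed.

Lemma closed_boundary (U : set 'rV[R]_n) : closed (boundary U).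
Proof.
rewrite /boundary setDE; apply: closedI; first exact: closed_closure.
exact: open_closedC (open_interior _).
Qed.

Lemma closed_norm_le (M : R) : closed [set x : 'rV[R]_n | `|x| <= M].
Proof.
rewrite (_ : mkset _ = (fun x : 'rV[R]_n => `|x|) @^-1` [set t | t <= M])//.
apply: closed_comp; last exact: closed_le.
by move=> x _; exact: norm_continuous.
Qed.

Lemma bounded_set_norm (U : set 'rV[R]_n) : bounded_set U -> exists M, forall x, U x -> `|x| <= M.
Proof. by move=> [k [_ H]]; exists (k + 1) => x; apply: H; rewrite ltrDl. Qed.

(** Otherwise the trace of [U] on the segment would be nonempty, open and closed, hence the whole
    segment. *)
Lemma segment_boundary (U : set 'rV[R]_n) x y : open U -> U x -> ~ U y ->
  exists2 q, boundary U q & `|x - q| <= `|x - y|.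
Proof.
move=> oU Ux nUy; apply: contrapT => H.
pose g (t : R) : 'rV[R]_n := t *: (y - x) + x.
have cg : continuous g.
  by move=> t; apply: cvgD; [apply: cvgZr_tmp; exact: cvg_id|exact: cvg_cst].
have /(_ (`[0, 1] `&` g @^-1` U))E := @segment_connected R 0 1.
suff : (`[0, 1]%classic `&` g @^-1` U) 1 by rewrite /g /= scale1r subrK => -[].
rewrite E; first by rewrite /= in_itv/= ler01 lexx.
- by exists 0; split; rewrite /= ?in_itv/= ?lexx ?ler01// /g scale0r add0r.
- by exists (g @^-1` U) => //; apply: open_comp => // t _; exact: cg.
- exists (g @^-1` closure U); first by apply: closed_comp => //; exact: closed_closure.
  apply/seteqP; split=> t [t01 gt]; split=> //; first exact: subset_closure.
  apply: contrapT => nU; apply: H; exists (g t).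
    by split=> // /interior_subset.
  rewrite /g opprD addrCA subrr addr0 normrN normrZ [`|x - y|]distrC.
  move: t01; rewrite /= in_itv/= => /andP[t0 t1].
  by rewrite ger0_norm// ler_piMl.
Qed.

Context d (T : measurableType d)
  (mu : {sigma_finite_measure set T -> \bar R}) (pt : T -> 'rV[R]_n).
Hypothesis mod : lebesgue_model mu pt.

Lemma thin_boundary (U : set 'rV[R]_n) : bounded_set U -> lipschitz_boundary U ->
  thin mu pt (boundary U).
Proof.
move=> bU lU; have [M HM] := bounded_set_norm bU.
have BM q : boundary U q -> `|q| <= M.
  by move=> [clq _]; apply: (@closed_norm_le M); apply: closure_subset clq => x /HM.
have cB : compact (boundary U).
  apply: bounded_closed_compact; last exact: closed_boundary.
  exists M; split; first exact: num_real.
  by move=> x Mx q Bq; apply: le_trans (BM q Bq) (ltW Mx).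
(* Choice needs a neighbourhood for every [p]; away from the boundary the empty set will do. *)
have /boolp.choice[V HV] (p : 'rV[R]_n) : exists V, [/\ open V, boundary U p -> V p & thin mu pt (boundary U `&` V)].
  have [Bp|nBp] := pselect (boundary U p); last first.
    exists set0; split=> //.
    rewrite setI0; have := @thin_bigsetU _ _ _ _ mu pt nat [::] (fun _ => set0).
    rewrite big_nil; apply => i; exists 0 => // r _; exists set0; split=> //.
    by rewrite measure0 mul0r.
  have [Q [i [phi [QQ lphi near_p]]]] := lU p Bp.
  have [lam Hlam] := lipschitz_cst lphi.
  have /nbhs_ballP[V /= nV HV] := near_p; exists (ball p V); split.
  - exact: ball_open.
  - by move=> _; exact: ballxx.
  apply: (thin_graph mod _ QQ Hlam) => [q [Bq _]|q [Bq Vq]]; first exact: BM Bq.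
  apply: (boundary_graph _ Vq Bq); first exact: ball_open.
    exact: lipschitz_continuous Hlam.
  by move=> x Vx; exact: HV.
move: cB; rewrite compact_cover => /(_ 'rV[R]_n (boundary U) V).
case=> [p _|p Bp|D' _ D'cov]; first by have [] := HV p.
  by exists p => //; have [_ + _] := HV p; exact.
have sub : boundary U `<=` \big[setU/set0]_(p <- finmap.enum_fset D') (boundary U `&` V p : set 'rV[R]_n).
  by move=> q Bq; have [p pD Vq] := D'cov q Bq; rewrite -bigcup_seq; exists p.
apply: (thinS sub).
by apply: thin_bigsetU => p; have [] := HV p.
Qed.

Lemma thin_null (S : set 'rV[R]_n) : closed S -> thin mu pt S -> mu (pt @^-1` S) = 0%E.
Proof.
move=> cS [C C0 H]; have mS := closed_measurable_pt mod cS.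
apply/eqP; rewrite eq_le measure_ge0 andbT; apply/lee_addgt0Pr => e e0; rewrite add0e.
pose r := Num.min 1 (e / (C + 1)).
have r0 : 0 < r by rewrite lt_min ltr01 divr_gt0// ltr_wpDl.
have [|B [mB muB HB]] := H r; first by rewrite r0 ge_min lexx.
apply: (@le_trans _ _ (mu B)).
  by apply: le_measure; rewrite ?inE// => x Sx; apply: (HB x _ Sx); rewrite subrr normr0 ltW.
apply: (le_trans muB); rewrite lee_fin.
apply: (@le_trans _ _ ((C + 1) * (e / (C + 1)))).
  by rewrite ler_pM// ?lerDl ?(ltW r0)// ge_min lexx orbT.
by rewrite mulrC divfK// gt_eqF// ltr_wpDl.
Qed.

Variable s : R.
Hypothesis s01 : 0 < s < 1.

(** A pair leaving [U] at distance below 2^-j starts within 2^-j of the boundary, by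
    [segment_boundary]; thinness at [r = 2^-j] supplies the sets [B j] of [energy_minkowski]. *)
Lemma energy_thin (U : set 'rV[R]_n) : open U -> bounded_set U -> thin mu pt (boundary U) ->
  (energy mu (fkernel pt s) (pt @^-1` U) < +oo)%E.
Proof.
move=> oU bU [C C0 H]; have [M HM] := bounded_set_norm bU.
have r01 j : 0 < ((2 : R) ^+ j)^-1 <= 1.
  by rewrite invr_gt0 exprn_gt0//= invf_le1 ?exprn_gt0// exprn_ege1// ler1n.
have /boolp.choice[B HB] (j : nat) := H _ (r01 j).
have mU := open_measurable_pt mod oU.
have M0 : 0 < `|M| + 1 by rewrite ltr_wpDl.
have := @energy_minkowski R n d T mu pt mod s s01 (pt @^-1` U) B (((`|M| + 1) *+ 2) ^+ n) C 1.
move=> /(_ mU (fun j => let: And3 mB _ _ := HB j in mB) ltr01 C0) E.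
apply: le_lt_trans (E _ _ _) (ltry _).
- move=> x y j Ux nUy xy; have [_ _ Bj] := HB j.
  have [q Bq xq] := segment_boundary oU Ux nUy.
  by apply: (Bj x q Bq); apply: (le_trans xq); rewrite ltW// -[X in _ < X]mul1r.
- rewrite -(mu_nball mod 0 M0); apply: le_measure; rewrite ?inE//.
    exact: (measurable_nball mod).
  move=> x Ux; rewrite /nball/= sub0r normrN (le_lt_trans (HM _ Ux))//.
  by rewrite (le_lt_trans (ler_norm _))// ltrDl.
- by move=> j; have [] := HB j.
Qed.

End lipschitz_domain.

(** * Approximation by sets of finite energy *)

Lemma integral_vanishing d (T : measurableType d) (R : realType) (mu : {measure set T -> \bar R})
    (w : T -> \bar R) (D : (set T)^nat) : measurable_fun setT w -> (forall x, 0 <= w x)%E ->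
  (\int[mu]_x w x < +oo)%E -> (forall k, measurable (D k)) ->
  (forall x, \forall k \near \oo, ~ D k x) -> (\int[mu]_(x in D k) w x)%E @[k --> \oo] --> 0%E.
Proof.
move=> mw w0 wfin mD Dx.
have mf k : measurable_fun setT (w \_ (D k)).
  by apply/(measurable_restrictT _ _).1; [|exact: measurable_funS mw].
have wcvg x : (w \_ (D k)) x @[k --> \oo] --> (cst 0%E : T -> \bar R) x.
  apply: cvg_near_cst; apply: filterS (Dx x) => k Dk.
  by rewrite patchE memNset.
have iw : mu.-integrable setT w.
  apply/integrableP; split=> //.
  rewrite (_ : (\int[mu]_x `|w x|)%E = (\int[mu]_x w x)%E)//.
  by apply: eq_integral => x _; rewrite gee0_abs.
have wle x k : (`|(w \_ (D k)) x| <= w x)%E.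
  rewrite patchE; case: ifPn => _; first by rewrite gee0_abs.
  by rewrite abse0.
have [_ _] := @dominated_convergence _ _ _ mu _ measurableT (fun k => w \_ (D k)) (cst 0%E) w
  mf (measurable_cst _) (aeW _ (fun x _ => wcvg x)) iw (aeW _ (fun x k _ => wle x k)).
rewrite integral0 => H.
rewrite (_ : (fun k => _) = fun k => \int[mu]_x (w \_ (D k)) x)%E//.
by apply/funext => k; rewrite integral_mkcond.
Qed.

Section finite_energy_approximation.
Context (R : realType) (n : nat) d (T : measurableType d)
  (mu : {sigma_finite_measure set T -> \bar R}) (pt : T -> 'rV[R]_n).
Hypothesis mod : lebesgue_model mu pt.
Variable s : R.
Hypothesis s01 : 0 < s < 1.
Local Notation K := (fkernel pt s).
Variable w : T -> \bar R.
Hypothesis mw : measurable_fun setT w.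
Hypothesis w0 : forall x, (0 <= w x)%E.
Hypothesis wfin : (\int[mu]_x w x < +oo)%E.
Local Notation nu A := (\int[mu]_(x in A) w x)%E.
Local Notation diff A B := ((A `\` B) `|` (B `\` A)).

Let mwS (A : set T) : measurable_fun A w.
Proof. exact: measurable_funS mw. Qed.

Let nuS (A B : set T) : measurable A -> measurable B -> A `<=` B -> (nu A <= nu B)%E.
Proof. by move=> mA mB AB; apply: ge0_subset_integral. Qed.

Let nuU (A B : set T) : measurable A -> measurable B -> (nu (A `|` B) <= nu A + nu B)%E.
Proof. by move=> mA mB; apply: le_integral_setU. Qed.

(** Closeness is measured by the finite measure with density [w], so continuity from above is
    available on the whole space. *)
Let dense (A : set T) := measurable A /\ forall e : R, 0 < e ->
  exists A', [/\ measurable A', (energy mu K A' < +oo)%E & (nu (diff A A') <= e%:E)%E].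

Let mdiff (A B : set T) : measurable A -> measurable B -> measurable (diff A B).
Proof. by move=> mA mB; apply: measurableU; exact: measurableD. Qed.

Let dense_trans (A : set T) : measurable A -> (forall e : R, 0 < e -> exists B,
  dense B /\ (nu (diff A B) <= e%:E)%E) -> dense A.
Proof.
move=> mA H; split=> // e e0; have e20 : 0 < e / 2 by rewrite divr_gt0.
have [B [[mB dB] AB]] := H _ e20; have [A' [mA' EA' BA']] := dB _ e20.
exists A'; split=> //; rewrite (splitr e) EFinD.
apply: (@le_trans _ _ (nu (diff A B `|` diff B A'))); last first.
  apply: (le_trans (nuU _ _)); [exact: mdiff|exact: mdiff|exact: leeD].
apply: nuS; [exact: mdiff|by apply: measurableU; exact: mdiff|].
move=> x [[Ax nA'x]|[A'x nAx]]; have [Bx|nBx] := pselect (B x).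
- by right; left.
- by left; left.
- by left; right.
- by right; right.
Qed.

Let dense_setC (A : set T) : dense A -> dense (~` A).
Proof.
move=> [mA H]; split; first exact: measurableC.
move=> e /H[A' [mA' EA' AA']]; exists (~` A'); split; first exact: measurableC.
  by rewrite (energyC mu (measurable_fkernel mod s) (fkernel_ge0 pt s) (fun x y => fkernelC pt s x y)).
by rewrite !setDE !setCK setUC [~` A' `&` _]setIC [~` A `&` _]setIC.
Qed.

Let dense_setU (A B : set T) : dense A -> dense B -> dense (A `|` B).
Proof.
move=> [mA HA] [mB HB]; split; first exact: measurableU.
move=> e e0; have e20 : 0 < e / 2 by rewrite divr_gt0.
have [A' [mA' EA' AA']] := HA _ e20; have [B' [mB' EB' BB']] := HB _ e20.
exists (A' `|` B'); split; first exact: measurableU.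
  apply: (le_lt_trans (le_energyU mu (measurable_fkernel mod s) (fkernel_ge0 pt s) mA' mB')).
  exact: lte_add_pinfty.
rewrite (splitr e) EFinD.
apply: (@le_trans _ _ (nu (diff A A' `|` diff B B'))); last first.
  apply: (le_trans (nuU _ _)); [exact: mdiff|exact: mdiff|exact: leeD].
apply: nuS; [by apply: mdiff; exact: measurableU|by apply: measurableU; exact: mdiff|].
move=> x [[[Ax|Bx] /not_orP[nA nB]]|[[Ax|Bx] /not_orP[nA nB]]].
- by left; left.
- by right; left.
- by left; right.
- by right; right.
Qed.

Let energy_finite_dense (A : set T) : measurable A -> (energy mu K A < +oo)%E -> dense A.
Proof.
move=> mA EA; split=> // e e0; exists A; split=> //.
by rewrite setDv setU0 integral_set0 lee_fin ltW.
Qed.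

Let dense_set0 : dense set0.
Proof. by apply: energy_finite_dense => //; rewrite /energy set0X integral_set0. Qed.

(** Finite unions preserve finite energy; the remainder of a countable one has vanishing
    [nu]-measure and is absorbed by [dense_trans]. *)
Let dense_bigcup (A : (set T)^nat) : (forall k, dense (A k)) -> dense (\bigcup_k A k).
Proof.
move=> dA; have mA k : measurable (A k) by have [] := dA k.
have mU : measurable (\bigcup_k A k) by exact: bigcup_measurable.
pose B k := \big[setU/set0]_(i < k) A i.
have mB k : measurable (B k) by exact: bigsetU_measurable.
have BU k : B k `<=` \bigcup_k A k.
  by rewrite /B -(big_mkord xpredT A) -bigcup_seq => x [i _ Ax]; exists i.
apply: dense_trans => // e e0.
have H : nu (\bigcup_k A k `\` B k) @[k --> \oo] --> 0%E.
  apply: (integral_vanishing mw w0 wfin) => [k|x]; first exact: measurableD.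
  have [[i _ Ax]|nAx] := pselect ((\bigcup_k A k) x); last by near=> k => -[].
  near=> k => -[_]; apply; rewrite /B -(big_mkord xpredT A) -bigcup_seq; exists i => //=.
  by rewrite mem_index_iota /=; near: k; exact: nbhs_infty_gt.
near \oo => k; exists (B k); split.
  by rewrite /B; elim/big_ind : _ => //; exact: dense_setU.
rewrite (_ : B k `\` _ = set0) ?setU0; last by apply/seteqP; split=> // x [/BU].
by near: k; exact: cvge0_near_le.
Unshelve. all: by end_near.
Qed.

Let dense_halfspace (i : 'I_n) (a : R) : dense [set x | pt x 0 i < a].
Proof.
set Hs := mkset _; have mH : measurable Hs.
  by apply: measurable_ltr_set; [exact: (model_coord mod)|exact: measurable_cst].
(* The half-space is exhausted by cubes, whose energy is finite. The upper face in direction [i]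
   stays on the hyperplane, and the cubes are centred in the other directions. *)
pose c k : 'rV[R]_n := \row_j if j == i then a - k.+1%:R else - (k.+1%:R / 2).
pose A k := cell pt (c k) k.+1%:R.
have mA k : measurable (A k) by exact: (measurable_cell mod).
have AH k : A k `<=` Hs.
  by move=> x /(_ i); rewrite /Hs/= mxE eqxx subrK => /andP[].
apply: dense_trans => // e e0.
have H : nu (Hs `\` A k) @[k --> \oo] --> 0%E.
  apply: (integral_vanishing mw w0 wfin) => [k|x]; first exact: measurableD.
  near=> k => -[/= xa]; apply => j; rewrite mxE.
  have xk : 2 * `|pt x| + `|a| < k.+1%:R.
    apply: (@lt_le_trans _ _ k%:R); last by rewrite ler_nat.
    by near: k; exact: nbhs_infty_gtr.
  have := le_coord_norm (pt x) j; rewrite ler_norml => /andP[x1 x2].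
  have a1 := ler_norm a; have nx := normr_ge0 (pt x); have na := normr_ge0 a; rewrite /Hs/= in xa.
  by case: ifPn => [/eqP ji|_]; [move: x1 x2; rewrite ji => x1 x2|]; apply/andP; split; lra.
near \oo => k; exists (A k); split.
  apply: energy_finite_dense => //.
  by apply: le_lt_trans (energy_cell mod s01 (c k) _) (ltry _).
rewrite (_ : A k `\` _ = set0) ?setU0; last by apply/seteqP; split=> // x [/AH].
by near: k; exact: cvge0_near_le.
Unshelve. all: by end_near.
Qed.

Let dense_sigma_algebra (f : T -> measurableTypeR R) :
  (forall a, dense [set x | f x < a]) ->
  forall Y, measurable Y -> dense (f @^-1` Y).
Proof.
move=> H; pose C : set (set (measurableTypeR R)) := [set Y | dense (f @^-1` Y)].
have sC : sigma_algebra setT C.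
  split; first by rewrite /C/= preimage_set0.
    by move=> A CA; rewrite setTD /C/= preimage_setC; exact: dense_setC.
  by move=> A CA; rewrite /C/= preimage_bigcup; exact: dense_bigcup.
rewrite [X in forall Y, X Y -> _](_ : _ = <<s @RGenInftyO.G R >>); last first.
  exact: RGenInftyO.measurableE.
apply: smallest_sub => // _ [a ->]; rewrite /C/=.
by rewrite (_ : _ @^-1` _ = [set x | f x < a]).
Qed.

Hypothesis borel_completion : forall A : set T, measurable A ->
  exists B : set 'rV[R]_n, [/\ measurable B, measurable (pt @^-1` B) & mu (diff A (pt @^-1` B)) = 0%E].

(** Half-spaces generate the Borel sets; a measurable set differs from a Borel one by a [mu]-null
    set, which [nu] ignores. *)
Lemma finite_energy_dense (A : set T) (e : R) : measurable A -> 0 < e ->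
  exists A', [/\ measurable A', (energy mu K A' < +oo)%E & (nu (diff A A') <= e%:E)%E].
Proof.
move=> mA; suff [_] : dense A by apply.
apply: dense_trans => // e' e'0.
have [B [mB mB' AB]] := borel_completion mA; exists (pt @^-1` B); split; last first.
  by rewrite null_set_integral ?lee_fin ?ltW//; exact: mdiff.
pose C : set (set 'rV[R]_n) := [set Y | dense (pt @^-1` Y)].
have sC : sigma_algebra setT C.
  split; first by rewrite /C/= preimage_set0.
    by move=> D CD; rewrite setTD /C/= preimage_setC; exact: dense_setC.
  by move=> D CD; rewrite /C/= preimage_bigcup; exact: dense_bigcup.
suff : g_sigma_preimage (@rV_coord R n) `<=` C by exact.
apply: smallest_sub => //; rewrite -bigcup_seq => Z [i _ [Y mY <-]]; rewrite setTI /C/=.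
rewrite -comp_preimage; apply: (dense_sigma_algebra (f := rV_coord i \o pt)) => // a.
exact: dense_halfspace.
Qed.

End finite_energy_approximation.

Section perimeter_kernel.
Context (R : realType) (n : nat) d (T : measurableType d)
  (mu : {sigma_finite_measure set T -> \bar R}) (pt : T -> 'rV[R]_n).
Hypothesis mod : lebesgue_model mu pt.
Variable s : R.
Hypothesis s01 : 0 < s < 1.
Local Notation p := (n%:R + s).
Local Notation K := (fkernel pt s).
Variable Om : set 'rV[R]_n.
Hypothesis oOm : open Om.
Local Notation O := (pt @^-1` Om).

Definition touching : set (T * T) := [set z | Om (pt z.1) \/ Om (pt z.2)].

Definition perimeter_kernel (z : T * T) : R := \1_touching z * K z.
Local Notation W := perimeter_kernel.

Lemma measurable_touching : measurable touching.
Proof.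
have mO := open_measurable_pt mod oOm.
rewrite (_ : touching = O `*` setT `|` setT `*` O).
  by apply: measurableU; exact: measurableX.
by apply/seteqP; split=> -[x y] /=; rewrite /touching/=; tauto.
Qed.

Lemma measurable_perimeter_kernel : measurable_fun setT W.
Proof.
apply: measurable_funM; last exact: (measurable_fkernel mod).
apply: measurable_indic; exact: measurable_touching.
Qed.

Lemma perimeter_kernel_ge0 z : 0 <= W z.
Proof. by rewrite mulr_ge0// fkernel_ge0. Qed.

Lemma perimeter_kernel_le z : W z <= K z.
Proof. by rewrite ler_piMl ?fkernel_ge0// indicE lern1 leq_b1. Qed.

Lemma euclidean_kernel_continuous (u : 'rV[R]_n) : u != 0 ->
  {for u, continuous (fun q : 'rV[R]_n => ((euclidean_norm q) `^ p)^-1)}.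
Proof.
move=> u0; have /andP[s0 _] := s01.
have e0 : 0 < euclidean_norm u.
  by rewrite (lt_le_trans _ (norm_le_euclidean u))// normr_gt0.
rewrite (_ : (fun q => _) = (fun a : R => a `^ (- p)) \o @euclidean_norm R n); last first.
  by apply/funext => q; rewrite /= powRN.
apply: continuous_comp; last exact: is_derive_continuous (is_derive1_powR (- p) e0).
rewrite (_ : @euclidean_norm R n = Num.sqrt \o (fun q => \sum_(i < n) q 0 i ^+ 2))//.
apply: continuous_comp; last exact: sqrt_continuous.
apply: (@Ck_continuous _ _ 0%N); apply: Ck_sum => i; apply: Ck_exp; exact: Ck_coord.
Qed.

(** Off the boundary of [Om], membership in [Om] is locally constant, and the fractional kernel is
    continuous off the diagonal. *)
Lemma perimeter_kernel_continuous z : ~ boundary Om (pt z.1) -> ~ boundary Om (pt z.2) ->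
  z.1 != z.2 -> forall e : R, 0 < e ->
  exists2 del : R, 0 < del & forall w, `|pt w.1 - pt z.1| < del -> `|pt w.2 - pt z.2| < del ->
    `|W w - W z| <= e.
Proof.
case: z => x y /= bx b_y xy e e0.
have loc (q : 'rV[R]_n) : ~ boundary Om q ->
    exists2 del, 0 < del & forall v, `|v - q| < del -> (Om v <-> Om q).
  move=> bq; have [Oq|nOq] := pselect (Om q).
    have /nbhs_ballP[r r0 H] : nbhs q Om by apply: open_nbhs_nbhs; split.
    by exists r => // v vq; split=> // _; apply: H; rewrite -ball_normE /= distrC.
  have /nbhs_ballP[r r0 H] : nbhs q (~` closure Om).
    apply: open_nbhs_nbhs; split; first exact/closed_openC/closed_closure.
    by move=> clq; apply: bq; split=> // /interior_subset.
  exists r => // v vq; split=> // Ov; exfalso.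
  by have : (~` closure Om) v; [apply: H; rewrite -ball_normE /= distrC|apply; exact: subset_closure].
have [d1 d10 H1] := loc _ bx; have [d2 d20 H2] := loc _ b_y.
have u0 : pt x - pt y != 0 by rewrite subr_eq0; apply: contra_neq xy; exact: (model_inj mod).
have /nbhs_ballP[d3 d30 H3] : \forall q \near pt x - pt y,
    `|((euclidean_norm (pt x - pt y)) `^ p)^-1 - ((euclidean_norm q) `^ p)^-1| < e.
  exact: (@cvgrPdist_lt _ _ _ (nbhs (pt x - pt y)) (nbhs_filter _) _ _).1 (euclidean_kernel_continuous u0) e e0.
exists (Num.min (Num.min d1 d2) (d3 / 2)).
  by rewrite !lt_min d10 d20 divr_gt0.
move=> [v w] /=; rewrite !lt_min => /andP[/andP[v1 _] v3] /andP[/andP[_ w2] w3].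
have E : \1_touching (v, w) = \1_touching (x, y) :> R.
  rewrite !indicE; congr (_%:R); congr nat_of_bool; apply/idP/idP; rewrite !inE /touching/=.
    by move=> [/(H1 _ v1)|/(H2 _ w2)]; [left|right].
  by move=> [/(H1 _ v1)|/(H2 _ w2)]; [left|right].
rewrite /W E -mulrBr normrM [X in X * _]ger0_norm// distrC.
apply: (@le_trans _ _ `|K (x, y) - K (v, w)|); first by rewrite ler_piMl// indicE lern1 leq_b1.
apply/ltW/H3; rewrite -ball_normE /=.
rewrite (_ : _ - _ = (pt w - pt y) - (pt v - pt x)); last first.
  by apply/rowP => j; rewrite !mxE; ring.
by rewrite (le_lt_trans (ler_normB _ _))// (splitr d3) ltrD.
Qed.

End perimeter_kernel.

(** * Smooth sets of almost optimal energy *)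

Section smooth_approximation.
Context (R : realType) (n : nat) d (T : measurableType d)
  (mu : {sigma_finite_measure set T -> \bar R}) (pt : T -> 'rV[R]_n).
Hypothesis mod : lebesgue_model mu pt.
Hypothesis borel_completion : forall A : set T, measurable A ->
  exists B : set 'rV[R]_n, [/\ measurable B, measurable (pt @^-1` B) &
    mu ((A `\` (pt @^-1` B)) `|` ((pt @^-1` B) `\` A)) = 0%E].
Hypothesis n0 : (0 < n)%N.
Variable s : R.
Hypothesis s01 : 0 < s < 1.
Local Notation K := (fkernel pt s).
Variable Om : set 'rV[R]_n.
Hypotheses (oOm : open Om) (bOm : bounded_set Om) (tOm : thin mu pt (boundary Om)).
Local Notation O := (pt @^-1` Om).
Local Notation W := (perimeter_kernel pt s Om).
Local Notation diff A B := ((A `\` B) `|` (B `\` A)).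

Let mO : measurable O. Proof. exact: (open_measurable_pt mod). Qed.
Let mK := measurable_fkernel mod s.
Let K0 := fkernel_ge0 pt s.
Let mKE D : measurable_fun D (fun z => (K z)%:E).
Proof. by apply/measurable_EFinP; exact: measurable_funS mK. Qed.
Let mW := measurable_perimeter_kernel mod s oOm.
Let W0 := perimeter_kernel_ge0 pt s Om.
Let mWE D : measurable_fun D (fun z => (W z)%:E).
Proof. by apply/measurable_EFinP; exact: measurable_funS mW. Qed.

(** The potential of [O]: its integral over a set [B] is the interaction of [O] with [B], that is,
    the price of changing a set on [B] outside [O]. *)
Let k (y : T) : \bar R := (\int[mu]_x (\1_O x * K (x, y))%:E)%E.

Let F (z : T * T) : \bar R := (\1_O z.1 * K z)%:E.

Let mF : measurable_fun setT F.
Proof.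
apply/measurable_EFinP; apply: measurable_funM => //.
by apply: (measurableT_comp (measurable_indic mO)); exact: measurable_fst.
Qed.

Let F0 z : (0 <= F z)%E. Proof. by rewrite lee_fin mulr_ge0. Qed.

Let mk : measurable_fun setT k.
Proof. exact: (@measurable_fun_fubini_tonelli_G _ _ _ _ _ mu F mF F0). Qed.

Let k0 y : (0 <= k y)%E.
Proof. by apply: integral_ge0 => x _; rewrite lee_fin mulr_ge0. Qed.

Let integral_potential (B : set T) : measurable B ->
  (\int[mu \x mu]_(z in O `*` B) (K z)%:E = \int[mu]_(y in B) k y)%E.
Proof.
move=> mB; have mOB : measurable (O `*` B) by exact: measurableX.
pose G := (fun z => (K z)%:E) \_ (O `*` B).
have mG : measurable_fun setT G by apply/(measurable_restrictT _ _).1.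
have G0 z : (0 <= G z)%E by apply: erestrict_ge0 => y _; rewrite lee_fin.
rewrite integral_mkcond (fubini_tonelli2 G mG G0).
rewrite [RHS]integral_mkcond; apply: eq_integral => y _.
rewrite [RHS]patchE; case: ifPn => yB.
  apply: eq_integral => x _; rewrite /G patchE indicE in_setX/= yB andbT.
  by case: ifPn => _; rewrite ?mul1r ?mul0r.
by apply: integral0_eq => x _; rewrite /G patchE in_setX/= (negbTE yB) andbF.
Qed.

Let integral_potentialC (B : set T) : measurable B ->
  (\int[mu \x mu]_(z in B `*` O) (K z)%:E = \int[mu]_(y in B) k y)%E.
Proof.
move=> mB; rewrite -integral_potential// integral_mkcond [RHS]integral_mkcond.
rewrite -[RHS]integral_swap; last 2 first.
- by apply/(measurable_restrictT _ _).1 => //; exact: measurableX.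
- by move=> z; apply: erestrict_ge0 => y _; rewrite lee_fin.
apply: eq_integral => -[x y] _; rewrite !patchE !in_setX/= fkernelC.
by congr (if _ then _ else _); rewrite andbC.
Qed.

Lemma smooth_approximation (E : set T) (M e : R) : measurable E -> (energy mu W E < +oo)%E -> 0 < e ->
  exists U : set 'rV[R]_n, [/\ open U, smooth_boundary U,
    (energy mu W (pt @^-1` U) <= energy mu W E + e%:E)%E &
    (mu (diff E (pt @^-1` U) `&` nball pt 0 M) <= e%:E)%E].
Proof.
move=> mE EE e0.
set Bl := nball pt 0 M.
have mBl : measurable Bl by exact: (measurable_nball mod).
have Blfin : (mu Bl < +oo)%E.
  have [M0|M0] := ltP 0 M; first by rewrite (mu_nball mod)// ltry.
  rewrite (_ : Bl = set0) ?measure0//; apply/seteqP; split=> // x; rewrite /Bl /nball/=.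
  by rewrite ltNge (le_trans M0).
have EO : (energy mu K O < +oo)%E by exact: (energy_thin mod).
(* The indicator controls the measure of the change in the ball, and [k] its effect on the
   perimeter. Inside [O] the potential is infinite, but there [E] will be kept as it is. *)
pose w (x : T) : \bar R := ((\1_Bl x)%:E + (k \_ (~` O)) x)%E.
have mkO : measurable_fun setT (k \_ (~` O)).
  by apply/(measurable_restrictT _ _).1; [exact: measurableC|exact: measurable_funS mk].
have m1 : measurable_fun setT (fun x => (\1_Bl x)%:E : \bar R).
  by apply/measurable_EFinP; exact: measurable_indic.
have mw : measurable_fun setT w by exact: emeasurable_funD.
have kO0 x : (0 <= (k \_ (~` O)) x)%E by apply: erestrict_ge0.
have w0 x : (0 <= w x)%E by rewrite adde_ge0// lee_fin.
have wfin : (\int[mu]_x w x < +oo)%E.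
  rewrite ge0_integralD//.
  rewrite integral_indic// setIT -integral_mkcond -integral_potential; last exact: measurableC.
  exact: lte_add_pinfty.
have mwS (A : set T) : measurable_fun A w by exact: measurable_funS mw.
(* The energy grows by at most [6 e1] (four for the modification, one for the step set, one for the
   rounding) and the measure in the ball changes by at most [5 e1]. *)
pose e1 := e / 8; have e10 : 0 < e1 by exact: divr_gt0.
have [A' [mA' EA' AA']] := finite_energy_dense mod s01 mw w0 wfin borel_completion mE e10.
have [M' HM'] := bounded_set_norm bOm.
pose Q j := cell pt (const_mx (- (j.+1%:R / 2))) j.+1%:R.
have mQ j : measurable (Q j) by exact: (measurable_cell mod).
have Qnear (r : R) : \forall j \near \oo, forall x, `|pt x| <= r -> Q j x.
  near=> j => x xr i; rewrite mxE.
  have rj : 2 * r < j.+1%:R.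
    by apply: (@lt_le_trans _ _ j%:R); [near: j; exact: nbhs_infty_gtr|rewrite ler_nat].
  have := le_trans (le_coord_norm (pt x) i) xr; rewrite ler_norml => /andP[x1 x2].
  by apply/andP; split; lra.
have Qvan : (\int[mu]_(x in ~` Q j) w x)%E @[j --> \oo] --> 0%E.
  apply: (integral_vanishing mw w0 wfin) => [j|x]; first exact: measurableC.
  by apply: filterS (Qnear `|pt x|) => j Qj; apply; exact: Qj.
near \oo => j.
have Qw : (\int[mu]_(x in ~` Q j) w x <= e1%:E)%E by near: j; exact: cvge0_near_le.
have QO : O `<=` Q j.
  move=> x /HM'; suff : forall x, `|pt x| <= M' -> Q j x by apply.
  by near: j; exact: Qnear.
pose A2 := A' `&` Q j.
have mA2 : measurable A2 by exact: measurableI.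
have mdiff (A B : set T) : measurable A -> measurable B -> measurable (diff A B).
  by move=> mA mB; apply: measurableU; exact: measurableD.
pose Z := diff E A2.
have mZ : measurable Z by exact: mdiff.
have nuZ : (\int[mu]_(x in Z) w x <= (e1 + e1)%:E)%E.
  apply: (@le_trans _ _ (\int[mu]_(x in diff E A' `|` ~` Q j) w x)%E).
    apply: ge0_subset_integral => //.
      by apply: measurableU; [exact: mdiff|exact: measurableC].
    move=> x [[Ex nA2]|[[A'x Qx] nEx]]; last by left; right.
    have [Qx|nQx] := pselect (Q j x); last by right.
    by left; left; split=> // A'x; apply: nA2.
  rewrite EFinD; apply: (le_trans (le_integral_setU _ _ _ mw w0)); [exact: mdiff|exact: measurableC|].
  exact: leeD.
(* [E] is unchanged in [O] and replaced outside by the bounded set [A2] of finite energy. *)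
pose E2 := (E `&` O) `|` (A2 `\` O).
have mE2 : measurable E2 by apply: measurableU; [exact: measurableI|exact: measurableD].
have E2bd x : E2 x -> `|pt x| <= j.+1%:R.
  move=> Ex; have Qx : Q j x by case: Ex => [[_ /QO]|[[_ ?] _]].
  apply/rV_norm_leP => // i; have := Qx i; rewrite mxE ler_norml => /andP[x1 x2].
  by apply/andP; split; lra.
have EQ : (energy mu K (Q j) < +oo)%E.
  by apply: le_lt_trans (energy_cell mod s01 _ _) (ltry _).
(* A pair leaving [E] intersected with [O] either stays in [O], where [K] equals [W], or leaves [O],
   which has finite energy. The other part comes from sets of finite energy by intersections and a
   complement. *)
have EE2 : (energy mu K E2 < +oo)%E.
  have mOC := measurableC mO.
  apply: (le_lt_trans (le_energyU mu mK K0 _ _)); [exact: measurableI|exact: measurableD|].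
  apply: lte_add_pinfty; last first.
    rewrite setDE; apply: (le_lt_trans (le_energyI mu mK K0 mA2 mOC)); apply: lte_add_pinfty.
      by apply: (le_lt_trans (le_energyI mu mK K0 mA' (mQ j))); exact: lte_add_pinfty.
    by rewrite (energyC mu mK K0 (fun x y => fkernelC pt s x y)).
  have mX (A : set T) : measurable A -> measurable (A `*` ~` A).
    by move=> mA; apply: measurableX => //; exact: measurableC.
  apply: (@le_lt_trans _ _ (energy mu W E + energy mu K O)%E); last exact: lte_add_pinfty.
  have mEO : measurable (E `&` O) by exact: measurableI.
  apply: (@le_trans _ _ (\int[mu \x mu]_(z in (E `&` O) `*` (~` E `&` O) `|` (O `*` ~` O)) (K z)%:E)%E).
    apply: ge0_subset_integral => //; first exact: mX.
    - apply: measurableU; last exact: mX.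
      by apply: measurableX => //; apply: measurableI => //; exact: measurableC.
    - by move=> z _; rewrite lee_fin.
    move=> [x y] [/= [Ex Ox] /not_andP nEy]; have [Oy|nOy] := pselect (O y); last by right.
    by left; split=> //; split=> //; case: nEy.
  have mEOO : measurable ((E `&` O) `*` (~` E `&` O)).
    by apply: measurableX => //; apply: measurableI => //; exact: measurableC.
  have KE0 z : (0 <= (K z)%:E)%E by rewrite lee_fin.
  apply: le_trans (le_integral_setU _ mEOO (mX _ mO) (@mKE setT) KE0) _.
  apply: leeD => //.
  rewrite (_ : (\int[mu \x mu]_(z in (E `&` O) `*` (~` E `&` O)) (K z)%:E)%E =
     (\int[mu \x mu]_(z in (E `&` O) `*` (~` E `&` O)) (W z)%:E)%E); last first.
    apply: eq_integral => -[x y]; rewrite inE => -[/= [_ Ox] _].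
    by rewrite /perimeter_kernel indicE mem_set ?mul1r//; left.
  apply: ge0_subset_integral => //; first exact: mX.
    by move=> z _; rewrite lee_fin.
  by move=> [x y] [/= [? _] [? _]].
pose Z' := Z `\` O.
have mZ' : measurable Z' by exact: measurableD.
have kZ' : (\int[mu]_(x in Z') k x <= (e1 + e1)%:E)%E.
  apply: (le_trans _ nuZ); apply: (@le_trans _ _ (\int[mu]_(x in Z') w x)%E).
    apply: ge0_le_integral => //; first exact: measurable_funS mk.
    move=> x [_ nOx]; rewrite /w patchE mem_set//.
    by rewrite leeDr// lee_fin.
  by apply: ge0_subset_integral => // x [].
have mOZ : measurable (O `*` Z') by exact: measurableX.
have mZO : measurable (Z' `*` O) by exact: measurableX.
have WK := perimeter_kernel_le pt s Om.
have WKint (B : set (T * T)) : measurable B ->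
    (\int[mu \x mu]_(z in B) (W z)%:E <= \int[mu \x mu]_(z in B) (K z)%:E)%E.
  move=> mB; apply: ge0_le_integral => //.
  - by move=> z _; rewrite lee_fin.
  - by move=> z _; rewrite lee_fin.
have WE0 z : (0 <= (W z)%:E)%E by rewrite lee_fin.
(* A touching pair that leaves [E2] but not [E] has one point in [O] and the other in [Z']; both
   orders occur, and each costs at most the integral of [k] over [Z']. *)
have WE2 : (energy mu W E2 <= energy mu W E + ((e1 + e1) + (e1 + e1))%:E)%E.
  have mX (A : set T) : measurable A -> measurable (A `*` ~` A).
    by move=> mA; apply: measurableX => //; exact: measurableC.
  have mZZ : measurable (O `*` Z' `|` Z' `*` O) by exact: measurableU.
  apply: (@le_trans _ _ (\int[mu \x mu]_(z in (E `*` ~` E) `|` (O `*` Z' `|` Z' `*` O)) (W z)%:E)%E).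
    rewrite /energy integral_mkcond [leRHS]integral_mkcond.
    apply: ge0_le_integral => //.
    - by move=> z _; apply: erestrict_ge0.
    - by apply/(measurable_restrictT _ _).1 => //; exact: mX.
    - by apply/(measurable_restrictT _ _).1 => //; apply: measurableU => //; exact: mX.
    move=> [x y] _; rewrite patchE; case: ifPn => [|_]; last by apply: erestrict_ge0.
    rewrite inE => -[/= E2x nE2y]; rewrite patchE; case: ifPn => // /negP xyG.
    rewrite /perimeter_kernel indicE memNset ?mul0r// => Oxy; apply: xyG; rewrite inE.
    have [Ox|nOx] := pselect (O x).
      have Ex : E x by case: E2x => -[].
      have [Ey|nEy] := pselect (E y); last by left.
      right; left; split=> //; split; last by move=> Oy; apply: nE2y; left.
      left; split=> // A2y; have [Oy|nOy] := pselect (O y); apply: nE2y; first by left.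
      by right.
    have Oy : O y by case: Oxy.
    have nEy : ~ E y by move=> Ey; apply: nE2y; left.
    have A2x : A2 x by case: E2x => -[].
    have [Ex|nEx] := pselect (E x); first by left.
    by right; right; split=> //; split=> //; right.
  apply: le_trans (le_integral_setU _ (mX _ mE) mZZ (@mWE setT) WE0) _; apply: leeD2l.
  apply: le_trans (le_integral_setU _ mOZ mZO (@mWE setT) WE0) _; rewrite EFinD; apply: leeD.
    by apply: (le_trans (WKint _ mOZ)); rewrite integral_potential.
  by apply: (le_trans (WKint _ mZO)); rewrite integral_potentialC.
have N0 := thin_null mod (@closed_boundary R n Om) tOm.
have mN := closed_measurable_pt mod (@closed_boundary R n Om).
have [h h0 [idx]] := step_approximation mod n0 s01 mW W0 WK mN N0
  (perimeter_kernel_continuous mod s01 oOm) mE2 E2bd EE2 e10.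
set D := mkset _ => -[mD WD E2D DE2].
have [N [t [N0' t0 [mU WU UD DU]]]] := rounded_cells_energy mod n0 s01 mW W0 WK idx h0 e10.
exists (rounded_cells N h t idx).
split.
- exact: open_rounded_cells.
- exact: smooth_boundary_rounded_cells.
- apply: (le_trans WU); apply: (le_trans (leeD2r _ WD)); rewrite -addeA.
  apply: (le_trans (leeD2r _ WE2)); rewrite -addeA -!EFinD; apply: leeD2l.
  by rewrite lee_fin /e1; lra.
- have mZB : measurable (Z `&` Bl) by exact: measurableI.
  have ZB : (mu (Z `&` Bl) <= (e1 + e1)%:E)%E.
    apply: (le_trans _ nuZ); rewrite setIC -integral_indic//.
    apply: ge0_le_integral => //; last by move=> x _; rewrite /w leeDl.
    by apply: measurable_funS m1.
  pose U := pt @^-1` rounded_cells N h t idx.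
  have mED : measurable (E2 `\` D) by exact: measurableD.
  have mDE : measurable (D `\` E2) by exact: measurableD.
  have mDU : measurable (D `\` U) by exact: measurableD.
  have m12 : measurable (Z `&` Bl `|` (E2 `\` D)) by exact: measurableU.
  have m34 : measurable ((D `\` E2) `|` (D `\` U)) by exact: measurableU.
  apply: (@le_trans _ _ (mu ((Z `&` Bl `|` (E2 `\` D)) `|` ((D `\` E2) `|` (D `\` U))))).
    apply: le_measure; rewrite ?inE; first by apply: measurableI => //; exact: mdiff.
      exact: measurableU.
    move=> x [[[Ex nUx]|[Ux nEx]] Bx].
      have [Dx|nDx] := pselect (D x); first by right; right.
      have [E2x|nE2x] := pselect (E2 x); left; [by right|left; split=> //].
      left; split=> // A2x; apply: nE2x; have [Ox|nOx] := pselect (O x); first by left.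
      by right.
    have Dx := UD _ Ux.
    have [E2x|nE2x] := pselect (E2 x); last by right; left.
    by left; left; split=> //; right; split=> //; case: E2x => -[].
  apply: (le_trans (measureU2 _ m12 m34)).
  apply: (@le_trans _ _ (((e1 + e1) + e1)%:E + (e1 + e1)%:E)%E).
    apply: leeD; rewrite EFinD.
      by apply: (le_trans (measureU2 _ mZB mED)); exact: leeD.
    by apply: (le_trans (measureU2 _ mDE mDU)); exact: leeD.
  by rewrite -EFinD lee_fin /e1; lra.
Unshelve. all: by end_near.
Qed.

End smooth_approximation.

(** * Relaxation *)

Lemma limn_einf_le (R : realType) (u : (\bar R)^nat) (a : \bar R) :
  (forall e : R, 0 < e -> \forall h \near \oo, (u h <= a + e%:E)%E) -> (limn_einf u <= a)%E.
Proof.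
move=> H; rewrite limn_einf_lim; apply: lime_le; first exact: is_cvg_einfs.
near=> k; apply/lee_addgt0Pr => e e0.
have [N _ HN] := H e e0.
apply: (@le_trans _ _ (u (maxn k N))); last by apply: HN; exact: leq_maxr.
by apply: ereal_inf_lbound; exists (maxn k N) => //=; exact: leq_maxl.
Unshelve. all: by end_near.
Qed.

Section relaxation.
Context (R : realType) (n : nat) d (T : measurableType d)
  (mu : {sigma_finite_measure set T -> \bar R}) (pt : T -> 'rV[R]_n).
Hypothesis mod : lebesgue_model mu pt.
Variable s : R.
Hypothesis s01 : 0 < s < 1.
Local Notation K := (fkernel pt s).
Variable Om : set 'rV[R]_n.
Hypothesis oOm : open Om.
Local Notation O := (pt @^-1` Om).
Local Notation W := (perimeter_kernel pt s Om).

Let mO : measurable O. Proof. exact: (open_measurable_pt mod). Qed.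
Let K0 := fkernel_ge0 pt s.
Let mKE (D : set (T * T)) : measurable_fun D (fun z => (K z)%:E).
Proof. by apply/measurable_EFinP; exact: measurable_funS (measurable_fkernel mod s). Qed.
Let W0 := perimeter_kernel_ge0 pt s Om.
Let mW := measurable_perimeter_kernel mod s oOm.

Lemma iterated_integral (A B : set T) : measurable A -> measurable B ->
  (\int[mu]_(x in A) \int[mu]_(y in B) (K (x, y))%:E = \int[mu \x mu]_(z in A `*` B) (K z)%:E)%E.
Proof.
move=> mA mB; have mAB : measurable (A `*` B) by exact: measurableX.
pose G := (fun z => (K z)%:E) \_ (A `*` B).
have mG : measurable_fun setT G by apply/(measurable_restrictT _ _).1 => //; exact: mKE.
have G0 z : (0 <= G z)%E by apply: erestrict_ge0 => y _; rewrite lee_fin.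
rewrite [RHS]integral_mkcond (fubini_tonelli1 G mG G0) [LHS]integral_mkcond.
apply: eq_integral => x _; rewrite patchE; case: ifPn => xA.
  rewrite integral_mkcond; apply: eq_integral => y _.
  by rewrite /G !patchE in_setX/= xA.
by rewrite /fubini_F integral0_eq// => y _; rewrite /G patchE in_setX/= (negbTE xA).
Qed.

(** The three rectangles are disjoint and their union is the part of E x E^c that touches [O]. *)
Lemma perimeter_energy (E : set T) : measurable E ->
  (\int[mu]_(x in E `&` O) \int[mu]_(y in ~` E `&` O) (K (x, y))%:E +
   \int[mu]_(x in E `&` O) \int[mu]_(y in ~` E `\` O) (K (x, y))%:E +
   \int[mu]_(x in E `\` O) \int[mu]_(y in ~` E `&` O) (K (x, y))%:E = energy mu W E)%E.
Proof.
move=> mE; have mEC := measurableC mE.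
have m1 : measurable (E `&` O) by exact: measurableI.
have m2 : measurable (~` E `&` O) by exact: measurableI.
have m3 : measurable (~` E `\` O) by exact: measurableD.
have m4 : measurable (E `\` O) by exact: measurableD.
rewrite !iterated_integral//.
have KE0 z : (0 <= (K z)%:E)%E by rewrite lee_fin.
have mA := measurableX m1 m2; have mB := measurableX m1 m3; have mC := measurableX m4 m2.
have mAB := measurableU _ _ mA mB.
rewrite -(ge0_integral_setU _ mA mB (@mKE _) (fun z _ => KE0 z)); last first.
  by apply/disj_setPS => -[x y] /= [[_ [_ Oy]] [_ [_ nOy]]].
rewrite -(ge0_integral_setU _ mAB mC (@mKE _) (fun z _ => KE0 z)); last first.
  by apply/disj_setPS => -[x y] /= [[[[_ Ox] _]|[[_ Ox] _]] [[_ nOx] _]].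
rewrite /energy integral_mkcond [RHS]integral_mkcond; apply: eq_integral => -[x y] _.
rewrite !patchE /perimeter_kernel; case: (boolP ((x, y) \in E `*` ~` E)) => xyE.
  rewrite inE in xyE; move: xyE => [/= Ex nEy].
  rewrite indicE; case: (boolP ((x, y) \in touching _ _)) => xyO; rewrite ?mul1r ?mul0r.
    rewrite ifT// inE; rewrite inE in xyO.
    have [Ox|nOx] := pselect (O x); last by right; split=> //; split=> //; case: xyO.
    by left; have [Oy|nOy] := pselect (O y); [left|right].
  rewrite ifF//; apply/negbTE/negP => xyG; move/negP: xyO; apply.
  by rewrite inE; rewrite inE in xyG; case: xyG => [[[[_ Ox] _]|[[_ Ox] _]]|[_ [_ Oy]]]; [left|left|right].
rewrite ifF//; apply/negbTE; apply: contra xyE.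
by rewrite !inE => -[[[[? _] [? _]]|[[? _] [? _]]]|[[? _] [? _]]].
Qed.

Definition L1loc_cvg (F : (set 'rV[R]_n)^nat) (E : set T) := forall C : set 'rV[R]_n, compact C ->
  (\int[mu]_(x in pt @^-1` C) (`|\1_(pt @^-1` F h) x - \1_E x|)%R%:E)%E @[h --> \oo] --> 0%E.

Lemma perimeter_lsc (F : (set 'rV[R]_n)^nat) (E : set T) : measurable E ->
  (forall h, open (F h)) -> L1loc_cvg F E ->
  (energy mu W E <= limn_einf (fun h => energy mu W (pt @^-1` F h)))%E.
Proof.
move=> mE oF FE.
pose B (M : nat) : set 'rV[R]_n := [set x | `|x| <= M%:R].
have mB M : measurable (pt @^-1` B M).
  by apply: (closed_measurable_pt mod); exact: closed_norm_le.
apply: (energy_lsc mW W0 _ mE mB) => //.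
- by move=> h; exact: (open_measurable_pt mod).
- move=> M; apply: (@le_lt_trans _ _ (mu (nball pt 0 M.+1%:R))).
    apply: le_measure; rewrite ?inE//; first exact: (measurable_nball mod).
    move=> x; rewrite /B/= /nball/= sub0r normrN => /le_lt_trans; apply.
    by rewrite ltr_nat.
  by rewrite (mu_nball mod)// ltry.
- move=> M M' MM'; apply/subsetPset => x; rewrite /B/= => /le_trans; apply.
  by rewrite ler_nat.
- apply/seteqP; split=> // x _; have [M xM] : exists M : nat, `|pt x| <= M%:R.
    by exists (Num.bound `|pt x|); apply/ltW/archi_boundP.
  by exists M.
- move=> M; apply: FE; apply: bounded_closed_compact; last exact: closed_norm_le.
  exists M%:R; split; first exact: num_real.
  by move=> x Mx q /=; rewrite /B/= => /le_trans; apply; exact: ltW.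
Qed.

Hypothesis borel_completion : forall A : set T, measurable A ->
  exists B : set 'rV[R]_n, [/\ measurable B, measurable (pt @^-1` B) &
    mu ((A `\` (pt @^-1` B)) `|` ((pt @^-1` B) `\` A)) = 0%E].
Hypothesis n0 : (0 < n)%N.
Hypotheses (bOm : bounded_set Om) (lOm : lipschitz_boundary Om).

(** The h-th set is within [1/(h+1)] of [E] on the ball of radius [h]; a compact set is eventually
    inside these balls. *)
Lemma recovery_sequence (E : set T) : measurable E -> (energy mu W E < +oo)%E ->
  exists F : (set 'rV[R]_n)^nat, [/\ forall h, open (F h) /\ smooth_boundary (F h),
    L1loc_cvg F E & (limn_einf (fun h => energy mu W (pt @^-1` F h)) <= energy mu W E)%E].
Proof.
move=> mE EE; have tOm := thin_boundary mod bOm lOm.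
have i0 (i : nat) : 0 < i.+1%:R^-1 :> R by rewrite invr_gt0.
have /boolp.choice[F HF] (i : nat) :=
  smooth_approximation mod borel_completion n0 s01 oOm bOm tOm i%:R mE EE (i0 i).
exists F; split.
- by move=> h; have [] := HF h.
- move=> C cC; have mC : measurable (pt @^-1` C).
    by apply: (closed_measurable_pt mod); exact: compact_closed (@norm_hausdorff _ _) cC.
  have [M HM] := bounded_set_norm (compact_bounded cC).
  apply: cvge_dist_le => e e0; near=> h.
  have mF : measurable (pt @^-1` F h).
    by apply: (open_measurable_pt mod); have [] := HF h.
  have mf : measurable_fun setT (fun x => (`|\1_(pt @^-1` F h) x - \1_E x|)%R%:E : \bar R).
    apply/measurable_EFinP; apply: measurableT_comp => //.
    by apply: measurable_funB; exact: measurable_indic.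
  rewrite sub0r add0r; apply/andP; split.
    apply: (@le_trans _ _ 0%E); first by rewrite lee_fin oppr_le0 ltW.
    by apply: integral_ge0 => x _; rewrite lee_fin.
  have [_ _ _ Hd] := HF h.
  set D := (E `\` _) `|` _ in Hd.
  have mD : measurable D by apply: measurableU; exact: measurableD.
  have he : h.+1%:R^-1 <= e by near: h; exact: near_invn_le.
  have hM : M < h%:R by near: h; exact: nbhs_infty_gtr.
  have mB := measurable_nball mod 0 h%:R.
  apply: (@le_trans _ _ (h.+1%:R^-1)%:E); last by rewrite lee_fin.
  apply: (le_trans _ Hd); rewrite -integral_indic//.
  apply: (@le_trans _ _ (\int[mu]_(x in nball pt 0 h%:R) (`|\1_(pt @^-1` F h) x - \1_E x|)%R%:E)%E).
    apply: ge0_subset_integral => //; first exact: measurable_funS mf.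
    by move=> x /HM Cx; rewrite /nball/= sub0r normrN (le_lt_trans Cx).
  rewrite le_eqVlt; apply/orP; left; apply/eqP; apply: eq_integral => x _; congr (_%:E).
  have [Fx|nFx] := pselect ((pt @^-1` F h) x); have [Ex|nEx] := pselect (E x).
  + by rewrite !indicE (mem_set Fx) (mem_set Ex) subrr normr0 memNset// => -[[]|[]].
  + rewrite !indicE (mem_set Fx) (memNset nEx) subr0 normr1 mem_set//.
    by right.
  + rewrite !indicE (memNset nFx) (mem_set Ex) sub0r normrN1 mem_set//.
    by left.
  + by rewrite !indicE (memNset nFx) (memNset nEx) subr0 normr0 memNset// => -[[]|[]].
- apply: limn_einf_le => e e0; near=> h.
  have [_ _ + _] := HF h => /le_trans; apply; apply: leeD2l; rewrite lee_fin.
  by near: h; exact: near_invn_le.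
Unshelve. all: by end_near.
Qed.

End relaxation.

(** * Measurable hulls for a completed measure *)

Section completion_hull.
Context d (S : measurableType d) (R : realType) (m : {sigma_finite_measure set S -> \bar R}).
Local Notation C := (caratheodory_type ((m : set S -> \bar R)^*)%mu).
Let nu : {measure set C -> \bar R} := @completed_measure_extension _ _ _ m.

Let cara (B : set S) : measurable B -> measurable (B : set C).
Proof. exact: caratheodory_measurable_mu_ext. Qed.

Let nuE (B : set S) : measurable B -> nu B = m B.
Proof. by move=> mB; apply: measurable_mu_extE. Qed.

(** The completed measure is an infimum over countable measurable covers; when it is finite,
    subtracting it from the measure of a nearly optimal cover bounds the excess. *)
Let hull_eps (A : set C) (e : R) : measurable A -> (nu A < +oo)%E -> 0 < e ->
  exists B : set S, [/\ measurable B, A `<=` B & (nu (B `\` A) <= e%:E)%E].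
Proof.
move=> mA Afin e0.
have Af : nu A \is a fin_num by rewrite ge0_fin_numE// measure_ge0.
have [_ [F [mF AF] <-] HF] := lb_ereal_inf_adherent e0 Af.
have mB : measurable (\bigcup_k F k) by exact: bigcup_measurable.
exists (\bigcup_k F k); split=> //.
have BA : (nu (\bigcup_k F k) <= nu A + e%:E)%E.
  have sub : (m (\bigcup_k F k) <= \sum_(k <oo) m (F k))%E by exact: measure_sigma_subadditive.
  by rewrite nuE//; exact: le_trans sub (ltW HF).
move: BA; rewrite (measureDI nu (cara mB) mA) (_ : (\bigcup_k F k : set C) `&` A = A); last first.
  by apply/setIidr.
by rewrite addeC leeD2lE.
Qed.

Lemma completion_hull (A : set C) : measurable A ->
  exists B : set S, [/\ measurable B, A `<=` B & nu (B `\` A) = 0%E].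
Proof.
move=> mA; have /sigma_finiteP[F [FT ndF Foo]] := sigma_finiteT m.
have mAF k : measurable (A `&` F k : set C).
  by apply: measurableI => //; apply: cara; have [] := Foo k.
have AFfin k : (nu (A `&` F k) < +oo)%E.
  have [mF Fk] := Foo k; have Fk' : (nu (F k : set C) < +oo)%E by rewrite nuE.
  apply: le_lt_trans Fk'.
  by apply: le_measure; rewrite ?inE//; exact: cara.
have e0 (i : nat) : 0 < i.+1%:R^-1 :> R by rewrite invr_gt0.
have /boolp.choice[G HG] (ki : nat * nat) := hull_eps (mAF ki.1) (AFfin ki.1) (e0 ki.2).
(* Intersecting over the tolerances removes the excess on each piece of finite measure, and the
   union over [k] then loses only a countable union of null sets. *)
pose H k := \bigcap_i G (k, i).
have mH k : measurable (H k) by apply: bigcapT_measurable => i; have [] := HG (k, i).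
have AH k : A `&` F k `<=` H k by move=> x Ax i _; have [_ + _] := HG (k, i); apply.
exists (\bigcup_k H k); split.
- exact: bigcup_measurable.
- move=> x Ax; have [k _ Fx] : (\bigcup_k F k) x by rewrite -FT.
  by exists k => //; exact: AH.
have mHA k : measurable (H k `\` (A `&` F k) : set C).
  by apply: measurableD; [exact: cara|exact: mAF].
have H0 k : nu (H k `\` (A `&` F k)) = 0%E.
  apply/eqP; rewrite eq_le measure_ge0 andbT; apply/lee_addgt0Pr => e' e'0; rewrite add0e.
  near \oo => i; have [mG _ HGe] := HG (k, i).
  apply: (@le_trans _ _ (i.+1%:R^-1)%:E); last by rewrite lee_fin; near: i; exact: near_invn_le.
  apply: le_trans HGe; apply: le_measure; rewrite ?inE.
  - exact: mHA.
  - by apply: measurableD; [exact: cara|exact: mAF].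
  by move=> x [Hx nAx]; split=> //; exact: Hx.
apply/eqP; rewrite eq_le measure_ge0 andbT.
apply: (@le_trans _ _ (\sum_(k <oo) nu (H k `\` (A `&` F k)))%E); last first.
  by rewrite eseries0.
apply: measure_sigma_subadditive => //.
  by apply: measurableD => //; apply: cara; exact: bigcup_measurable.
move=> x [[k _ Hx] nAx]; exists k => //; split=> // -[Ax _].
exact: nAx.
Unshelve. all: by end_near.
Qed.

End completion_hull.

(** * Transfer to the Lebesgue measure *)

Section lebesgue_instance.
Variables (R : realType) (n : nat).
Local Notation T := (lebesgue_space R n).
Local Notation pt := (fun x : T => x : 'rV[R]_n).

Lemma lebesgue_model_leb : lebesgue_model (@leb R n) pt.
Proof.
apply: LebesgueModel; first by move=> x y.
  exact: measurable_coord.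
exact: leb_box.
Qed.

Lemma leb_borel_completion (A : set T) : measurable A ->
  exists B : set 'rV[R]_n, [/\ measurable B, measurable (pt @^-1` B) &
    @leb R n ((A `\` (pt @^-1` B)) `|` ((pt @^-1` B) `\` A)) = 0%E].
Proof.
move=> mA; have [B [mB AB nB]] := completion_hull mA.
exists B; split; first exact: mB.
  exact: borel_lebesgue_measurable.
rewrite (_ : A `\` _ = set0); last by apply/seteqP; split=> // x [/AB].
by rewrite set0U.
Qed.

Variables (s : R) (Om : set 'rV[R]_n).
Hypothesis oOm : open Om.

Lemma s_perimeterE (E : set 'rV[R]_n) : lebesgue_measurable E ->
  s_perimeter s E Om = energy (@leb R n) (perimeter_kernel pt s Om) E.
Proof. by move=> mE; exact: (perimeter_energy lebesgue_model_leb s oOm mE). Qed.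

Lemma open_lebesgue_measurable (U : set 'rV[R]_n) : open U -> lebesgue_measurable U.
Proof. exact: (open_measurable_pt lebesgue_model_leb). Qed.

End lebesgue_instance.

Theorem corollary1p4 (R : realType) (n : nat) (hn : (0 < n)%N) (s : R)
    (hs : 0 < s < 1) (Omega : set 'rV[R]_n) (oOmega : open Omega)
    (bOmega : bounded_set Omega) (lOmega : lipschitz_boundary Omega)
    (E : set 'rV[R]_n) (mE : lebesgue_measurable E) :
  s_perimeter s E Omega =
  ereal_inf [set limn_einf (fun h => s_perimeter s (F h) Omega) | F in
    [set F : (set 'rV[R]_n)^nat |
      (forall h, open (F h) /\ smooth_boundary (F h)) /\ loc_cvg F E]].
Proof.
pose mod := @lebesgue_model_leb R n.
have FE (F : (set 'rV[R]_n)^nat) : (forall h, open (F h) /\ smooth_boundary (F h)) ->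
    (fun h => s_perimeter s (F h) Omega) =
    (fun h => energy (@leb R n) (perimeter_kernel (fun x : lebesgue_space R n => x : 'rV[R]_n) s Omega) (F h)).
  move=> HF; apply/funext => h; apply: s_perimeterE => //.
  by apply: open_lebesgue_measurable; have [] := HF h.
rewrite (s_perimeterE s oOmega mE).
apply/eqP; rewrite eq_le; apply/andP; split.
  apply: le_ereal_inf_tmp => _ [F [HF cF] <-]; rewrite FE//.
  apply: (perimeter_lsc mod s oOmega mE (F := F) _ cF) => h.
  by have [] := HF h.
set P := energy _ _ _.
have [->|Pfin] := eqVneq P +oo%E; first exact: leey.
have {Pfin}EE : (P < +oo)%E by rewrite ltey.
have [F [HF cF leP]] := recovery_sequence mod hs oOmega (@leb_borel_completion R n) hn bOmega lOmega mE EE.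
apply: le_trans leP; apply: ereal_inf_lbound; exists F; first by split.
by rewrite FE.
Qed.
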